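(* Let $A=\sigma 2^\omega\subset C=2^\omega$ be the set of binary sequences with only finitely many nonzero terms. Then the space $\nu\mu_0(A)$ can be embedded as a closed subspace in a metrizable topological group $G$ with $\operatorname{ind} G=0$ and $\dim G>0$. In particular, there exists a metrizable topological group $G$ for which $\operatorname{ind} G\ne\dim G$.
   Context: $\operatorname{ind}$ is the small inductive dimension and $\dim$ is the covering dimension. $C=2^\omega$ is the Cantor set with the product topology. For $x\in C$, $x|_n$ denotes the restriction of $x$ to $\{0,\dots,n-1\}$. Elements of $C^\omega$ are sequences $\boldsymbol{x}=(\boldsymbol{x}(n))_{n\in\omega}$ with $\boldsymbol{x}(n)\in C$. Let $I=[0,1]$. For $t\in I$: if $t=(2k+1)/2^n$ with integers $k\ge 0$, $n\ge 1$, then $\operatorname{ord} t=n$; $\operatorname{ord} 0=\operatorname{ord} 1=0$; for all other $t\in I$, $\operatorname{ord} t=\infty$. For $n\in\omega$ and $t\in(0,1)$, let $I_n(t)=(a_n(t),b_n(t))$, where $a_n(t)$ and $b_n(t)$ are the dyadic rationals of minimal order for which $b_n(t)-a_n(t)=1/2^n$ and $t\in(a_n(t),b_n(t))$. Thus, if $0<\operatorname{ord} t\le n$ and $t=k/2^n$, then $I_n(t)=((2k-1)/2^{n+1},(2k+1)/2^{n+1})$; if $\operatorname{ord} t>n$, then $I_n(t)=(k/2^n,(k+1)/2^n)$ for the integer $k$ for which this interval contains $t$. Also $I_n(0)=[0,1/2^{n+1})$ and $I_n(1)=(1-1/2^{n+1},1]$. For $A\subset C$, $$\nu\mu_0(A)=\{(\boldsymbol{x},t)\in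 C^\omega\times I:\ \boldsymbol{x}(n)\in A \text{ for } n\ne\operatorname{ord} t,\ \boldsymbol{x}(n)\in C\setminus A \text{ for } n=\operatorname{ord} t\},$$ endowed with the topology generated by the sets $U_n(\boldsymbol{x},t)$, where $(\boldsymbol{x},t)\in\nu\mu_0(A)$, $n\in\omega$, defined as follows. If $n<\operatorname{ord} t$, then $$U_n(\boldsymbol{x},t)=\{(\boldsymbol{y},s)\in\nu\mu_0(A):\ s\in I_n(t),\ \boldsymbol{y}(i)=\boldsymbol{x}(i)\text{ for } i\le n\}.$$ If $\operatorname{ord} t\le n$, then $$U_n(\boldsymbol{x},t)=\{(\boldsymbol{y},s)\in\nu\mu_0(A):\ s\in I_n(t);\ \boldsymbol{y}(i)=\boldsymbol{x}(i)\text{ for } i\le n+1,\ i\ne\operatorname{ord} t;\ \boldsymbol{y}(i)|_{n+1}=\boldsymbol{x}(i)|_{n+1}\text{ for } i=\operatorname{ord} t\}.$$ *)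

(* Defs.v *)
From HB Require Import structures.
From mathcomp Require Import all_boot all_order all_algebra.
From mathcomp Require Import all_classical all_reals all_analysis.

Set Implicit Arguments.
Unset Strict Implicit.
Unset Printing Implicit Defensive.

Import Order.TTheory GRing.Theory Num.Theory.

Local Open Scope classical_set_scope.
Local Open Scope ring_scope.

(* Topological groups, not necessarily commutative and written
   multiplicatively; no separation axiom is included. *)

HB.mixin Record isTopologicalGroup G & Topological G & Group G := {
  mulg_continuous : continuous (fun p : G * G => (p.1 * p.2)%g) ;
  invg_continuous : continuous (fun x : G => (x^-1)%g)
}.

#[short(type="topologicalGroupType")]
HB.structure Definition TopologicalGroup :=
  {G of Topological G & Group G & isTopologicalGroup G}.

Definition homeomorphic (S T : topologicalType) : Prop :=
  exists (f : S -> T) (g : T -> S),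
    [/\ cancel f g, cancel g f, continuous f & continuous g].

Definition metrizable (R : realType) (T : topologicalType) : Prop :=
  exists M : metricType R, homeomorphic T M.

(* Here the set [Z], coerced to the type [set_type Z], carries the subspace
   topology. *)
Definition embeds_as_closed_subspace (S T : topologicalType) : Prop :=
  exists2 Z : set T, closed Z & homeomorphic S Z.

Definition boundary (T : topologicalType) (U : set T) : set T :=
  closure U `\` U°.

(* Dimension functions take their values in {-1, 0, 1, ...} together with +oo.
   If [P n] says that the dimension is at most n - 1, then [dim_value P] is the
   dimension. *)
Definition dim_value (P : nat -> Prop) : \bar int :=
  if pselect (exists n, `[< P n >]) is left e
  then ((ex_minn e)%:Z - 1)%:E else +oo%E.

(* The index is shifted by one: [small_ind_le_pred n T] means that the small
   inductive dimension of T is at most n - 1. *)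
Fixpoint small_ind_le_pred (n : nat) (T : topologicalType) : Prop :=
  if n is m.+1 then
    forall (x : T) (V : set T), nbhs x V ->
      exists U : set T,
        [/\ open U, U x, U `<=` V & small_ind_le_pred m (boundary U)]
  else [set: T] = set0.

Definition small_ind (T : topologicalType) : \bar int :=
  dim_value (fun n => small_ind_le_pred n T).

Definition open_cover (T : topologicalType) k (U : 'I_k -> set T) : Prop :=
  (forall i, open (U i)) /\ \bigcup_i U i = [set: T].

(* [covering_dim_le_pred n T] means that the covering dimension of T is at most
   n - 1: every finite open cover has a finite open refinement such that each
   point lies in at most n of its members. *)
Definition covering_dim_le_pred (n : nat) (T : topologicalType) : Prop :=
  forall k (U : 'I_k -> set T), open_cover U ->
    exists m (V : 'I_m -> set T),
      [/\ open_cover V,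
          forall j, exists i, V j `<=` U i
        & forall x, (#|[set j | `[< V j x >]]%SET| <= n)%N].

Definition covering_dim (T : topologicalType) : \bar int :=
  dim_value (fun n => covering_dim_le_pred n T).

(* The set of binary sequences with finitely many nonzero terms. *)
Definition sigma2 : set cantor_space :=
  [set x : cantor_space | finite_set [set n : nat | x n = true]].

Section NuMu0.
Variable R : realType.
Implicit Types t s : R.

Definition has_dyadic_ord t (n : nat) : Prop :=
  if n is 0 then t = 0 \/ t = 1
  else exists k : nat, t = (k.*2.+1)%:R / 2 ^+ n.

(* [None] stands for the order infinity. *)
Definition dyadic_ord t : option nat :=
  if pselect (exists n, has_dyadic_ord t n) is left e then Some (projT1 (cid e))
  else None.

Definition dyadic_ord_le t (n : nat) : bool :=
  if dyadic_ord t is Some m then (m <= n)%N else false.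

(* For 0 < t < 1 the endpoints of I_n(t), where k = floor (2^n t); if
   ord t <= n, then t = k / 2^n. *)
Definition dyadic_left n t : R :=
  let k := Num.floor (2 ^+ n * t) in
  if dyadic_ord_le t n then (2 * k - 1)%:~R / 2 ^+ n.+1
  else k%:~R / 2 ^+ n.

Definition dyadic_right n t : R :=
  let k := Num.floor (2 ^+ n * t) in
  if dyadic_ord_le t n then (2 * k + 1)%:~R / 2 ^+ n.+1
  else (k + 1)%:~R / 2 ^+ n.

Definition dyadic_nbhd n t : set R :=
  if t == 0 then [set` `[0, 1 / 2 ^+ n.+1[ ]
  else if t == 1 then [set` `]1 - 1 / 2 ^+ n.+1, 1] ]
  else [set` `]dyadic_left n t, dyadic_right n t[ ].

Definition numu0_set (A : set cantor_space) :
    set ((nat -> cantor_space) * R) :=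
  [set p | [/\ p.2 \in `[0, 1],
               forall n, Some n <> dyadic_ord p.2 -> A (p.1 n)
             & forall n, Some n = dyadic_ord p.2 -> ~ A (p.1 n)]].

(* A separate constant, because the topology is not the one induced by the
   product. *)
Definition numu0 (A : set cantor_space) : Type := set_type (numu0_set A).

HB.instance Definition _ A := Choice.on (numu0 A).

Section Topology.
Variable A : set cantor_space.

Definition numu0_seq (p : numu0 A) : nat -> cantor_space := (set_val p).1.

Definition numu0_time (p : numu0 A) : R := (set_val p).2.

Definition basic_nbhd (n : nat) (p : numu0 A) : set (numu0 A) :=
  let x := numu0_seq p in
  let t := numu0_time p in
  if dyadic_ord_le t n then
    [set q | [/\ dyadic_nbhd n t (numu0_time q),
                 forall i, (i <= n.+1)%N -> Some i <> dyadic_ord t ->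
                   numu0_seq q i = x i
               & forall i, Some i = dyadic_ord t ->
                   forall j, (j < n.+1)%N -> numu0_seq q i j = x i j]]
  else
    [set q | dyadic_nbhd n t (numu0_time q) /\
             forall i, (i <= n)%N -> numu0_seq q i = x i].

HB.instance Definition _ := isSubBaseTopological.Build (numu0 A)
  [set U | exists n p, U = basic_nbhd n p] id.

End Topology.
End NuMu0.

(* Main.v *)
Require Import Defs.
From HB Require Import structures.
From mathcomp Require Import all_boot all_order all_algebra finmap.
From mathcomp Require Import all_classical all_reals all_analysis.
From mathcomp Require Import zify ring lra.

Set Implicit Arguments.
Unset Strict Implicit.
Unset Printing Implicit Defensive.
Import Order.TTheory GRing.Theory Num.Theory.

(** The group is the Boolean group of the finite subsets of a set Z, with
    symmetric difference as product.  Z carries relations [near n] that form a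
    base of a uniformity and are clopen in the square of Z
    ([clopen_uniformity]).  A finite set has norm at most r if it is a sum of
    pairs {p} + {q} in which at most r * 2 ^ m pairs are of level m, that is,
    with p and q as near as [pairscale m] demands.  The norm gives an invariant
    metric in which Z, as the set of singletons, is closed
    ([boolean_group_metrizable], [singletons_embed]).

    The group has a base of clopen sets ([boolean_group_ind]).  For a finite set
    F, the classes of the [cluster] relations arise level by level, from fine to
    coarse: classes with an odd number of points of F are merged if they come
    close to each other.  F is [small] if there are few odd classes at every
    level.  Nearness improves so fast with the level that all chains of links and
    pairs of one level stay within the margin between two scales.  Hence, first,
    smallness survives a change of F by short pairs ([small_local]): coarse
    clusters are copied because [near] is clopen, and at fine levels the odd
    classes are too few to matter.  So small sets form a clopen set.  Secondly, a
    small set is a sum of few short pairs, which move representatives of the odd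
    classes from one level to the next ([small_decomposition]).  So the clopen
    sets of small sets shrink to the unit.

    The covering dimension is positive as soon as Z contains two sets, not near
    to each other, that no locally constant predicate separates: in dimension
    zero the closures of their images would be separated by a clopen set
    ([covering_separation]).  Therefore Z is taken to be a disjoint sum of
    numu0 and an auxiliary space of threads.

    On numu0 there are countably many clopen sets that generate the topology
    ([numu0_nbhsP]): a digit of a letter is one; the letter i is a given finite
    word, continued by zeros; the letter m is a given finite word and the time is
    before u, where u is a dyadic number of order m.  The last set is clopen
    because a point of time u has no finite word in place m.

    A thread consists of a sequence of letters, each an infinite binary
    sequence, and of a branch of the binary tree.  In a plain thread the letters
    are recurrent, a property of comeager many letters, and the branch is not
    eventually constant.  In a thread glued at depth m, the letter m is not
    recurrent but codes all the rest; such a thread lies on the wall between the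
    two subtrees at depth m of its branch, and plain threads on both sides are
    near to it.  As the coding letter determines the thread, [near] is clopen
    ([ynear_stable]).  Yet every locally constant predicate takes one value on
    all branches of some sequence of letters ([constant_fibre]), so that it
    cannot separate the branches beginning with 00 from those beginning with 11
    ([bits_inseparable]).  This is a Baire category argument, letter by letter.
    Call a cell of the tree bad, over the letters chosen so far, if in no box of
    further letters the predicate is generically constant on it.  If the
    predicate is generically constant on each of the cells below that involve
    both directions, then the values agree across the walls, since glued threads
    are dense there ([glued_colours], [same_colour]), and the cell is not bad.
    So a bad cell contains smaller bad cells, and a sequence of them shrinks to a
    plain thread; but near this thread the predicate is constant. *)

(** * Clopen uniformities *)

Local Open Scope fset_scope.

(** A countable base of a uniformity, each relation of which is a clopen subset
    of the square.  The modulus k of [near_clopen] depends on the two points, so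
    that the relations need not be equivalences. *)
Record clopen_uniformity := ClopenUniformity {
  cu_sort :> choiceType;
  near : nat -> cu_sort -> cu_sort -> Prop;
  near0 : forall x y, near 0 x y;
  near_refl : forall n x, near n x x;
  near_sym : forall n x y, near n x y -> near n y x;
  near_trans : forall n x y z, near n.+1 x y -> near n.+1 y z -> near n x z;
  near_sep : forall x y, (forall n, near n x y) -> x = y;
  near_clopen : forall n x y, exists k, forall x' y',
    near k x x' -> near k y y' -> (near n x' y' <-> near n x y) }.

Section Equivalences.
Context {Z : Type}.
Implicit Types (R Q L : Z -> Z -> Prop) (x y z u v : Z).

Record equiv R : Prop := Equiv {
  eqv_refl : forall x, R x x;
  eqv_sym : forall x y, R x y -> R y x;
  eqv_trans : forall x y z, R x y -> R y z -> R x z }.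

Inductive eqgen Q : Z -> Z -> Prop :=
| eqgen_base x y : Q x y -> eqgen Q x y
| eqgen_refl x : eqgen Q x x
| eqgen_sym x y : eqgen Q x y -> eqgen Q y x
| eqgen_trans x y z : eqgen Q x y -> eqgen Q y z -> eqgen Q x z.

Lemma eqgen_equiv Q : equiv (eqgen Q).
Proof. by split; [exact: eqgen_refl|exact: eqgen_sym|exact: eqgen_trans]. Qed.

Lemma eqgen_min Q R : equiv R -> (forall x y, Q x y -> R x y) ->
  forall x y, eqgen Q x y -> R x y.
Proof.
move=> [r s t] QR x y; elim=> {x y} [x y /QR|x|x y _|x y z _ xy _] //.
  exact: s.
exact: t.
Qed.

Lemma eqgen_sub Q Q' : (forall x y, Q x y -> Q' x y) ->
  forall x y, eqgen Q x y -> eqgen Q' x y.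
Proof. by move=> QQ'; apply: eqgen_min (eqgen_equiv _) _ => x y /QQ'; exact: eqgen_base. Qed.

Definition orrel Q L x y := Q x y \/ L x y.

Definition join1 R u v x y := R x y \/ (R x u /\ R v y) \/ (R x v /\ R u y).

Lemma join1_equiv R u v : equiv R -> equiv (join1 R u v).
Proof.
move=> [r s t]; split=> [x|x y|x y z]; first by left.
  move=> [/s xy|[[/s a /s b]|[/s a /s b]]]; [by left|right; right|right; left] => //.
rewrite /join1.
by move=> [xy|[[xu vy]|[xv uy]]] [yz|[[yu vz]|[yv uz]]]; [left|right; left|right; right
  |right; left|left|left|right; right|left|left]; (try split); eauto.
Qed.

End Equivalences.

Section Chains.
Context {Z : clopen_uniformity}.
Implicit Types (R Q L : Z -> Z -> Prop) (x y z u v : Z).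

Lemma near_le i j x y : (i <= j)%N -> near j x y -> near i x y.
Proof.
move=> ij; elim: j ij => [|j IH]; first by rewrite leqn0 => /eqP ->.
rewrite leq_eqVlt => /predU1P[-> //|ij] xy; apply: (IH ij).
exact: near_trans xy (near_refl _ _).
Qed.

Lemma near_trans1 j x y z : near j x y -> near j y z -> near (j - 1) x z.
Proof.
case: j => [|j]; first by move=> _ _; exact: near0.
by rewrite subn1; exact: near_trans.
Qed.

Lemma near_trans2 j x y z u : near j x y -> near j y z -> near j z u ->
  near (j - 2) x u.
Proof.
move=> xy yz zu; rewrite -[2]/(1 + 1)%N subnDA.
apply: near_trans1 (near_trans1 xy yz) _.
by apply: near_le zu; rewrite leq_subr.
Qed.

Definition within j R := forall x y, R x y -> near j x y.

Lemma join1_within j R u v : within j R -> near j u v ->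
  within (j - 2) (join1 R u v).
Proof.
move=> Rj uv x y [xy|[[a b]|[a b]]].
- by apply: near_le (Rj _ _ xy); rewrite leq_subr.
- exact: near_trans2 (Rj _ _ a) uv (Rj _ _ b).
- exact: near_trans2 (Rj _ _ a) (near_sym uv) (Rj _ _ b).
Qed.

Lemma within_le i j R : (i <= j)%N -> within j R -> within i R.
Proof. by move=> ij Rj x y /Rj; exact: near_le. Qed.

(** Each edge joins at most two classes, and this costs two levels. *)
Lemma edges_within (es : seq (Z * Z)) j R : equiv R -> within j R ->
  (forall e, e \in es -> near j e.1 e.2) ->
  within (j - 2 * size es) (eqgen (orrel R (fun x y => (x, y) \in es))).
Proof.
elim: es j R => [|[u v] es IH] j R eR Rj esj.
  rewrite muln0 subn0 => x y /(eqgen_min eR) xy; apply: Rj; apply: xy.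
  by move=> a b [].
have uvj : near j u v by apply: (esj (u, v)); rewrite mem_head.
rewrite /= mulnS subnDA => x y xy.
apply: (IH (j - 2) (join1 R u v)) => //.
- exact: join1_equiv.
- exact: join1_within.
- move=> e ees; apply: (@near_le _ j); first by rewrite leq_subr.
  by apply: esj; rewrite inE ees orbT.
- apply: eqgen_min (eqgen_equiv _) _ _ _ xy => a b [ab|].
    by apply: eqgen_base; left; left.
  rewrite inE => /predU1P[[-> ->]|ab]; apply: eqgen_base; last by right.
  by left; right; left; split; apply: eqv_refl.
Qed.

(** There may be any number of links, but a link is effective only if it joins
    two different classes among those of the n elements of S, and then it
    reduces the number of these classes. *)
Lemma links_within n (S : seq Z) j R L : equiv R -> within j R -> within j L ->
  (size S <= n)%N ->
  (forall x y, L x y -> (exists2 s, s \in S & R x s) /\ (exists2 s, s \in S & R y s)) ->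
  within (j - 2 * n) (eqgen (orrel R L)).
Proof.
elim: n S j R => [|n IH] S j R eR Rj Lj Sn cov.
  move: Sn cov; rewrite leqn0 size_eq0 => /eqP -> cov x y xy.
  rewrite muln0 subn0; apply: Rj; apply: (eqgen_min eR) xy => a b [//|].
  by move=> /cov[[]].
have [sub|] := pselect (forall x y, L x y -> R x y).
  move=> x y xy; apply: (@near_le _ j); first by rewrite leq_subr.
  by apply: Rj; apply: (eqgen_min eR) xy => a b [|/sub].
move=> /existsNP[x /existsNP[y /not_implyP[Lxy nRxy]]].
have [[s sS xs] [t tS yt]] := cov _ _ Lxy.
have ts : t != s.
  apply/eqP => ts; apply: nRxy; apply: (eqv_trans eR) xs _.
  by rewrite -ts; exact: (eqv_sym eR).
rewrite mulnS subnDA => a b ab.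
apply: (IH (rem s S) (j - 2) (join1 R x y)) => //.
- exact: join1_equiv.
- by apply: join1_within => //; exact: Lj.
- by apply: within_le Lj; rewrite leq_subr.
- by rewrite size_rem// -ltnS (leq_trans _ Sn)// prednK//; case: (S) sS.
- have key c : (exists2 s, s \in S & R c s) ->
      exists2 s', s' \in rem s S & join1 R x y c s'.
    move=> [s' s'S cs']; have [s's|s's] := eqVneq s' s; last first.
      by exists s'; [rewrite (rem_mem s's)|left].
    exists t; first exact: rem_mem.
    right; left; split => //; apply: (eqv_trans eR) cs' _.
    by rewrite s's; exact: (eqv_sym eR).
  by move=> c d /cov[/key ? /key ?].
- apply: eqgen_sub ab => c d [cd|cd]; [by left; left|by right].
Qed.

End Chains.

(** * Parities of finite sets *)

Section Parity.
Context {Z : choiceType}.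
Implicit Types (F G : {fset Z}) (P U : Z -> bool) (R : Z -> Z -> Prop).

Definition fsetx F G : {fset Z} := (F `\` G) `|` (G `\` F).

Lemma in_fsetx F G x : (x \in fsetx F G) = (x \in F) (+) (x \in G).
Proof. by rewrite !inE; case: (x \in F); case: (x \in G). Qed.

(** A homomorphism from the Boolean group to the field of two elements.  Sums
    in the group are handled below through these homomorphisms. *)
Definition par F P : bool := \big[addb/false]_(x <- F) P x.

Lemma par_big F S P : F `<=` S ->
  par F P = \big[addb/false]_(x <- S) ((x \in F) && P x).
Proof.
move=> FS; transitivity (\big[addb/false]_(x <- F) ((x \in F) && P x)).
  by apply: eq_big_seq => x ->.
by apply: big_fset_incl => // x _ /negbTE ->.
Qed.

Lemma par_fsetx F G P : par (fsetx F G) P = par F P (+) par G P.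
Proof.
pose S := F `|` G.
rewrite (@par_big F S) ?fsubsetUl// (@par_big G S) ?fsubsetUr//.
rewrite (@par_big _ S) -?big_split/=; last first.
  by apply/fsubsetP => x; rewrite in_fsetx !inE; case: (x \in F).
by apply: eq_bigr => x _; rewrite in_fsetx andb_addl.
Qed.

Lemma par0 P : par fset0 P = false.
Proof. by rewrite /par big_seq_fset0. Qed.

Lemma par1 z P : par [fset z] P = P z.
Proof. by rewrite /par big_seq_fset1. Qed.

Lemma eq_par F P P' : {in F, P =1 P'} -> par F P = par F P'.
Proof. by move=> PP'; apply: eq_big_seq => x /PP'. Qed.

Lemma par_split F P U :
  par F P = par F (fun x => P x && U x) (+) par F (fun x => P x && ~~ U x).
Proof.
rewrite /par -big_split/=; apply: eq_bigr => x _.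
by case: (P x); case: (U x).
Qed.

Lemma par_pred0 F P : {in F, forall x, ~~ P x} -> par F P = false.
Proof. by move=> P0; rewrite /par big1_seq// => x /P0/negbTE. Qed.

Definition cls R x : Z -> bool := fun y => `[< R x y >].

Definition oddc F R x : bool := par F (cls R x).

Lemma clsE R x y : equiv R -> R x y -> cls R x =1 cls R y.
Proof.
move=> [r s t] xy z; apply/asboolP/asboolP => [xz|yz]; last exact: t yz.
by apply: t xz; exact: s.
Qed.

Lemma oddc_eq F R x y : equiv R -> R x y -> oddc F R x = oddc F R y.
Proof. by move=> eR xy; apply: eq_par => z _; exact: clsE. Qed.

Definition saturated R P := forall x y, R x y -> P x = P y.

Lemma cls_saturated R x : equiv R -> saturated R (cls R x).
Proof.
move=> [r s t] y z yz; apply/asboolP/asboolP => [xy|xz]; first exact: t yz.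
by apply: t xz _; exact: s.
Qed.

(** A saturated predicate is a union of classes, and each class contributes its
    own parity. *)
Lemma par_even F R P : equiv R -> saturated R P ->
  {in F, forall x, P x -> ~~ oddc F R x} -> par F P = false.
Proof.
move=> eR; have [n] := ubnP (count P F); elim: n P => // n IH P Pn Psat Pev.
have [/hasP[x xF Px]|/hasPn noP] := boolP (has P F); last exact: par_pred0.
rewrite (par_split F P (cls R x)).
have -> : par F (fun y => P y && cls R x y) = oddc F R x.
  apply: eq_par => y _; rewrite andb_idl// => /asboolP xy.
  by rewrite -(Psat _ _ xy).
rewrite (negbTE (Pev _ xF Px))/=; apply: IH.
- rewrite -ltnS; apply: leq_trans Pn; rewrite ltnS.
  have -> : count P F = (count (fun y => P y && cls R x y) F +
      count (fun y => P y && ~~ cls R x y) F)%N.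
    elim: (F : seq Z) => //= y t ->.
    by case: (P y); case: (cls R x y) => /=; lia.
  rewrite -[X in (X < _)%N]add0n ltn_add2r -has_count; apply/hasP; exists x => //.
  by rewrite Px; apply/asboolP; exact: (eqv_refl eR).
- by move=> y z yz; rewrite (Psat _ _ yz) (cls_saturated x eR yz).
- by move=> y yF /andP[Py _]; exact: Pev.
Qed.

Lemma par_reps F R (s : seq Z) P : equiv R -> saturated R P ->
  pairwise (fun x y => ~~ cls R x y) s -> {in s, forall z, oddc F R z} ->
  {in F, forall x, P x -> oddc F R x -> exists2 z, z \in s & R z x} ->
  par F P = \big[addb/false]_(z <- s) P z.
Proof.
move=> eR; elim: s P => [|z s IH] P Psat /=.
  move=> _ _ cov; rewrite big_nil; apply: (par_even eR Psat) => x xF Px.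
  by apply/negP => /(cov _ xF Px)[].
move=> /andP[/allP zs ps] odds cov; rewrite big_cons (par_split F P (cls R z)).
congr addb.
  have [Pz|Pz] := boolP (P z).
    transitivity (oddc F R z); last by rewrite odds ?mem_head.
    apply: eq_par => y _; rewrite andb_idl// => /asboolP zy.
    by rewrite -(Psat _ _ zy).
  apply: par_pred0 => y _; apply/negP => /andP[Py /asboolP zy].
  by rewrite (Psat _ _ zy) Py in Pz.
rewrite (IH (fun y => P y && ~~ cls R z y)) //.
- by apply: eq_big_seq => y ys; rewrite zs ?andbT.
- by move=> x y xy; rewrite (Psat _ _ xy) (cls_saturated z eR xy).
- by move=> y ys; rewrite odds// inE ys orbT.
- move=> x xF /andP[Px nzx] ox; have [y + yx] := cov _ xF Px ox.
  rewrite inE => /predU1P[yz|ys]; last by exists y.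
  by move: nzx => /asboolP; rewrite -yz.
Qed.

Lemma oddc_ex F R P : equiv R -> saturated R P -> par F P ->
  exists2 x, x \in F & P x && oddc F R x.
Proof.
move=> eR Ps pF; apply: contrapT => no; move: pF; rewrite (par_even eR Ps)// => x xF Px.
by apply/negP => ox; apply: no; exists x; rewrite ?Px.
Qed.

End Parity.

(** * Clusters *)

Lemma down_ind (P : nat -> Prop) a K : P K ->
  (forall m, (a <= m < K)%N -> P m.+1 -> P m) ->
  forall m, (a <= m <= K)%N -> P m.
Proof.
move=> PK Pstep m; move: {2}(K - m)%N (erefl (K - m)%N) => d.
elim: d m => [|d IH] m dE /andP[am mK]; first by have -> : m = K by lia.
by apply: Pstep; [lia|apply: IH; lia].
Qed.

(** At level m at most 2 ^ m pairs and 5 * 2 ^ m links are chained, at a cost of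
    two levels of nearness each.  The constants leave room for this:
    [pairscale m <= diamscale m.+1], [linkscale m <= pairscale m - 2 * 2 ^ m] and
    [diamscale m <= linkscale m - 10 * 2 ^ m].  The scales are locked to keep
    them from being computed. *)
Definition linkscale := locked (fun k => 200 * 2 ^ k)%N.
Definition pairscale := locked (fun k => 264 * 2 ^ k)%N.
Definition diamscale := locked (fun k => 136 * 2 ^ k)%N.

Section Clusters.
Context {Z : clopen_uniformity}.
Implicit Types (F : {fset Z}) (R : Z -> Z -> Prop) (l : seq (nat * (Z * Z))).

Definition link F R k x y :=
  [/\ x \in F, y \in F, oddc F R x, oddc F R y & near (linkscale k) x y].

(** The stage j belongs to the level K - j.  The coarser classes arise from the
    finer ones by links between odd classes only; an even class is never merged
    again. *)
Fixpoint stages F K j : Z -> Z -> Prop :=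
  if j is i.+1 then eqgen (orrel (stages F K i) (link F (stages F K i) (K - j)))
  else eq.

Definition cluster F K m := stages F K (K - m).

Lemma cluster_top F K m : (K <= m)%N -> cluster F K m = eq.
Proof. by move=> Km; rewrite /cluster (eqP Km). Qed.

Lemma clusterS F K m : (m < K)%N ->
  cluster F K m = eqgen (orrel (cluster F K m.+1) (link F (cluster F K m.+1) m)).
Proof.
move=> mK; rewrite /cluster; have -> : (K - m = (K - m.+1).+1)%N by lia.
by rewrite [LHS]/=; have -> : (K - (K - m.+1).+1 = m)%N by lia.
Qed.

Lemma cluster_equiv F K m : equiv (cluster F K m).
Proof.
have [mK|Km] := ltnP m K; first by rewrite clusterS//; exact: eqgen_equiv.
by rewrite cluster_top//; split=> [//|x y ->|x y z -> ->].
Qed.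

Lemma cluster_sub F K m x y : (m < K)%N -> cluster F K m.+1 x y -> cluster F K m x y.
Proof. by move=> mK xy; rewrite clusterS//; apply: eqgen_base; left. Qed.

Definition valid l := {in l, forall e, near (pairscale e.1) e.2.1 e.2.2}.

Definition cnt l k := count (fun e => e.1 == k) l.

Definition parl l (P : Z -> bool) := \big[addb/false]_(e <- l) (P e.2.1 (+) P e.2.2).

Definition edge l m x y := exists2 e, e \in l & (m <= e.1)%N /\ e.2 = (x, y).

(** If F is the sum of another set and of the pairs in l, then a point of that
    set may be displaced within its class for this relation, when only the
    levels from m on are taken into account. *)
Definition thick F K l m := eqgen (orrel (cluster F K m) (edge l m)).

Lemma thick_equiv F K l m : equiv (thick F K l m).
Proof. exact: eqgen_equiv. Qed.

Lemma cluster_thick F K l m x y : cluster F K m x y -> thick F K l m x y.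
Proof. by move=> xy; apply: eqgen_base; left. Qed.

Lemma edge_thick F K l m e : e \in l -> (m <= e.1)%N -> thick F K l m e.2.1 e.2.2.
Proof.
by move=> el me; apply: eqgen_base; right; exists e => //; split=> //; case: (e.2).
Qed.

(** [thick F K l m] without the links of level m. *)
Definition prethick F K l m :=
  eqgen (orrel (thick F K l m.+1)
    (fun x y => (x, y) \in [seq e.2 | e <- l & e.1 == m])).

Lemma prethick_equiv F K l m : equiv (prethick F K l m).
Proof. exact: eqgen_equiv. Qed.

Lemma edge_prethick F K l m x y : edge l m x y -> prethick F K l m x y.
Proof.
move=> [e el [me exy]]; apply: eqgen_base.
move: me; rewrite leq_eqVlt => /predU1P[me|me]; last first.
  by left; have := edge_thick F K el me; rewrite exy.
by right; apply/mapP; exists e; rewrite ?mem_filter ?me ?eqxx.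
Qed.

Lemma cluster_prethick F K l m x y : cluster F K m.+1 x y -> prethick F K l m x y.
Proof. by move=> xy; apply: eqgen_base; left; exact: cluster_thick. Qed.

Lemma prethick_within F K l m : valid l -> (cnt l m <= 2 ^ m)%N ->
  within (diamscale m.+1) (thick F K l m.+1) ->
  within (linkscale m) (prethick F K l m).
Proof.
move=> vl cl dl; pose es := [seq e.2 | e <- l & e.1 == m].
have szes : (size es <= 2 ^ m)%N by rewrite size_map size_filter.
apply: (@within_le _ _ (pairscale m - 2 * size es)).
  by rewrite /linkscale /pairscale -!lock; lia.
apply: edges_within (thick_equiv _ _ _ _) _ _.
  by apply: within_le dl; rewrite /diamscale /pairscale -!lock expnS; lia.
move=> e /mapP[e' + ->]; rewrite mem_filter => /andP[/eqP <- e'l].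
exact: vl.
Qed.

Definition covers F R (s : seq Z) :=
  {in F, forall x, oddc F R x -> exists2 z, z \in s & R x z}.

(** The classes of [prethick] are small by the induction hypothesis and the
    bound on the number of pairs; the links of level m then join at most
    5 * 2 ^ m of them. *)
Lemma thick_within F K l m (s : seq Z) : (m < K)%N -> valid l ->
  (cnt l m <= 2 ^ m)%N -> within (diamscale m.+1) (thick F K l m.+1) ->
  covers F (cluster F K m.+1) s -> (size s <= 5 * 2 ^ m)%N ->
  within (diamscale m) (thick F K l m).
Proof.
move=> mK vl cl dl cov szs x y xy.
have dm := prethick_within vl cl dl.
have lm : within (linkscale m) (link F (cluster F K m.+1) m) by move=> a b [].
have cv a b : link F (cluster F K m.+1) m a b ->
    (exists2 z, z \in s & prethick F K l m a z) /\
    (exists2 z, z \in s & prethick F K l m b z).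
  move=> [aF bF oa ob _]; split.
    by have [z zs az] := cov _ aF oa; exists z => //; exact: cluster_prethick.
  by have [z zs bz] := cov _ bF ob; exists z => //; exact: cluster_prethick.
have wl := links_within (prethick_equiv F K l m) dm lm szs cv.
apply: (@near_le _ _ (linkscale m - 2 * (5 * 2 ^ m))).
  by rewrite /linkscale /diamscale -!lock; lia.
apply: wl; move: xy; apply: eqgen_min => [|a b [|ab]]; first exact: eqgen_equiv; last first.
  by apply: eqgen_base; left; exact: edge_prethick.
rewrite clusterS//; apply: eqgen_sub => {}a {}b [ab|]; [left|by right].
exact: cluster_prethick.
Qed.

Definition one_odd F K l m := forall x y, x \in F -> y \in F ->
  oddc F (cluster F K m) x -> oddc F (cluster F K m) y ->
  thick F K l m x y -> cluster F K m x y.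

(** Two odd classes of level m.+1 in one class of [prethick] are near enough to
    be linked at level m.  So all odd classes of level m.+1 in one class of
    [thick F K l m] belong to one cluster of level m, and every odd cluster of
    level m contains such a class. *)
Lemma one_odd_step F K l m : (m < K)%N ->
  within (linkscale m) (prethick F K l m) -> one_odd F K l m.
Proof.
move=> mK pw.
set R := cluster F K m; set R1 := cluster F K m.+1.
have eR : equiv R by exact: cluster_equiv.
have eR1 : equiv R1 by exact: cluster_equiv.
have eP := prethick_equiv F K l m.
have R1R x y : R1 x y -> R x y by exact: cluster_sub.
have merge x y : x \in F -> y \in F -> oddc F R1 x -> oddc F R1 y ->
    prethick F K l m x y -> R x y.
  move=> xF yF ox oy /pw xy; rewrite /R clusterS//.
  by apply: eqgen_base; right.
pose Q x y := prethick F K l m x y \/ exists x0 y0,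
  [/\ x0 \in F /\ y0 \in F, oddc F R1 x0 /\ oddc F R1 y0, R x0 y0,
      prethick F K l m x x0 & prethick F K l m y y0].
have eQ : equiv Q.
  split=> [x|x y|x y z].
  - by left; exact: eqv_refl.
  - move=> [/(eqv_sym eP) ?|[x0 [y0 [[? ?] [? ?] /(eqv_sym eR) ? ? ?]]]]; first by left.
    by right; exists y0, x0.
  - move=> [xy|[x0 [y0 [[x0F y0F] [ox oy] xy0 xx0 yy0]]]].
      move=> [yz|[y1 [z1 [[y1F z1F] [oy1 oz1] yz1 yy1 zz1]]]].
        by left; exact: eqv_trans yz.
      right; exists y1, z1; split=> //; exact: eqv_trans yy1.
    move=> [yz|[y1 [z1 [[y1F z1F] [oy1 oz1] yz1 yy1 zz1]]]].
      right; exists x0, y0; split=> //; apply: eqv_trans yy0 => //.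
      exact: eqv_sym.
    right; exists x0, z1; split=> //.
    apply: (eqv_trans eR) xy0 _; apply: (eqv_trans eR) yz1.
    apply: merge => //; apply: (eqv_trans eP) yy1; exact: eqv_sym.
have thickQ x y : thick F K l m x y -> Q x y.
  apply: eqgen_min => // {}x {}y [|xy]; last by left; exact: edge_prethick.
  rewrite clusterS//; apply: eqgen_min => // {}x {}y [xy|xy].
    by left; exact: cluster_prethick.
  case: (xy) => xF yF ox oy _; right; exists x, y; split=> //; try exact: eqv_refl.
  by rewrite /R clusterS//; apply: eqgen_base; right.
have fine x : x \in F -> oddc F R x -> exists x1, [/\ x1 \in F, oddc F R1 x1 & R x x1].
  move=> xF ox.
  have sat : saturated R1 (cls R x).
    by move=> a b /R1R ab; rewrite (cls_saturated x eR ab).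
  by have [x1 x1F /andP[/asboolP xx1 o1]] := oddc_ex eR1 sat ox; exists x1.
move=> x y xF yF /(fine _ xF)[x1 [x1F ox1 xx1]] /(fine _ yF)[y1 [y1F oy1 yy1]] xy.
apply: (eqv_trans eR) (xx1) _; apply: (eqv_trans eR) _ (eqv_sym eR (yy1)).
have : Q x1 y1.
  apply: thickQ; apply: (eqgen_trans (y := x)).
    apply/(eqv_sym (thick_equiv F K l m))/cluster_thick; exact: xx1.
  by apply: (eqgen_trans xy); apply: cluster_thick; exact: yy1.
move=> [/merge|[x0 [y0 [[x0F y0F] [ox0 oy0] xy0 xx0 yy0]]]]; first exact.
apply: (eqv_trans eR) (merge _ _ _ _ _ _ xx0) _ => //.
by apply: (eqv_trans eR) xy0 _; apply: merge => //; exact: (eqv_sym eP).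
Qed.


End Clusters.

(** * Clusters of a perturbed set *)

Section Perturbation.
Context {Z : clopen_uniformity}.
Implicit Types (F : {fset Z}) (R : Z -> Z -> Prop) (l : seq (nat * (Z * Z))).

(** F' is the sum of F and of the pairs in l. *)
Definition differ F F' l := forall P, par F' P = par F P (+) parl l P.

Definition coarse l m := [seq e <- l | (e.1 < m)%N].

Lemma parl_saturated l m (P : Z -> bool) : coarse l m = [::] ->
  {in l, forall e, (m <= e.1)%N -> P e.2.1 = P e.2.2} -> parl l P = false.
Proof.
move=> cl Pl; rewrite /parl big1_seq// => e /andP[_ el].
have em : (m <= e.1)%N.
  rewrite leqNgt; apply/negP => em.
  by have : e \in coarse l m by [rewrite mem_filter em]; rewrite cl.
by rewrite Pl// addbb.
Qed.

Lemma parl_ex l m (P : Z -> bool) :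
  {in l, forall e, (m <= e.1)%N -> P e.2.1 = P e.2.2} -> parl l P ->
  exists2 e, e \in coarse l m & P e.2.1 || P e.2.2.
Proof.
move=> Pl pl; apply: contrapT => no; move: pl; rewrite /parl big1_seq// => e /andP[_ el].
have [em|em] := leqP m e.1; first by rewrite Pl// addbb.
have : ~~ (P e.2.1 || P e.2.2).
  by apply/negP => Pe; apply: no; exists e; rewrite ?mem_filter ?em.
by rewrite negb_or => /andP[/negbTE -> /negbTE ->].
Qed.

Lemma thick_par F F' K l m x : differ F F' l ->
  par F' (cls (thick F' K l m) x) ->
  exists2 z, thick F' K l m x z &
    z \in F \/ z \in [seq e.2.1 | e <- coarse l m] ++ [seq e.2.2 | e <- coarse l m].
Proof.
move=> dF; rewrite dF; set P := cls _ x; have eT := thick_equiv F' K l m.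
have [/hasP[z zF /asboolP Pz] _|/hasPn noF] := boolP (has P F); first by exists z => //; left.
rewrite (par_pred0 noF) => /(@parl_ex _ m)[|e ec Pe].
  by move=> e el me; apply: (cls_saturated x eT); exact: edge_thick.
case/orP: Pe => /asboolP Pe; eexists; try exact: Pe; right; rewrite mem_cat.
  by rewrite (map_f (fun e => e.2.1) ec).
by rewrite (map_f (fun e => e.2.2) ec) orbT.
Qed.

(** A class of [thick] that contains an odd cluster contains only one, by
    [one_odd], and so has odd parity in F'.  The pairs of level at least m do not
    change its parity, so it meets F or one of the other pairs. *)
Lemma odd_touches F F' K l m x : differ F F' l -> one_odd F' K l m ->
  x \in F' -> oddc F' (cluster F' K m) x ->
  exists2 z, thick F' K l m x z &
    z \in F \/ z \in [seq e.2.1 | e <- coarse l m] ++ [seq e.2.2 | e <- coarse l m].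
Proof.
move=> dF one xF ox; apply: thick_par (dF) _.
have eT := thick_equiv F' K l m; have eC := cluster_equiv F' K m.
rewrite (@par_reps _ _ _ [:: x] _ eC) ?big_seq1//.
- by apply/asboolP; exact: eqv_refl.
- by move=> a b ab; apply: (cls_saturated x eT); exact: cluster_thick.
- by move=> z; rewrite inE => /eqP ->.
- move=> y yF /asboolP xy oy; exists x; rewrite ?mem_head//.
  exact: one.
Qed.

(** By [odd_touches] and [one_odd], the odd clusters inject into the points of F
    and the ends of the coarse pairs. *)
Lemma odd_covers F F' K l m : differ F F' l -> one_odd F' K l m ->
  exists s : seq Z, [/\ (size s <= #|` F| + 2 * size (coarse l m))%N,
    {in s, forall z, z \in F' /\ oddc F' (cluster F' K m) z} &
    covers F' (cluster F' K m) s].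
Proof.
move=> dF one.
pose ends : seq Z := F ++ ([seq e.2.1 | e <- coarse l m] ++ [seq e.2.2 | e <- coarse l m]).
pose good z x := [/\ x \in F', oddc F' (cluster F' K m) x & thick F' K l m x z].
have eT := thick_equiv F' K l m.
suff: exists s : seq Z, [/\ (size s <= size ends)%N,
    {in s, forall z, z \in F' /\ oddc F' (cluster F' K m) z} &
    {in ends, forall z x, good z x -> exists2 y, y \in s & cluster F' K m x y}].
  move=> [s [szs sF sc]]; exists s; split=> //.
    by apply: leq_trans szs _; rewrite !size_cat !size_map cardfE; lia.
  move=> x xF ox; have [z xz zF] := odd_touches dF one xF ox.
  by apply: (sc z) => //; rewrite mem_cat; apply/orP.
elim: ends => [|z ends [s [szs sF sc]]]; first by exists [::].
have [[x gx]|no] := pselect (exists x, good z x); last first.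
  exists s; split=> //=; first by rewrite ltnW// ltnS.
  move=> y; rewrite inE => /predU1P[-> x gx|/sc//].
  by case: no; exists x.
have [xF ox xz] := gx.
exists (x :: s); split=> //=.
  by move=> y; rewrite inE => /predU1P[-> //|/sF].
move=> y; rewrite inE => /predU1P[-> x' [x'F ox' x'z]|/sc ys x' /ys[u us x'u]].
  exists x; rewrite ?mem_head//; apply: one => //.
  by apply: (eqv_trans eT) x'z _; exact: eqv_sym.
by exists u => //; rewrite inE us orbT.
Qed.

Lemma coarse_size l m : (forall k, cnt l k <= 2 ^ k)%N -> (size (coarse l m) <= 2 ^ m)%N.
Proof.
move=> cl; elim: m => [|m IH].
  by rewrite /coarse (eq_filter (a2 := pred0)) ?filter_pred0.
have -> : size (coarse l m.+1) = (size (coarse l m) + cnt l m)%N.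
  rewrite /coarse /cnt !size_filter; elim: (l) => //= e t ->.
  by rewrite ltnS leq_eqVlt; case: (ltngtP e.1 m) => _ /=; lia.
by rewrite expnS; have := cl m; lia.
Qed.

Lemma thick_top F K l : {in l, forall e, e.1 < K}%N ->
  forall x y, thick F K l K x y -> x = y.
Proof.
move=> lK x y; apply: eqgen_min => [|{}x {}y [|]].
- by split=> [//|a b ->|a b c -> ->].
- by rewrite cluster_top.
- by move=> [e /lK eK [Ke _]]; rewrite ltnNge Ke in eK.
Qed.

(** Downward induction on the level: the number of odd clusters of level m.+1
    bounds the number of effective links of level m, hence the diameters at
    level m, and this yields [one_odd] and the number of odd clusters at
    level m. *)
Lemma perturbation F F' K K0 l : differ F F' l -> valid l ->
  (forall k, cnt l k <= 2 ^ k)%N -> {in l, forall e, e.1 < K}%N ->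
  (#|` F| <= 2 ^ K0)%N -> forall m, (K0 <= m <= K)%N ->
  within (diamscale m) (thick F' K l m) /\ one_odd F' K l m.
Proof.
move=> dF vl cl lK szF; apply: down_ind => [|m /andP[K0m mK] [wm om]].
  split=> [x y /(thick_top lK) ->|x y _ _ _ _ /(thick_top lK) ->].
    exact: near_refl.
  by apply: eqv_refl; exact: cluster_equiv.
have [s [szs _ cov]] := odd_covers dF om.
split; last by apply: one_odd_step => //; exact: prethick_within.
apply: thick_within cov _ => //; apply: leq_trans szs _.
have := coarse_size m.+1 cl; have : (2 ^ K0 <= 2 ^ m)%N by rewrite leq_exp2l.
by move: szF; rewrite expnS; lia.
Qed.

End Perturbation.

(** * Independence of the starting level *)

Definition pickrel (Z : Type) (good : Z -> Z -> Prop) z : Z :=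
  if pselect (exists x, good z x) is left e then projT1 (cid e) else z.

Lemma pickrelP (Z : Type) (good : Z -> Z -> Prop) z x :
  good z x -> good z (pickrel good z).
Proof.
move=> gzx; rewrite /pickrel; case: pselect => [e|[]]; last by exists x.
exact: (projT2 (cid e)).
Qed.

Section Local.
Context {Z : clopen_uniformity}.
Implicit Types (F : {fset Z}) (R : Z -> Z -> Prop) (l : seq (nat * (Z * Z))).

Definition separated F n := {in F &, forall x y, near n x y -> x = y}.

Lemma separated_le F n n' : (n <= n')%N -> separated F n -> separated F n'.
Proof. by move=> nn' sF x y xF yF xy; apply: sF => //; exact: near_le xy. Qed.

Lemma finite_bound (T : eqType) (s : seq T) (P : T -> nat -> Prop) :
  (forall x i j, (i <= j)%N -> P x i -> P x j) ->
  {in s, forall x, exists n, P x n} -> exists n, {in s, forall x, P x n}.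
Proof.
move=> Pm; elim: s => [|x s IH] Ps; first by exists 0%N.
have [n Pn] := IH (fun y ys => Ps y (@mem_behead _ (x :: s) y ys)).
have [m Pmx] := Ps x (mem_head _ _).
exists (maxn n m) => y; rewrite inE => /predU1P[->|ys].
  by apply: Pm Pmx; rewrite leq_maxr.
by apply: Pm (Pn _ ys); rewrite leq_maxl.
Qed.

Lemma finite_bound2 F (P : Z -> Z -> nat -> Prop) :
  (forall x y i j, (i <= j)%N -> P x y i -> P x y j) ->
  (forall x y, exists n, P x y n) -> exists n, {in F &, forall x y, P x y n}.
Proof.
move=> Pm Pex.
have [n Pn] := @finite_bound _ [seq (x, y) | x <- F, y <- F]
  (fun xy => P xy.1 xy.2) (fun xy => Pm _ _) (fun xy _ => Pex _ _).
exists n => x y xF yF; apply: (Pn (x, y)).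
by apply/allpairsP; exists (x, y).
Qed.

Lemma separated_ex F : exists n, separated F n.
Proof.
apply: (@finite_bound2 F (fun x y n => near n x y -> x = y)) => [x y i j ij ij' xy|x y].
  by apply: ij'; exact: near_le xy.
have [->|xy] := pselect (x = y); first by exists 0%N.
have [n nxy] : exists n, ~ near n x y.
  by apply: contrapT => no; apply: xy; apply: near_sep => n; apply: contrapT => nn; apply: no; exists n.
by exists n.
Qed.

Lemma linkscale_le i j : (i <= j)%N -> (linkscale i <= linkscale j)%N.
Proof. by move=> ij; rewrite /linkscale -!lock leq_mul2l leq_exp2l. Qed.

Lemma link_le m : (m <= linkscale m)%N.
Proof. by have := ltn_expl m (isT : 1 < 2)%N; rewrite /linkscale -!lock; lia. Qed.

Lemma cluster_top_eq F K K' m : separated F (linkscale K) ->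
  (K <= m)%N -> cluster F K' m = eq.
Proof.
move=> sF Km; have [mK'|/cluster_top ->//] := ltnP m K'.
suff: forall k, (m <= k <= K')%N -> cluster F K' k = eq by apply; rewrite leqnn ltnW.
apply: down_ind => [|k /andP[mk kK'] IH]; first by rewrite cluster_top.
rewrite clusterS// IH; apply/funext => x; apply/funext => y; apply/propext; split.
  apply: eqgen_min => [|{}x {}y [//|[xF yF _ _ xy]]].
    by split=> [//|a b ->|a b c -> ->].
  by apply: sF => //; apply: near_le xy; apply: linkscale_le; exact: leq_trans mk.
by move=> ->; exact: eqgen_refl.
Qed.

(** No links exist at the levels at which F is separated. *)
Lemma cluster_indep F K K' m : separated F (linkscale K) ->
  separated F (linkscale K') -> cluster F K m = cluster F K' m.
Proof.
wlog KK' : K K' / (K <= K')%N => [H|sK sK'].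
  by have [/H|/ltnW/H {}H sK sK'] := leqP K K'; [exact|rewrite H].
have [mK|Km] := leqP m K; last by rewrite !(cluster_top_eq _ sK)// ltnW.
suff: forall k, (m <= k <= K)%N -> cluster F K k = cluster F K' k.
  by apply; rewrite leqnn mK.
apply: down_ind => [|k /andP[mk kK] IH]; first by rewrite !(cluster_top_eq _ sK).
rewrite (clusterS F kK) (clusterS F (leq_trans kK KK')) IH//.
Qed.

Lemma cluster_in F K m x y : cluster F K m x y -> x = y \/ (x \in F /\ y \in F).
Proof.
have [mK|Km] := ltnP m K; last by rewrite cluster_top//; left.
suff: forall k, (m <= k <= K)%N -> forall x y,
    cluster F K k x y -> x = y \/ (x \in F /\ y \in F).
  by apply; rewrite leqnn ltnW.
apply: down_ind => [a b|k /andP[mk kK] IH]; first by rewrite cluster_top//; left.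
have eQ : equiv (fun a b => a = b \/ (a \in F /\ b \in F)).
  split=> [u|u v|u v w]; first by left.
    by move=> [->|[? ?]]; [left|right].
  by move=> [->|[uF vF]] // [<-|[_ wF]]; right.
rewrite clusterS// => a b; apply: (eqgen_min eQ) => {}a {}b [|[]]; first exact: IH.
by move=> aF bF _ _ _; right.
Qed.

Lemma even_frozen F K m x y : (m < K)%N ->
  ~~ oddc F (cluster F K m.+1) x -> cluster F K m x y -> cluster F K m.+1 x y.
Proof.
move=> mK nox; set R := cluster F K m.+1; have eR : equiv R by exact: cluster_equiv.
have eQ : equiv (fun a b => R a b \/ (oddc F R a /\ oddc F R b)).
  split=> [a|a b|a b c].
  - by left; exact: eqv_refl.
  - by move=> [/(eqv_sym eR)|[? ?]]; [left|right].
  - move=> [ab|[oa ob]] [bc|[ob' oc]].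
    + by left; exact: (eqv_trans eR) bc.
    + by right; rewrite (oddc_eq F eR ab).
    + by right; rewrite -(oddc_eq F eR bc).
    + by right.
suff: cluster F K m x y -> R x y \/ (oddc F R x /\ oddc F R y).
  by move=> H /H[//|[ox _]]; rewrite ox in nox.
rewrite clusterS//; apply: (eqgen_min eQ) => a b [ab|[aF bF oa ob _]]; first by left.
by right.
Qed.

Lemma odd_le F K m m' x : (m <= m')%N ->
  oddc F (cluster F K m) x -> oddc F (cluster F K m') x.
Proof.
move=> mm'; rewrite -(subnKC mm'); elim: (m' - m)%N => [|d IH]; first by rewrite addn0.
move=> /IH; rewrite addnS; set k := (m + d)%N => okx.
have [kK|Kk] := ltnP k K; last first.
  by move: okx; rewrite (cluster_top F Kk) (cluster_top F (leqW Kk)).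
apply/negPn/negP => nok; move: okx; rewrite /oddc.
suff -> : par F (cls (cluster F K k) x) = par F (cls (cluster F K k.+1) x).
  exact/negP.
apply: eq_par => y _; apply/asboolP/asboolP; first exact: even_frozen.
exact: cluster_sub.
Qed.

(** At every level m there are at most 2 ^ (m - M) odd clusters, hence none below
    level M. *)
Definition small M F := forall K m, separated F (linkscale K) ->
  exists2 s : seq Z, (size s * 2 ^ M <= 2 ^ m)%N & covers F (cluster F K m) s.

End Local.

(** * Clusters under sparse perturbations *)

Section Tracking.
Context {Z : clopen_uniformity}.
Implicit Types (R : Z -> Z -> Prop) (l : seq (nat * (Z * Z))).

Definition sparse l T := forall k, (cnt l k * 2 ^ T <= 2 ^ k)%N.

Lemma sparse_cnt l T : sparse l T -> forall k, (cnt l k <= 2 ^ k)%N.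
Proof. by move=> sl k; apply: leq_trans (sl k); rewrite leq_pmulr// expn_gt0. Qed.

Lemma coarse_sparse l T m : sparse l T -> (size (coarse l m) * 2 ^ T <= 2 ^ m)%N.
Proof.
move=> sl; elim: m => [|m IH].
  by rewrite /coarse (eq_filter (a2 := pred0)) ?filter_pred0.
have -> : size (coarse l m.+1) = (size (coarse l m) + cnt l m)%N.
  rewrite /coarse /cnt !size_filter; elim: (l) => //= e t ->.
  by rewrite ltnS leq_eqVlt; case: (ltngtP e.1 m) => _ /=; lia.
by rewrite mulnDl expnS; have := sl m; lia.
Qed.

Lemma sparse_scale l T e : sparse l T -> e \in l -> (T <= e.1)%N.
Proof.
move=> /(_ e.1) + el; have : (0 < cnt l e.1)%N by rewrite -has_count; apply/hasP; exists e.
case: (cnt l e.1) => // c _; rewrite mulSn => /(leq_trans (leq_addr _ _)).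
by rewrite leq_exp2l.
Qed.

Lemma coarse_nil l T m : sparse l T -> (m <= T)%N -> coarse l m = [::].
Proof.
move=> sl mT; apply/eqP; rewrite -(filter_pred0 l); apply/eqP/eq_in_filter => e el.
by rewrite ltnNge (leq_trans mT)// (sparse_scale sl el).
Qed.

(** F is fixed and F' arises from it by pairs of levels at least T, hence by much
    shorter pairs than the distances in F.  Each point p of F is followed by one
    odd cluster [f p] of level K of F', near to p, and there are no other odd
    clusters.  Below level K the links of F' between these clusters are the links
    of F, since [near] is clopen. *)
Section Simulation.
Context (F F' : {fset Z}) (l : seq (nat * (Z * Z))) (T K K' : nat).
Context (dF : differ F F' l) (vl : valid l) (sl : sparse l T).
Context (KT : (K <= T)%N) (KK' : (K <= K')%N) (lK' : {in l, forall e, e.1 < K'}%N).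
Context (szF : (#|` F| <= 2 ^ K)%N).
Context (sepF : separated F (diamscale K - 2)).
Context (stable : forall m p q a b, (m < K)%N -> p \in F -> q \in F ->
  near (diamscale K) p a -> near (diamscale K) q b ->
  (near (linkscale m) a b <-> near (linkscale m) p q)).

Let C' m := cluster F' K' m.
Let C m := cluster F K m.
Let eC' m : equiv (C' m) := cluster_equiv F' K' m.
Let eC m : equiv (C m) := cluster_equiv F K m.
Let eT := thick_equiv F' K' l K.

Let pert m : (K <= m <= K')%N ->
  within (diamscale m) (thick F' K' l m) /\ one_odd F' K' l m.
Proof. by apply: (perturbation dF vl (sparse_cnt sl) lK' szF). Qed.

Let thickK : within (diamscale K) (thick F' K' l K).
Proof. by have [] := pert (m := K); rewrite ?leqnn. Qed.

Let oneK : one_odd F' K' l K.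
Proof. by have [] := pert (m := K); rewrite ?leqnn. Qed.

Let coarseK : coarse l K = [::] := coarse_nil sl KT.

Let thick_inj p q : p \in F -> q \in F -> thick F' K' l K p q -> p = q.
Proof.
move=> pF qF /thickK pq; apply: sepF => //; apply: near_le pq; exact: leq_subr.
Qed.

Let follows p x := [/\ x \in F', oddc F' (C' K) x & thick F' K' l K p x].

Let f := pickrel follows.

(** The class of p for [thick] contains no other point of F, so its parity in F,
    and thus in F', is odd. *)
Let fP p : p \in F -> follows p (f p).
Proof.
move=> pF; suff [x px] : exists x, follows p x by exact: pickrelP px.
have sat : saturated (C' K) (cls (thick F' K' l K) p).
  by move=> a b ab; apply: (cls_saturated p eT); exact: cluster_thick.
have pp : par F (cls (thick F' K' l K) p).
  rewrite (@eq_par _ F _ (cls eq p)); last first.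
    move=> q qF; apply/asboolP/asboolP => [|<-]; first exact: thick_inj.
    exact: (eqv_refl eT).
  rewrite (@eq_par _ F _ (fun q => (q == p))); last first.
    by move=> q _; apply/asboolP/eqP => ->.
  rewrite /par (big_fsetD1 p)//= eqxx big1_fset// => q; rewrite !inE => /andP[/negbTE ->] //.
have := dF (cls (thick F' K' l K) p); rewrite pp.
rewrite (@parl_saturated _ l K) // => [/= pF'|e el Ke].
  have [x xF /andP[/asboolP px ox]] := oddc_ex (eC' K) sat pF'.
  by exists x.
by apply: (cls_saturated p eT); exact: edge_thick.
Qed.

Let odd_follows x : x \in F' -> oddc F' (C' K) x ->
  exists2 p, p \in F & C' K x (f p) /\ near (diamscale K) p x.
Proof.
move=> xF ox; have [p xp pF] := odd_touches dF oneK xF ox.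
have {}pF : p \in F by case: pF; rewrite ?coarseK.
exists p => //; have [fF fo pf] := fP pF; split; last first.
  by apply: near_sym; exact: thickK.
by apply: oneK => //; apply: (eqv_trans eT) xp pf.
Qed.

Let f_unrelated p q : p \in F -> q \in F -> C' K (f p) (f q) -> p = q.
Proof.
move=> pF qF pq; have [_ _ pf] := fP pF; have [_ _ qf] := fP qF.
apply: thick_inj => //; apply: (eqv_trans eT) pf _.
apply: (eqv_trans eT) (cluster_thick _ pq) _; exact: (eqv_sym eT).
Qed.

Let f_pairwise (s : seq Z) : {subset s <= F} -> uniq s ->
  pairwise (fun x y => ~~ cls (C' K) x y) (map f s).
Proof.
elim: s => //= q s IH sub /andP[qs us]; rewrite IH// ?andbT; last first.
  by move=> z zs; apply: sub; rewrite inE zs orbT.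
apply/allP => _ /mapP[z zs ->]; apply/asboolP => qz; move: qs.
rewrite (f_unrelated _ _ qz) ?zs//; first by apply: sub; rewrite mem_head.
by apply: sub; rewrite inE zs orbT.
Qed.

Let cluster'_le m m' x y : (m <= m' <= K)%N -> C' m' x y -> C' m x y.
Proof.
move=> /andP[mm']; rewrite -(subnKC mm'); elim: (m' - m)%N => [|d IH] dK.
  by rewrite addn0.
rewrite addnS => xy; apply: IH; first by lia.
by apply: cluster_sub xy; lia.
Qed.

Let tracked m := {in F &, forall p q, C' m (f p) (f q) <-> C m p q}.

Let tracked_odd m : (m <= K)%N -> tracked m ->
  {in F, forall p, oddc F' (C' m) (f p) = oddc F (C m) p}.
Proof.
move=> mK tm p pF; rewrite {1}/oddc (@par_reps _ _ (C' K) (map f F)).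
- rewrite big_map; apply: eq_big_seq => q qF.
  by apply/asboolP/asboolP => [/tm|/tm]; apply.
- exact: eC'.
- move=> a b ab; apply: (cls_saturated _ (eC' m)).
  by apply: cluster'_le ab; rewrite mK leqnn.
- exact: (f_pairwise _ (fset_uniq F)).
- by move=> z /mapP[q qF ->]; have [] := fP qF.
- move=> x xF _ /(odd_follows xF)[q qF [xq _]]; exists (f q); first exact: map_f.
  exact: (eqv_sym (eC' K)).
Qed.

Let tracked_step m : (m < K)%N -> tracked m.+1 -> tracked m.
Proof.
move=> mK tm p q pF qF; have mK' := leq_trans mK KK'.
have sub a b : C m.+1 a b -> C m a b by exact: cluster_sub.
split; last first.
  have eQ : equiv (fun a b => a = b \/ [/\ a \in F, b \in F & C' m (f a) (f b)]).
    split=> [a|a b|a b c]; first by left.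
      by move=> [->|[aF bF ab]]; [left|right; split=> //; exact: (eqv_sym (eC' m))].
    move=> [->//|[aF bF ab]] [<-|[_ cF bc]]; right; split=> //.
    exact: (eqv_trans (eC' m)) bc.
  suff: C m p q -> p = q \/ [/\ p \in F, q \in F & C' m (f p) (f q)].
    by move=> H /H[->|[]//]; exact: (eqv_refl (eC' m)).
  rewrite {1}/C clusterS//; apply: (eqgen_min eQ) => a b [ab|[aF bF oa ob ab]].
    have [->|[aF bF]] := cluster_in ab; first by left.
    by right; split=> //; apply: cluster_sub => //; apply/tm.
  right; split=> //; have [faF foa af] := fP aF; have [fbF fob bf] := fP bF.
  rewrite /C' clusterS//; apply: eqgen_base; right; split=> //.
  - by rewrite -/(C' m.+1) tracked_odd.
  - by rewrite -/(C' m.+1) tracked_odd.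
  - apply/(stable mK aF bF) => //; exact: thickK.
pose Q a b := C' m.+1 a b \/ exists p q, [/\ p \in F, q \in F,
  C' m.+1 a (f p), C' m.+1 b (f q) & C m p q].
have e1 := eC' m.+1; have eQ : equiv Q.
  split=> [a|a b|a b c].
  - by left; exact: (eqv_refl e1).
  - move=> [/(eqv_sym e1)|[u [v [uF vF au bv uv]]]]; first by left.
    by right; exists v, u; split=> //; exact: (eqv_sym (eC m)).
  - move=> [ab|[u [v [uF vF au bv uv]]]] [bc|[u' [v' [u'F v'F bu' cv' uv']]]].
    + by left; exact: (eqv_trans e1) bc.
    + by right; exists u', v'; split=> //; exact: (eqv_trans e1) bu'.
    + right; exists u, v; split=> //; apply: (eqv_trans e1) bv.
      exact: (eqv_sym e1).
    + right; exists u, v'; split=> //; apply: (eqv_trans (eC m)) uv _.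
      apply: (eqv_trans (eC m)) uv'; apply/sub/(tm _ _ vF u'F).
      by apply: (eqv_trans e1) bu'; exact: (eqv_sym e1).
move=> pq; have : Q (f p) (f q).
  move: pq; rewrite {1}/C' clusterS//; apply: (eqgen_min eQ) => a b [ab|]; first by left.
  move=> [aF bF oa ob ab]; right.
  have [u uF [au ua]] := odd_follows aF (odd_le (m' := K) mK oa).
  have [v vF [bv vb]] := odd_follows bF (odd_le (m' := K) mK ob).
  have au1 : C' m.+1 a (f u) by apply: cluster'_le au; rewrite mK leqnn.
  have bv1 : C' m.+1 b (f v) by apply: cluster'_le bv; rewrite mK leqnn.
  exists u, v; split=> //; rewrite /C clusterS//; apply: eqgen_base; right; split=> //.
  - by rewrite -/(C m.+1) -tracked_odd// -(oddc_eq F' e1 au1).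
  - by rewrite -/(C m.+1) -tracked_odd// -(oddc_eq F' e1 bv1).
  - by apply/(stable mK uF vF ua vb).
move=> [/tm pq1|[u [v [uF vF pu qv uv]]]]; first exact/sub/pq1.
apply: (eqv_trans (eC m)) (sub _ _ (proj1 (tm _ _ pF uF) pu)) _.
apply: (eqv_trans (eC m)) uv _; apply: (eqv_sym (eC m)).
exact/sub/(proj1 (tm _ _ qF vF)).
Qed.

Lemma cluster_tracked m : (m <= K)%N -> tracked m.
Proof.
move=> mK; suff: forall k, (m <= k <= K)%N -> tracked k by apply; rewrite leqnn.
apply: down_ind => [p q pF qF|k /andP[_ kK]]; last exact: tracked_step.
rewrite /C cluster_top//; split=> [|->]; first exact: f_unrelated.
exact: (eqv_refl (eC' K)).
Qed.

Lemma covers_tracked m n : (m <= K)%N ->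
  (exists2 s : seq Z, (size s <= n)%N & covers F' (C' m) s) <->
  (exists2 s : seq Z, (size s <= n)%N & covers F (C m) s).
Proof.
move=> mK; have tm := cluster_tracked mK; split=> -[s szs cov].
  pose g := pickrel (fun z p => p \in F /\ C' m (f p) z).
  exists (map g s); first by rewrite size_map.
  move=> p pF op; have [fF _ _] := fP pF.
  have [|z zs pz] := cov _ fF; first by rewrite tracked_odd.
  exists (g z); first exact: map_f.
  have [gF gz] : g z \in F /\ C' m (f (g z)) z.
    apply: (pickrelP (good := fun z p => p \in F /\ C' m (f p) z) (x := p)).
    by split.
  apply/tm => //; apply: (eqv_trans (eC' m)) pz _; exact: (eqv_sym (eC' m)).
exists (map f s); first by rewrite size_map.
move=> x xF ox; have [p pF [xp _]] := odd_follows xF (odd_le mK ox).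
have xpm : C' m x (f p) by apply: cluster'_le xp; rewrite mK leqnn.
have [|z zs pz] := cov _ pF.
  by rewrite -tracked_odd// -(oddc_eq F' (eC' m) xpm).
exists (f z); first exact: map_f.
have zF : z \in F by have [<-|[]] := cluster_in pz.
by apply: (eqv_trans (eC' m)) xpm _; apply/tm.
Qed.

Lemma shadow p : p \in F -> exists2 x, x \in F' & near (diamscale K) p x.
Proof. by move=> /fP[xF _ /thickK px]; exists (f p). Qed.

Lemma covers_above m : (K <= m <= K')%N ->
  exists2 s : seq Z, (size s <= #|` F| + 2 * size (coarse l m))%N & covers F' (C' m) s.
Proof.
by move=> /pert[_ /(odd_covers dF)[s [szs _ cov]]]; exists s.
Qed.

End Simulation.
End Tracking.

(** * Smallness is locally constant *)

Lemma scale_facts m : [/\ (m + 2 <= linkscale m)%N, (m + 2 <= diamscale m)%N,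
  (diamscale m.+1 <= pairscale m + 8 * 2 ^ m)%N, (pairscale m <= diamscale m.+1)%N &
  (linkscale m + 1 <= diamscale m.+1)%N].
Proof.
have := ltn_expl m (isT : 1 < 2)%N.
by rewrite /linkscale /diamscale /pairscale -!lock expnS => ?; split; lia.
Qed.

Lemma diamscale_le i j : (i <= j)%N -> (diamscale i <= diamscale j)%N.
Proof. by move=> ij; rewrite /diamscale -!lock leq_mul2l leq_exp2l. Qed.

Lemma diam_link m : (diamscale m - 2 <= linkscale m)%N.
Proof. by rewrite /diamscale /linkscale -!lock; lia. Qed.

Section SmallSets.
Context {Z : clopen_uniformity}.
Implicit Types (F : {fset Z}) (R : Z -> Z -> Prop) (l : seq (nat * (Z * Z))).

Lemma small_at M F K : separated F (linkscale K) ->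
  small M F <-> forall m, exists2 s : seq Z,
    (size s <= 2 ^ m %/ 2 ^ M)%N & covers F (cluster F K m) s.
Proof.
move=> sK; have e (s : seq Z) m : (size s * 2 ^ M <= 2 ^ m)%N = (size s <= 2 ^ m %/ 2 ^ M)%N.
  by rewrite leq_divRL// expn_gt0.
split=> [sm m|sm K' m sK']; first by have [s + ?] := sm K m sK; rewrite e; exists s.
by have [s + sc] := sm m; rewrite -e; exists s => //; rewrite (cluster_indep _ sK' sK).
Qed.

(** Only the levels at which F is not separated need the clopenness of [near]; at
    all finer levels both sides hold just for p = q. *)
Lemma stable_ex F : exists k, forall n, (k <= n)%N -> separated F (diamscale n - 2) /\
  forall m p q a b, (m < n)%N -> p \in F -> q \in F ->
  near (diamscale n) p a -> near (diamscale n) q b ->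
  (near (linkscale m) a b <-> near (linkscale m) p q).
Proof.
have [n0 s0] := separated_ex F.
pose P (p q : Z) (k : nat) := forall m, (m < n0)%N -> forall a b, near k p a -> near k q b ->
  (near (linkscale m) a b <-> near (linkscale m) p q).
have [|p q|k kP] := @finite_bound2 _ F P.
- move=> p q i j ij Pi m m0 a b pa qb; apply: Pi => //; exact: near_le ij _.
- have [|m _|k kP] := @finite_bound _ (iota 0 n0) (fun m k => forall a b,
      near k p a -> near k q b -> (near (linkscale m) a b <-> near (linkscale m) p q)).
  + by move=> m i j ij Pi a b pa qb; apply: Pi; exact: near_le ij _.
  + exact: near_clopen.
  + by exists k => m m0; apply: kP; rewrite mem_iota.
exists (maxn k n0) => n; rewrite geq_max => /andP[kn n0n].
have [_ dn _ _ _] := scale_facts n; split.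
  by apply: separated_le s0; lia.
move=> m p q a b mn pF qF pa qb.
have [m0|n0m] := ltnP m n0.
  by apply: kP => //; [apply: near_le pa|apply: near_le qb]; lia.
have [lm _ _ _ lmd] := scale_facts m; have dmn := diamscale_le mn.
have [pq|pq] := pselect (p = q).
  subst q; split=> _; first exact: near_refl.
  apply: near_le (near_trans1 (near_sym pa) qb); lia.
split=> [ab|ab]; exfalso; apply: pq; apply: s0 => //; last by apply: near_le ab; lia.
have lmdn : (linkscale m <= diamscale n)%N by lia.
apply: near_le (near_trans2 (near_le lmdn pa) ab (near_le lmdn (near_sym qb))); lia.
Qed.

(** Below level K the odd clusters of both sets correspond to each other.  From
    level K on, F is too small a set to violate the condition, and F' has at most
    the odd clusters allowed by [odd_covers]. *)
Lemma small_local M F : exists T, forall F' l, differ F F' l -> valid l ->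
  sparse l T -> (small M F' <-> small M F).
Proof.
have [k kP] := stable_ex F.
(* As #|F| * 2 ^ (M + 1) <= 2 ^ K, the points of F may serve as representatives
   from level K on; the ends of pairs of level K + M + 2 or more add less than
   the other half of the allowed number. *)
pose K := (k + #|` F| + M + 1)%N; exists (K + M + 2)%N => F' l dF vl sl.
have [sepF stab] := kP K (ltac:(rewrite /K; lia)).
have sepFl : separated F (linkscale K).
  by apply: separated_le sepF; exact: diam_link.
have [n' sepF'] := separated_ex F'.
have [n lK] := @finite_bound _ l (fun e n => (e.1 < n)%N)
  (fun e i j ij ei => leq_trans ei ij) (fun e _ => ex_intro _ e.1.+1 (ltnSn _)).
pose K' := (K + n + n')%N.
have sK' : separated F' (linkscale K').
  by apply: separated_le sepF'; have := link_le K'; rewrite /K'; lia.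
have lK' : {in l, forall e, e.1 < K'}%N by move=> e /lK /= eK; apply: leq_trans eK _; rewrite /K'; lia.
have KK' : (K <= K')%N by rewrite /K'; lia.
have KT : (K <= K + M + 2)%N by lia.
have szF2 : (#|` F| * (2 * 2 ^ M) <= 2 ^ K)%N.
  have /ltnW := ltn_expl #|` F| (isT : 1 < 2)%N => szF.
  apply: leq_trans (_ : 2 ^ #|` F| * (2 * 2 ^ M) <= _)%N; first by rewrite leq_mul2r szF orbT.
  by rewrite -expnS -expnD leq_exp2l// /K; lia.
have szF : (#|` F| <= 2 ^ K)%N.
  by apply: leq_trans szF2; rewrite leq_pmulr// muln_gt0 expn_gt0.
rewrite (small_at _ sK') (small_at _ sepFl).
split=> sm m.
  have [Km|mK] := leqP K m; last first.
    by apply/(covers_tracked dF vl sl KT KK' lK' szF sepF stab) => //; exact: ltnW.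
  exists (F : seq Z); last by move=> x xF _; exists x => //; apply: eqv_refl; exact: cluster_equiv.
  rewrite leq_divRL ?expn_gt0//; have := leq_pexp2l (isT : 0 < 2)%N Km.
  by move=> Km2; apply: leq_trans Km2; apply: leq_trans szF2; rewrite mulnCA leq_pmull.
have [Km|mK] := leqP K m; last first.
  by apply/(covers_tracked dF vl sl KT KK' lK' szF sepF stab) => //; exact: ltnW.
have [m' [Km' mm' ->]] : exists m', [/\ (K <= m' <= K')%N, (m' <= m)%N &
    cluster F' K' m = cluster F' K' m'].
  have [mK'|K'm] := leqP m K'; first by exists m; rewrite Km mK'.
  by exists K'; rewrite KK' leqnn ltnW// !cluster_top// ltnW.
have [s szs cov] := covers_above dF vl sl lK' szF Km'; exists s => //.
apply: leq_trans szs _; rewrite leq_divRL ?expn_gt0//.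
have := coarse_sparse m' sl; have := leq_pexp2l (isT : 0 < 2)%N mm'.
have /andP[Km'' _] := Km'; have := leq_pexp2l (isT : 0 < 2)%N Km''.
rewrite 2!expnD => KX X cX; rewrite mulnDl.
have h1 : (#|` F| * 2 ^ M * 2 <= 2 ^ m)%N.
  apply: leq_trans X; apply: leq_trans KX; apply: leq_trans szF2.
  by rewrite [(2 * _)%N]mulnC mulnA.
have h2 : (2 * size (coarse l m') * 2 ^ M * 2 <= 2 ^ m)%N.
  apply: leq_trans X; apply: leq_trans cX; have := expn_gt0 2 K.
  move: (2 ^ K)%N => a a0; rewrite -[leqLHS]muln1 [leqRHS](_ : _ = 2 * size (coarse l m') * 2 ^ M * 2 * a)%N; last lia.
  by rewrite leq_mul2l a0 orbT.
lia.
Qed.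

End SmallSets.

(** * Decomposition of small sets *)

Section Canonical.
Context {Z : choiceType}.
Implicit Types (R : Z -> Z -> Prop).

Definition canon R (z : Z) : Z := choose (cls R z) z.

Lemma canon_rel R z : equiv R -> R z (canon R z).
Proof. by move=> eR; apply/asboolP; apply: (@chooseP _ (cls R z)); apply/asboolP; exact: eqv_refl. Qed.

Lemma canon_eq R x y : equiv R -> R x y -> canon R x = canon R y.
Proof.
move=> eR xy; rewrite /canon -(eq_choose (clsE eR xy)); apply: choose_id.
  by apply/asboolP; exact: eqv_refl.
by apply/asboolP.
Qed.

Lemma canon_id R x : equiv R -> canon R (canon R x) = canon R x.
Proof. by move=> eR; rewrite -(canon_eq eR (canon_rel x eR)). Qed.

End Canonical.

Section Decomposition.
Context {Z : clopen_uniformity} (F : {fset Z}) (M K : nat).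
Context (M2 : (2 <= M)%N) (sm : small M F) (sK : separated F (linkscale K)).

Let R m := cluster F K m.
Let eR m : equiv (R m) := cluster_equiv F K m.

Let R_succ m x y : R m.+1 x y -> R m x y.
Proof.
have [mK|Km] := ltnP m K; first exact: cluster_sub.
by rewrite /R !cluster_top// ltnW.
Qed.

Let R_within m : within (diamscale m) (R m).
Proof.
have [Km|mK] := leqP K m.
  by rewrite /R cluster_top// => x y ->; exact: near_refl.
suff: forall k, (m <= k <= K)%N -> within (diamscale k) (thick F K [::] k).
  by move=> /(_ m) H x y xy; apply: H; [rewrite leqnn ltnW|exact: cluster_thick].
apply: down_ind => [x y /thick_top ->//|k /andP[mk kK] IH]; first exact: near_refl.
have [s szs cov] := sm k.+1 sK; apply: thick_within IH cov _ => //.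
have := leq_pexp2l (isT : 0 < 2)%N M2; move: szs; rewrite expnS; nia.
Qed.

Let oddreps m : seq Z := undup [seq canon (R m) x | x <- F & oddc F (R m) x].

Let oddreps_size m : (size (oddreps m) * 2 ^ M <= 2 ^ m)%N.
Proof.
have [s szs cov] := sm m sK; apply: leq_trans szs; rewrite leq_mul2r.
apply/orP; right; rewrite -(size_map (canon (R m)) s).
apply: uniq_leq_size; first exact: undup_uniq.
move=> z; rewrite mem_undup => /mapP[x]; rewrite mem_filter => /andP[ox xF] ->.
by have [y ys xy] := cov _ xF ox; apply/mapP; exists y => //; exact: canon_eq.
Qed.

(** The parity of F after every point has been moved to the representative of its
    cluster of level m: it is [par F P] for large m, and zero for m < M, where no
    odd clusters exist. *)
Let T m (P : Z -> bool) := par F (fun x => P (canon (R m) x)).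

Let T_low (m : nat) P : (m < M)%N -> T m P = false.
Proof.
move=> mM; apply: (par_even (eR m)) => [x y xy|x xF _]; first by rewrite (canon_eq (eR m) xy).
have [s + cov] := sm m sK; rewrite leqNgt; case: s cov => [|y s] cov.
  by move=> _; apply/negP => /(cov _ xF)[].
by move=> /negP[]; rewrite /= mulSn; apply: ltn_addr; rewrite ltn_exp2l.
Qed.

Let T_step m P : T m.+1 P (+) T m P =
  \big[addb/false]_(z <- oddreps m.+1) (P (canon (R m.+1) z) (+) P (canon (R m) z)).
Proof.
rewrite /T /par -big_split/= -/(par F _); apply: (par_reps (eR m.+1)).
- by move=> x y xy; rewrite (canon_eq (eR _) xy) (canon_eq (eR _) (R_succ xy)).
- have : uniq (oddreps m.+1) by exact: undup_uniq.
  have : {in oddreps m.+1, forall z, canon (R m.+1) z = z}.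
    by move=> z; rewrite mem_undup => /mapP[x _ ->]; exact: canon_id.
  elim: (oddreps m.+1) => //= z s IH sc /andP[zs us].
  rewrite IH ?andbT// => [|y ys]; last by apply: sc; rewrite inE ys orbT.
  apply/allP => y ys; apply/asboolP => /(canon_eq (eR _)) zy; move: zs.
  by rewrite -(sc z) ?mem_head// zy sc ?ys// inE ys orbT.
- move=> z; rewrite mem_undup => /mapP[x]; rewrite mem_filter => /andP[ox _] ->.
  by rewrite -(oddc_eq F (eR _) (canon_rel x (eR _))).
- move=> x xF _ ox; exists (canon (R m.+1) x); last by apply: (eqv_sym (eR _)); exact: canon_rel.
  by rewrite mem_undup map_f// mem_filter ox.
Qed.

(** The step from level i.+2 to level i.+1 is given the level i, because the two
    representatives lie in one cluster of level i.+1, whose diameter is bounded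
    by [diamscale i.+1] and so by [pairscale i]. *)
Let edges := fix edges j : seq (nat * (Z * Z)) := if j is i.+1 then
  [seq (i, (canon (R i.+2) z, canon (R i.+1) z)) | z <- oddreps i.+2] ++ edges i else [::].

Let edges_parl j P : parl (edges j) P = T j.+1 P.
Proof.
elim: j => [|i IH]; first by rewrite /parl big_nil T_low.
by rewrite /parl/= big_cat/= -/(parl (edges i) P) IH big_map/= -T_step addbK.
Qed.

Let edges_mem j e : e \in edges j -> (e.1 < j)%N /\ near (pairscale e.1) e.2.1 e.2.2.
Proof.
elim: j => //= i IH; rewrite mem_cat => /orP[/mapP[z _ -> /=]|/IH[ei]]; last first.
  by split=> //; exact: ltnW.
split=> //; have [_ _ _ d _] := scale_facts i; apply: near_le d _; apply: R_within.
apply: (eqv_trans (eR _)) (canon_rel z (eR _)).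
by apply: (eqv_sym (eR _)); apply: R_succ; exact: canon_rel.
Qed.

Let edges_cnt j k : (cnt (edges j) k <= size (oddreps k.+2))%N.
Proof.
elim: j => //= i IH; rewrite /cnt count_cat -/(cnt (edges i) k) count_map.
have [ik|ik] := eqVneq i k.
  have -> : cnt (edges i) k = 0%N.
    apply/eqP; rewrite -leqn0 leqNgt -has_count; apply/hasPn => e /edges_mem[].
    by rewrite -ik ltn_neqAle => /andP[].
  by rewrite addn0 ik; apply: leq_trans (count_size _ _) _.
by rewrite (eq_count (a2 := pred0)) ?count_pred0// => z /=; exact/negbTE.
Qed.

Lemma small_decomposition :
  exists l, [/\ valid l, differ fset0 F l & sparse l (M - 2)].
Proof.
exists (edges K); split=> [e /edges_mem[]//|P|k].
  rewrite par0 edges_parl; apply: eq_par => x _.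
  by have := canon_rel x (eR K.+1); rewrite {1}/R cluster_top// => <-.
apply: (@leq_trans (size (oddreps k.+2) * 2 ^ (M - 2))); first by rewrite leq_mul2r edges_cnt orbT.
have := oddreps_size k.+2; rewrite -{1}(subnK M2) !expnD !expnS; lia.
Qed.

End Decomposition.

Lemma small_empty (Z : clopen_uniformity) M : small M (fset0 : {fset Z}).
Proof. by move=> K m _; exists [::]. Qed.

(** * Closeness in the Boolean group *)

Section Sparse.
Context {Z : clopen_uniformity}.
Implicit Types (F G : {fset Z}) (l : seq (nat * (Z * Z))).

(** The distance of F and G is at most 2 ^ -T, in terms of pairs. *)
Definition close T F G := exists l, [/\ valid l, differ F G l & sparse l T].

Lemma fsetxx F : fsetx F F = fset0.
Proof. by apply/fsetP => x; rewrite in_fsetx addbb inE. Qed.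

Lemma fsetxC F G : fsetx F G = fsetx G F.
Proof. by apply/fsetP => x; rewrite !in_fsetx addbC. Qed.

Lemma fsetxA F G H : fsetx F (fsetx G H) = fsetx (fsetx F G) H.
Proof. by apply/fsetP => x; rewrite !in_fsetx addbA. Qed.

Lemma fset0x F : fsetx fset0 F = F.
Proof. by apply/fsetP => x; rewrite in_fsetx inE. Qed.

Lemma fsetx_eq0 F G : fsetx F G = fset0 -> F = G.
Proof.
move=> FG; apply/fsetP => x; have : x \in fsetx F G = false by rewrite FG inE.
by rewrite in_fsetx; case: (x \in F); case: (x \in G).
Qed.

Lemma differ_fsetx F G l : differ fset0 (fsetx F G) l <-> differ F G l.
Proof.
by split=> d P; have := d P; rewrite par_fsetx par0/=; case: (par F P); case: (par G P); case: (parl l P).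
Qed.

Lemma differ_translate F G H l : differ F G l -> differ (fsetx H F) (fsetx H G) l.
Proof. by move=> d P; rewrite !par_fsetx d addbA. Qed.

Lemma close_translate T F G H : close T F G -> close T (fsetx H F) (fsetx H G).
Proof. by move=> [l [vl dl sl]]; exists l; split=> //; exact: differ_translate. Qed.

Lemma close_sym T F G : close T F G -> close T G F.
Proof.
move=> [l [vl dl sl]]; exists l; split=> // P; rewrite dl.
by case: (par F P); case: (parl l P).
Qed.

Lemma close_refl T F : close T F F.
Proof.
exists [::]; split=> [e //|P|k]; last by rewrite mul0n.
by rewrite /parl big_nil addbF.
Qed.

Lemma parl_cat l l' P : parl (l ++ l') P = parl l P (+) parl l' P.
Proof. exact: big_cat. Qed.

Lemma cnt_cat l l' k : cnt (l ++ l') k = (cnt l k + cnt l' k)%N.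
Proof. exact: count_cat. Qed.

Lemma valid_cat l l' : valid l -> valid l' -> valid (l ++ l').
Proof. by move=> vl vl' e; rewrite mem_cat => /orP[/vl|/vl']. Qed.

Lemma close_trans T F G H : close T.+1 F G -> close T.+1 G H -> close T F H.
Proof.
move=> [l [vl dl sl]] [l' [vl' dl' sl']]; exists (l ++ l'); split=> [|P|k].
- exact: valid_cat.
- by rewrite dl' dl parl_cat addbA.
- by have := sl k; have := sl' k; rewrite cnt_cat expnS mulnDl; lia.
Qed.

Lemma close_edge T n p q : (pairscale T <= n)%N -> near n p q ->
  close T [fset p] [fset q].
Proof.
move=> Tn pq; exists [:: (T, (p, q))]; split=> [e|P|k].
- by rewrite inE => /eqP ->; exact: near_le pq.
- by rewrite !par1 /parl big_seq1/=; case: (P p); case: (P q).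
- rewrite /cnt/= addn0; case: eqP => [->|]; first by rewrite mul1n.
  by rewrite mul0n.
Qed.

Lemma shadows F n : exists T, forall F', close T F F' ->
  {in F, forall p, exists2 x, x \in F' & near n p x}.
Proof.
have [k kP] := stable_ex F; pose K := (k + #|` F| + n)%N; exists K.
move=> F' [l [vl dF sl]] p pF.
have [sepF _] := kP K (ltac:(rewrite /K; lia)).
have [m lK] := @finite_bound _ l (fun e n => (e.1 < n)%N)
  (fun e i j ij ei => leq_trans ei ij) (fun e _ => ex_intro _ e.1.+1 (ltnSn _)).
have lK' : {in l, forall e, e.1 < K + m}%N.
  by move=> e /lK /= eK; apply: leq_trans eK _; lia.
have szF : (#|` F| <= 2 ^ K)%N.
  by apply: leq_trans (ltnW (ltn_expl _ (isT : 1 < 2)%N)) _; rewrite leq_exp2l// /K; lia.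
have [x xF px] := shadow dF vl sl (leqnn K) (leq_addr m K) lK' szF sepF pF.
exists x => //; apply: near_le px; have [_ d _ _ _] := scale_facts K.
by apply: leq_trans d; rewrite /K; lia.
Qed.

Lemma close_singleton n p : exists T, forall q, close T [fset p] [fset q] -> near n p q.
Proof.
have [T TP] := shadows [fset p] n; exists T => q /TP /(_ p).
by rewrite inE eqxx => /(_ isT)[x]; rewrite inE => /eqP ->.
Qed.

(** The empty set differs from a singleton in parity; two points of F would both
    have shadows in the singleton. *)
Lemma close_to_singletons (P : Z -> Prop) F :
  (forall z, ~ P z -> exists n, forall z', near n z z' -> ~ P z') ->
  (forall z, P z -> F <> [fset z]) ->
  exists T, forall z, P z -> ~ close T F [fset z].
Proof.
move=> clP noF.
have [F0|/fset0Pn[p pF]] := eqVneq F fset0.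
  exists 0%N => z _ [l [_ dl _]]; have := dl predT; rewrite F0 par0 par1 /parl.
  by rewrite big1.
have [[q qF pq]|single] := pselect (exists2 q, q \in F & p <> q).
  have [n npq] : exists n, ~ near n p q.
    apply: contrapT => no; apply: pq; apply: near_sep => n; apply: contrapT => nn.
    by apply: no; exists n.
  have [T TP] := shadows F n.+1; exists T => z _ /TP cl; apply: npq.
  have [x] := cl _ pF; rewrite inE => /eqP -> px.
  have [y] := cl _ qF; rewrite inE => /eqP -> qx.
  by apply: near_trans px (near_sym qx).
have Fp : F = [fset p].
  apply/fsetP => q; rewrite inE; apply/idP/eqP => [qF|->//].
  by apply: contrapT => /nesym pq; apply: single; exists q.
have [|n nP] := clP p; first by move=> /noF.
by have [T TP] := close_singleton n p; exists T => z Pz; rewrite Fp => /TP/nP.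
Qed.

Lemma small_open M F : exists T, forall G, close T F G -> (small M G <-> small M F).
Proof.
by have [T TP] := small_local M F; exists T => G [l [vl dl sl]]; exact: TP dl vl sl.
Qed.

(** A set H arbitrarily close to the empty set is small for every M, since
    smallness is locally constant.  So it has no odd clusters at all, while at a
    level at which H is separated every point of H is an odd cluster. *)
Lemma close_sep F G : (forall T, close T F G) -> F = G.
Proof.
move=> FG; apply: fsetx_eq0; set H := fsetx F G.
have clH T : close T fset0 H.
  by have [l [vl dl sl]] := FG T; exists l; split=> //; apply/differ_fsetx.
have smH M : small M H.
  have [T TP] := small_open M H; apply/(TP fset0); first exact/close_sym/clH.
  exact: small_empty.
have [n sn] := separated_ex H; apply/eqP; apply: contraT => /fset0Pn[x xH].
have sK : separated H (linkscale n) by apply: separated_le sn; exact: link_le.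
have [s + cov] := smH n.+1 n n sK; case: s cov => [|y s] cov; last first.
  by rewrite /= mulSn leqNgt ltn_addr// ltn_exp2l.
have [] // := cov x xH; rewrite cluster_top// /oddc /par (big_fsetD1 x)//= big1_fset.
  by rewrite addbF; apply/asboolP.
by move=> y; rewrite !inE => /andP[yx _] _; apply/asboolP => xy; rewrite xy eqxx in yx.
Qed.

Lemma small_close M F : small M.+2 F -> close M fset0 F.
Proof.
move=> sF; have [n sn] := separated_ex F.
have sK : separated F (linkscale n) by apply: separated_le sn; exact: link_le.
have [l [vl dl sl]] := small_decomposition (isT : 2 <= M.+2)%N sF sK.
by exists l; split=> //; move: sl; rewrite subn2.
Qed.

End Sparse.

(** * The Boolean group and its dimensions *)

Local Open Scope classical_set_scope.
Local Open Scope ring_scope.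

Section Norm.
Context {R : realType} {Z : clopen_uniformity}.
Implicit Types (F G : {fset Z}) (r s : R).

(** The first alternative bounds the norm by one; a singleton, for instance, is
    not a sum of pairs. *)
Definition norm_le F r := 1 <= r \/ exists l,
  [/\ valid l, differ fset0 F l & forall k, (cnt l k)%:R <= r * 2 ^+ k].

Definition norm F : R := inf [set r : R | 0 < r /\ norm_le F r].

Lemma norm_le_mono F r s : r <= s -> norm_le F r -> norm_le F s.
Proof.
move=> rs [r1|[l [vl dl cl]]]; first by left; exact: le_trans rs.
right; exists l; split=> // k; apply: le_trans (cl k) _.
by rewrite ler_wpM2r// exprn_ge0.
Qed.

Let norm_set F : has_inf [set r : R | 0 < r /\ norm_le F r].
Proof.
split; first by exists 1; split=> //; left.
by exists 0 => r [/ltW].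
Qed.

Lemma norm_ge0 F : 0 <= norm F.
Proof. by apply: lb_le_inf (norm_set F).1 _ => r [/ltW]. Qed.

Lemma norm_leP F r : norm F < r -> norm_le F r.
Proof.
rewrite -subr_gt0 => /(inf_adherent)/(_ (norm_set F))[s [_ sF]].
by rewrite addrC subrK => /ltW sr; exact: norm_le_mono sF.
Qed.

Lemma le_norm F r : 0 < r -> norm_le F r -> norm F <= r.
Proof. by move=> r0 Fr; apply: ge_inf (norm_set F).2 _ _. Qed.

Lemma normD F G : norm (fsetx F G) <= norm F + norm G.
Proof.
apply/ler_addgt0Pr => e e0; set a := norm F + e / 2; set b := norm G + e / 2.
have [Fa Gb] : norm_le F a /\ norm_le G b.
  by split; apply: norm_leP; rewrite ltrDl divr_gt0.
have a0 : 0 < a by rewrite ltr_wpDl ?norm_ge0 ?divr_gt0.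
have b0 : 0 < b by rewrite ltr_wpDl ?norm_ge0 ?divr_gt0.
have -> : norm F + norm G + e = a + b by rewrite /a /b; lra.
apply: le_norm; first exact: addr_gt0.
case: Fa => [a1|[l [vl dl cl]]]; first by left; lra.
case: Gb => [b1|[l' [vl' dl' cl']]]; first by left; lra.
right; exists (l ++ l'); split=> [|P|k]; first exact: valid_cat.
  by rewrite par_fsetx dl dl' par0 parl_cat.
by rewrite cnt_cat natrD mulrDl lerD.
Qed.

Lemma norm_close T F : norm F < 2^-1 ^+ T.+1 -> close T.+1 fset0 F.
Proof.
move=> /norm_leP[|[l [vl dl cl]]]; last first.
  exists l; split=> // k; have := cl k; rewrite exprVn mulrC ler_pdivlMr ?exprn_gt0//.
  by rewrite -!natrX -natrM ler_nat.
by rewrite leNgt exprn_ilt1 ?invr_ge0 ?invf_lt1 ?ltr1n.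
Qed.

Lemma close_norm T F : close T fset0 F -> norm F <= 2^-1 ^+ T.
Proof.
move=> [l [vl dl sl]]; apply: le_norm; first by rewrite exprn_gt0 ?invr_gt0.
right; exists l; split=> // k; rewrite exprVn mulrC ler_pdivlMr ?exprn_gt0//.
by rewrite -!natrX -natrM ler_nat.
Qed.

End Norm.

Definition boolean_group (R : realType) (Z : clopen_uniformity) : Type := {fset Z}.

Section BooleanGroup.
Context {R : realType} {Z : clopen_uniformity}.
Let G := boolean_group R Z.

HB.instance Definition _ := Choice.on G.

Let dist (F F' : G) : R := norm (fsetx F F').

Lemma close_fsetx T (F F' : {fset Z}) : close T fset0 (fsetx F F') <-> close T F F'.
Proof.
by split=> -[l [vl dl sl]]; exists l; split=> //; move: dl; rewrite differ_fsetx.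
Qed.

Let distxx F : dist F F = 0.
Proof.
apply/eqP; rewrite eq_le norm_ge0 andbT /dist fsetxx; apply/ler_addgt0Pr => e e0.
rewrite add0r; apply: le_norm => //; right; exists [::]; split=> // [P|k].
  by rewrite /parl big_nil par0.
by rewrite mulr_ge0// ?ltW// exprn_ge0.
Qed.

Let dist_eq0 F F' : dist F F' = 0 -> F = F'.
Proof.
move=> d0; apply: close_sep => T; apply/close_fsetx.
have : close T.+1 fset0 (fsetx F F').
  by apply: (@norm_close R); rewrite -/(dist F F') d0 exprn_gt0 ?invr_gt0.
move=> c; exact: close_trans c (close_refl _ _).
Qed.

Let dist_sym F F' : dist F F' = dist F' F.
Proof. by rewrite /dist fsetxC. Qed.

Let dist_triangle H F F' : dist F F' <= dist F H + dist H F'.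
Proof.
rewrite /dist; have -> : fsetx F F' = fsetx (fsetx F H) (fsetx H F').
  by rewrite fsetxA -(fsetxA F H H) fsetxx (fsetxC F fset0) fset0x.
exact: normD.
Qed.

HB.instance Definition _ := isMetric.Build R G distxx dist_eq0 dist_sym dist_triangle.

Let fsetx0 : right_id (fset0 : G) fsetx.
Proof. by move=> F; rewrite fsetxC fset0x. Qed.

HB.instance Definition _ := isGroup.Build G (@fsetxA Z) (@fset0x Z) fsetx0
  (@fsetxx Z) (@fsetxx Z).

Lemma nbhs_close (F : G) (V : set G) :
  nbhs F V <-> exists T, forall F', close T F F' -> V F'.
Proof.
split=> [/nbhs_ballP[e /= e0 eV]|[T TV]].
  pose T := Num.bound e^-1; have Te : 2^-1 ^+ T < e.
    rewrite exprVn -[ltRHS]invrK ltf_pV2 ?posrE ?invr_gt0 ?exprn_gt0//.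
    apply: lt_trans (archi_boundP _) _; first by rewrite invr_ge0 ltW.
    by rewrite -natrX ltr_nat ltn_expl.
  exists T => F' /close_fsetx /(@close_norm R) FF'; apply: eV.
  rewrite ballEmdist /=; apply: le_lt_trans FF' _; exact: Te.
apply/nbhs_ballP; exists (2^-1 ^+ T.+1); first by rewrite /= exprn_gt0 ?invr_gt0.
move=> F'; rewrite ballEmdist /= => /(@norm_close R) /close_fsetx FF'; apply: TV.
exact: close_trans FF' (close_refl _ _).
Qed.

Let mul_continuous : continuous (fun p : G * G => (p.1 * p.2)%g).
Proof.
move=> [F F'] V /nbhs_close[T TV].
exists ([set H | close T.+1 F H], [set H | close T.+1 F' H]) => /=.
  by split; apply/nbhs_close; exists T.+1.
move=> [H H'] /= [FH F'H']; apply: TV; apply: (close_trans (G := fsetx H F')).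
  by have := close_translate F' FH; rewrite (fsetxC F' F) (fsetxC F' H).
exact: close_translate.
Qed.

Let inv_continuous : continuous (fun F : G => (F^-1)%g).
Proof. by move=> F V. Qed.

HB.instance Definition _ := isTopologicalGroup.Build G mul_continuous inv_continuous.

End BooleanGroup.

Lemma dim_value0 (P : nat -> Prop) : P 1%N -> ~ P 0%N -> dim_value P = 0%E.
Proof.
move=> P1 P0; rewrite /dim_value; case: pselect => [e|[]]; last first.
  by exists 1%N; apply/asboolP.
case: ex_minnP => m /asboolP Pm /(_ 1%N) mle.
by case: m Pm mle => [//|[//|m]] _; move/(_ (introT (asboolP _) P1)).
Qed.

Lemma dim_value_gt0 (P : nat -> Prop) : ~ P 1%N -> ~ P 0%N -> (0 < dim_value P)%E.
Proof.
move=> P1 P0; rewrite /dim_value; case: pselect => [e|//].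
by case: ex_minnP => -[|[|m]] /asboolP Pm _.
Qed.

(** In a refinement of multiplicity one, all members are clopen. *)
Lemma separating_clopen (T : topologicalType) (A B : set T) :
  closed A -> closed B -> A `&` B = set0 -> covering_dim_le_pred 1 T ->
  exists W : set T, [/\ open W, open (~` W), A `<=` W & B `<=` ~` W].
Proof.
move=> cA cB AB; pose U (i : 'I_2) := if i == ord0 then ~` A else ~` B.
case/(_ _ U).
  split=> [i|]; first by rewrite /U; case: ifP => _; exact: closed_openC.
  rewrite -subTset => x _; have [Ax|nAx] := pselect (A x); last by exists ord0.
  exists (lift ord0 ord0) => // Bx; have : (A `&` B) x by [].
  by rewrite AB.
move=> m [V [[oV cV] VU V1]].
have Vx x : exists j, V j x.
  by have : [set: T] x by []; rewrite -cV => -[j _ Vj]; exists j.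
have Vuniq x i j : V i x -> V j x -> i = j.
  move=> Vi Vj; apply/eqP; have := V1 x; apply: contraTT => ij; rewrite -ltnNge.
  apply: (@leq_trans #|[set i; j]%SET|); first by rewrite cards2 ij.
  apply: subset_leq_card; apply/fintype.subsetP => k.
  by rewrite !inE => /orP[] /eqP ->.
pose W := \bigcup_(j in [set j | ~ (V j `<=` ~` A)]) V j.
have WC : ~` W = \bigcup_(j in [set j | V j `<=` ~` A]) V j.
  apply/seteqP; split=> x.
    move=> nW; have [j Vj] := Vx x; exists j => //=; apply: contrapT => jA.
    by apply: nW; exists j.
  by move=> [j /= jA Vj] [j' /= j'A Vj']; apply: j'A; rewrite (Vuniq _ _ _ Vj' Vj).
exists W; split.
- by apply: bigcup_open => j _; exact: oV.
- by rewrite WC; apply: bigcup_open => j _; exact: oV.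
- by move=> x Ax; have [j Vj] := Vx x; exists j => //= /(_ x Vj).
- move=> x Bx [j /= jA Vj]; have [i] := VU j; rewrite /U; case: ifP => _ // /(_ x Vj).
  exact.
Qed.

Section GroupTopology.
Context (R : realType) (Z : clopen_uniformity).
Let G : topologicalGroupType := boolean_group R Z.

Lemma boolean_group_metrizable : metrizable R G.
Proof. by exists (boolean_group R Z), id, id; split=> // x V. Qed.

(** Translates of the set of small sets. *)
Let clopen_base (F : G) (V : set G) : nbhs F V ->
  exists U : set G, [/\ open U, closed U, U F & U `<=` V].
Proof.
move=> /nbhs_close[T TV]; pose U : set G := [set F' | small T.+2 (fsetx F F')].
have U_loc F1 : exists T, forall F', close T F1 F' -> (U F' <-> U F1).
  have [T' T'P] := small_open T.+2 (fsetx F F1).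
  by exists T' => F' F1F'; apply: T'P; exact: close_translate.
exists U; split.
- rewrite openE => F1 UF1; apply/nbhs_close; have [T' T'P] := U_loc F1.
  by exists T' => F' /T'P[_]; apply.
- rewrite -[U]setCK; apply: open_closedC; rewrite openE => F1 UF1; apply/nbhs_close.
  by have [T' T'P] := U_loc F1; exists T' => F' /T'P[H _] /H.
- by rewrite /U/= fsetxx; exact: small_empty.
- by move=> F' /small_close /close_fsetx; exact: TV.
Qed.

Lemma boolean_group_ind : small_ind G = 0%E.
Proof.
apply: dim_value0; last by move=> /seteqP[/(_ (fset0 : G) I)].
move=> F V /clopen_base[U [oU cU UF UV]]; exists U; split=> //.
rewrite /= -subset0 => -[x xU] _; have [] := set_mem xU.
by move/closure_id: cU => <-; have /interior_id -> := oU.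
Qed.

Section Embedding.
Context (e : Z -> Prop).
Context (e_closed : forall z, ~ e z -> exists n, forall z', near n z z' -> ~ e z').

Lemma closed_singletons : closed [set ([fset z] : G) | z in e].
Proof.
set E := image _ _; rewrite -[E]setCK; apply: open_closedC; rewrite openE => F nEF.
have [|T TP] := close_to_singletons (F := F) e_closed.
  by move=> z ez FE; apply: nEF; exists z.
by apply/nbhs_close; exists T => F' FF' [z ez zF']; apply: TP ez _; rewrite zF'.
Qed.

End Embedding.

Lemma nbhs_singleton (p : Z) (V : set G) :
  nbhs ([fset p] : G) V -> exists n, forall q, near n p q -> V [fset q].
Proof.
move=> /nbhs_close[T TV]; exists (pairscale T) => q pq; apply: TV.
exact: close_edge pq.
Qed.

Lemma singletons_embed (S : topologicalType) (i : S -> Z) :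
  injective i ->
  (forall s V, nbhs s V <-> exists n, forall s', near n (i s) (i s') -> V s') ->
  (forall z, ~ range i z -> exists n, forall s, ~ near n z (i s)) ->
  embeds_as_closed_subspace S G.
Proof.
move=> i_inj i_nbhs i_closed; pose E : set G := [set ([fset z] : G) | z in range i].
exists E.
  apply: closed_singletons => z /i_closed[n nP]; exists n => z' zz' [s _ sz'].
  by apply: (nP s); rewrite sz'.
have Ei s : E [fset i s] by exists (i s) => //; exists s.
pose f s : E := SigSub (mem_set (Ei s)).
have gP (x : E) : exists s, val x = [fset i s].
  by case: x => x /= /set_mem[_ [s _ <-] <-]; exists s.
pose g (x : E) : S := projT1 (cid (gP x)).
have fK : cancel f g.
  move=> s; rewrite /g; case: cid => s' /= /fset1_inj ss'.
  by apply: i_inj.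
have gK : cancel g f.
  by move=> x; apply: val_inj; rewrite /g; case: cid => s /= ->.
exists f, g; split=> //.
  apply: continuous_comp_initial => s V /nbhs_singleton[n nV].
  by apply/i_nbhs; exists n => s' /nV.
move=> x V; rewrite -{1}[x]gK; set s := g x => /i_nbhs[n]; rewrite fK => nV.
have [T TP] := close_singleton n (i s).
have : nbhs (f s) (set_val @^-1` [set F | close T [fset i s] F]).
  by apply: initial_continuous; apply/nbhs_close; exists T.
rewrite gK => near_x; suff : nbhs x (g @^-1` V) by [].
apply: filterS near_x => y /=; rewrite -{1}(gK y) /= => /TP; exact: nV.
Qed.

End GroupTopology.

Local Close Scope ring_scope.
Local Close Scope classical_set_scope.
Local Close Scope fset_scope.

(** * Baire category for letters *)

Lemma word_limit (L : Type) (u : nat -> seq L) :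
  (forall n, exists x w, u n.+1 = u n ++ x :: w) ->
  exists c : nat -> L, forall n, (n <= size (u n))%N /\ u n = mkseq c (size (u n)).
Proof.
move=> step; have [x0 _] := step 0%N.
have chain n m : (n <= m)%N -> exists w, u m = u n ++ w.
  move=> nm; rewrite -(subnKC nm); elim: (m - n)%N => [|d [w IH]].
    by exists [::]; rewrite addn0 cats0.
  have [x [w' e]] := step (n + d)%N; exists (w ++ x :: w').
  by rewrite addnS e IH catA.
have long n : (n <= size (u n))%N.
  elim: n => // n IH; have [x [w ->]] := step n.
  by rewrite size_cat /= addnS ltnS (leq_trans IH)// leq_addr.
exists (fun i => nth x0 (u i.+1) i) => n; split=> //.
apply: (@eq_from_nth _ x0); first by rewrite size_mkseq.
move=> i iu; rewrite nth_mkseq//.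
have [ni|ni] := leqP n i.+1; last first.
  by have [w ->] := chain _ _ (ltnW ni); rewrite nth_cat long.
by have [w ->] := chain _ _ ni; rewrite nth_cat iu.
Qed.

Definition ext (t : seq bool) (b : nat -> bool) :=
  forall i, (i < size t)%N -> b i = nth false t i.

(** Letters that code a thread are zero at almost all even places, and so they
    are not recurrent. *)
Definition recurrent (b : nat -> bool) := forall N, exists2 j, (N <= j)%N & b j.*2.

Lemma ext_nil b : ext [::] b.
Proof. by []. Qed.

Lemma ext_prefix t t' b : prefix t t' -> ext t' b -> ext t b.
Proof.
move=> /prefixP[s ->] tb i it; rewrite tb ?size_cat ?ltn_addr//.
by rewrite nth_cat it.
Qed.

Lemma ext_mkseq b n : ext (mkseq b n) b.
Proof. by move=> i; rewrite size_mkseq => ni; rewrite nth_mkseq. Qed.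

Lemma mkseq_prefix t b n : ext t b -> (size t <= n)%N -> prefix t (mkseq b n).
Proof.
move=> tb tn; rewrite prefixE; apply/eqP/(@eq_from_nth _ false).
  by rewrite size_takel ?size_mkseq.
rewrite size_takel ?size_mkseq// => i it.
by rewrite nth_take// nth_mkseq ?tb// (leq_trans it).
Qed.

Lemma ext_comparable t t' b : ext t b -> ext t' b -> prefix t t' \/ prefix t' t.
Proof.
move=> tb t'b; have [tt'|/ltnW tt'] := leqP (size t) (size t'); [left|right].
  have -> : t' = mkseq b (size t'); last exact: mkseq_prefix.
  apply: (@eq_from_nth _ false); rewrite ?size_mkseq// => i it.
  by rewrite nth_mkseq// t'b.
have -> : t = mkseq b (size t); last exact: mkseq_prefix.
apply: (@eq_from_nth _ false); rewrite ?size_mkseq// => i it.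
by rewrite nth_mkseq// tb.
Qed.

Definition pad (t : seq bool) (i : nat) := nth true t i.

Lemma ext_pad t : ext t (pad t).
Proof. by move=> i it; apply: set_nth_default. Qed.

Lemma recurrent_pad t : recurrent (pad t).
Proof.
move=> N; exists (N + size t)%N; first by rewrite leq_addr.
by rewrite /pad nth_default//; lia.
Qed.

Section Category.
Implicit Types (t : seq bool) (b : nat -> bool) (P S : (nat -> bool) -> Prop).

Definition nowhere_dense S := forall t, exists2 t', prefix t t' &
  forall b, ext t' b -> ~ S b.

Definition comeager t P := exists2 S : nat -> (nat -> bool) -> Prop,
  (forall n, nowhere_dense (S n)) &
  forall b, ext t b -> (forall n, ~ S n b) -> P b.

Lemma comeager_mono t P Q : comeager t P ->
  (forall b, ext t b -> P b -> Q b) -> comeager t Q.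
Proof. by move=> [S nS SP] PQ; exists S => // b tb /SP Pb; apply/PQ/Pb. Qed.

Lemma comeager_sub t t' P : prefix t t' -> comeager t P -> comeager t' P.
Proof. by move=> tt' [S nS SP]; exists S => // b /(ext_prefix tt') /SP. Qed.

Lemma comeagerT t P : (forall b, ext t b -> P b) -> comeager t P.
Proof.
move=> tP; exists (fun _ _ => False) => [n t0|b /tP//].
by exists t0 => [|b _ []]; exact: prefix_refl.
Qed.

Lemma comeager_all (I : countType) t (P : I -> (nat -> bool) -> Prop) :
  (forall i, comeager t (P i)) -> comeager t (fun b => forall i, P i b).
Proof.
move=> cP; have /choice[S nS] : forall i, exists S : nat -> (nat -> bool) -> Prop,
    (forall n, nowhere_dense (S n)) /\
    forall b, ext t b -> (forall n, ~ S n b) -> P i b.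
  by move=> i; have [S nS SP] := cP i; exists S.
exists (fun (m : nat) b => if @choice.unpickle (I * nat)%type m is Some (i, n) then S i n b else False).
  move=> m; case: choice.unpickle => [[i n]|]; first exact: (nS i).1.
  by move=> t0; exists t0 => [|b _ []]; exact: prefix_refl.
move=> b tb nSb i; apply: (nS i).2 => // n.
by have := nSb (choice.pickle (i, n)); rewrite choice.pickleK.
Qed.

Lemma comeager_and t P Q : comeager t P -> comeager t Q ->
  comeager t (fun b => P b /\ Q b).
Proof.
move=> cP cQ; have /comeager_all cPQ : forall i : bool, comeager t (if i then P else Q).
  by case.
by apply: comeager_mono cPQ _ => b _ H; split; [exact: (H true)|exact: (H false)].
Qed.

Lemma comeager_not_nowhere_dense t S : nowhere_dense S ->
  comeager t (fun b => ~ S b).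
Proof. by move=> nS; exists (fun _ => S) => // b _ /(_ 0%N). Qed.

(** There are countably many cones, and the points of the cone of t that avoid
    all cones on which P is comeager form a nowhere dense set. *)
Lemma comeager_local t P :
  (forall t', prefix t t' -> exists2 t'', prefix t' t'' & comeager t'' P) ->
  comeager t P.
Proof.
move=> dense.
have good t' : comeager t (fun b => comeager t' P -> ext t' b -> P b).
  have [cP|] := pselect (comeager t' P); last by move=> ncP; apply: comeagerT.
  have [S nS SP] := cP; exists (fun n b => S n b) => // b _ Sb _ /SP; exact.
have nd : nowhere_dense (fun b => ext t b /\ forall t', comeager t' P -> ~ ext t' b).
  move=> r; have [[b [rb tb]]|no] := pselect (exists b, ext r b /\ ext t b); last first.
    by exists r; [exact: prefix_refl|move=> b rb [tb _]; apply: no; exists b].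
  have [r' [rr' tr']] : exists r', prefix r r' /\ prefix t r'.
    by case: (ext_comparable rb tb) => ?; [exists t|exists r]; rewrite prefix_refl.
  have [t'' r't'' ct''] := dense _ tr'.
  exists t''; first exact: prefix_trans r't''.
  by move=> b' t''b' [_ /(_ _ ct'')].
apply: comeager_mono (comeager_and (comeager_all good) (comeager_not_nowhere_dense t nd)) _.
move=> b tb [gb nb]; apply: contrapT => nPb; apply: nb; split=> // t' ct' t'b.
by apply: nPb; exact: gb ct' t'b.
Qed.

Lemma comeager_recurrent t : comeager t recurrent.
Proof.
have nd N : nowhere_dense (fun b => forall j, (N <= j)%N -> ~~ b j.*2).
  move=> t'; pose j := (N + size t')%N; exists (mkseq (pad t') j.*2.+1).
    by apply: mkseq_prefix; [exact: ext_pad|rewrite /j; lia].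
  move=> b tb /(_ j (leq_addr _ _)); rewrite tb ?size_mkseq// nth_mkseq// /pad nth_default//.
  by rewrite /j; lia.
have /comeager_all := fun N => comeager_not_nowhere_dense t (nd N).
move=> c; apply: comeager_mono c _ => b _ H N; apply: contrapT => no; apply: (H N) => j Nj.
by apply/negP => bj; apply: no; exists j.
Qed.

Lemma baire t P : comeager t P -> exists2 b, ext t b & P b.
Proof.
move=> [S nS SP].
have [|f [f0 fS]] := @dependent_choice (nat * seq bool)%type (fun x y =>
    [/\ y.1 = x.1.+1, exists a w, y.2 = x.2 ++ a :: w &
        forall b, ext y.2 b -> ~ S x.1 b]) _ (0%N, t).
  move=> [n r]; apply: cid; have [r' /prefixP[w r'E] nSr] := nS n r; subst r'.
  exists (n.+1, rcons (r ++ w) true); split=> //.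
    by case: w {nSr} => [|a w]; [exists true, [::]; rewrite cats0 cats1
      |exists a, (rcons w true); rewrite rcons_cat].
  by move=> b rb; apply: nSr; apply: ext_prefix rb; exact: prefix_rcons.
have f1 n : (f n).1 = n.
  by elim: n => [|n IH]; [rewrite f0|have [-> _ _] := fS n; rewrite IH].
have [c cf] := @word_limit _ (fun n => (f n).2) (fun n => let: And3 _ h _ := fS n in h).
have fc n : ext (f n).2 c by rewrite (cf n).2; exact: ext_mkseq.
have tc : ext t c by have := fc 0%N; rewrite f0.
exists c => //; apply: SP => // n.
by have [_ _] := fS n; rewrite f1; apply; exact: fc.
Qed.

End Category.

(** * Large sets of sequences of letters *)

(** A tail is a sequence of letters; a box restricts finitely many of its letters
    to cones. *)
Notation letter := (nat -> bool).
Notation tail := (nat -> letter).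
Notation box := (seq (seq bool)).

Lemma dependent_choice_inv (X : Type) (Inv : nat -> X -> Prop)
    (R : nat -> X -> X -> Prop) x0 :
  Inv 0%N x0 -> (forall n x, Inv n x -> exists y, R n x y /\ Inv n.+1 y) ->
  exists f, f 0%N = x0 /\ forall n, Inv n (f n) /\ R n (f n) (f n.+1).
Proof.
move=> I0 step.
have [|f [f0 fS]] := @dependent_choice (nat * X)%type (fun x y =>
    y.1 = x.1.+1 /\ (Inv x.1 x.2 -> R x.1 x.2 y.2 /\ Inv x.1.+1 y.2)) _ (0%N, x0).
  move=> [n x]; apply: cid; have [/step[y [Ry Iy]]|nI] := pselect (Inv n x).
    by exists (n.+1, y).
  by exists (n.+1, x).
have f1 n : (f n).1 = n.
  by elim: n => [|n IH]; [rewrite f0|have [-> _] := fS n; rewrite IH].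
exists (fun n => (f n).2); rewrite f0; split=> // n.
have In : Inv n (f n).2.
  elim: n => [|n IH]; first by rewrite f0.
  by have [_] := fS n; rewrite f1 => /(_ IH)[].
by have [_] := fS n; rewrite f1 => /(_ In)[].
Qed.

Definition consw (b : letter) (c : tail) : tail := fun i => if i is j.+1 then c j else b.
Definition catw (u : seq letter) (c : tail) : tail := foldr consw c u.

Lemma catw_cat u u' c : catw (u ++ u') c = catw u (catw u' c).
Proof. exact: foldr_cat. Qed.

Lemma catwE x0 u c i : catw u c i = if (i < size u)%N then nth x0 u i else c (i - size u)%N.
Proof. by elim: u i => [|b u IH] [|i] //=; rewrite ?subn0// ltnS IH. Qed.

Lemma consw_head_tail c : consw (c 0%N) (fun i => c i.+1) = c.
Proof. by apply/funext; case. Qed.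

Section Boxes.
Implicit Types (v w : box) (u : seq letter) (b : letter) (c : tail).

Definition refines w v := forall i, prefix (nth [::] v i) (nth [::] w i).

Definition inbox v c := forall i, recurrent (c i) /\ ext (nth [::] v i) (c i).

Fixpoint fits v u := if u is b :: u' then
  [/\ recurrent b, ext (head [::] v) b & fits (behead v) u'] else True.

Lemma refines_refl v : refines v v.
Proof. by move=> i; exact: prefix_refl. Qed.

Lemma refines_trans w v v' : refines w v -> refines v v' -> refines w v'.
Proof. by move=> wv vv' i; exact: prefix_trans (vv' i) (wv i). Qed.

Lemma refines_behead w v : refines w v -> refines (behead w) (behead v).
Proof. by move=> wv i; rewrite !nth_behead. Qed.

Lemma refines_head w v : refines w v -> prefix (head [::] v) (head [::] w).
Proof. by rewrite -!nth0. Qed.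

Lemma refines_cons t w v : prefix (head [::] v) t -> refines w (behead v) ->
  refines (t :: w) v.
Proof. by rewrite -nth0 => tv wv [|i] //=; rewrite -nth_behead. Qed.

Lemma refines_drop n w v : refines w v -> refines (drop n w) (drop n v).
Proof. by move=> wv i; rewrite !nth_drop. Qed.

Lemma inbox_refines w v c : refines w v -> inbox w c -> inbox v c.
Proof. by move=> wv wc i; have [r e] := wc i; split=> //; exact: ext_prefix (wv i) e. Qed.

Lemma inbox_consw v b c :
  inbox v (consw b c) <-> [/\ recurrent b, ext (head [::] v) b & inbox (behead v) c].
Proof.
rewrite -nth0; split=> [vbc|[rb vb vc] [|i]] //; last first.
  by have := vc i; rewrite nth_behead.
by split=> [||i]; [exact: (vbc 0%N).1|exact: (vbc 0%N).2|rewrite nth_behead; exact: (vbc i.+1)].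
Qed.

Lemma drop_behead n v : drop n.+1 v = drop n (behead v).
Proof. by case: v => //=; rewrite drop_nil. Qed.

Lemma inbox_catw v u c : inbox v (catw u c) <-> fits v u /\ inbox (drop (size u) v) c.
Proof.
elim: u v => [|b u IH] v /=; first by rewrite drop0; split=> [|[]].
rewrite drop_behead; split=> [/inbox_consw[? ? /IH[]]//|[[? ? ?] ?]].
by apply/inbox_consw; split=> //; apply/IH.
Qed.

Lemma fits_refines w v u : refines w v -> fits w u -> fits v u.
Proof.
elim: u w v => [|b u IH] w v //= wv [rb /(ext_prefix (refines_head wv)) vb wu].
by split=> //; exact: IH (refines_behead wv) wu.
Qed.

Lemma fits_cat v u u' : fits v (u ++ u') <-> fits v u /\ fits (drop (size u) v) u'.
Proof.
elim: u v => [|b u IH] v /=; first by rewrite drop0; split=> [|[]].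
by rewrite drop_behead; split=> [[? ? /IH[]]|[[? ? ?] ?]] //; split=> //; apply/IH.
Qed.

Lemma fits_nth v u : fits v u -> forall i, (i < size u)%N ->
  recurrent (nth (fun _ => false) u i) /\ ext (nth [::] v i) (nth (fun _ => false) u i).
Proof.
elim: u v => [|b u IH] v //= [rb vb vu] [_|i /(IH _ vu)]; first by rewrite nth0.
by rewrite nth_behead.
Qed.

(** Words that grow inside shrinking boxes converge to a tail that stays in all
    of these boxes. *)
Lemma fusion (f : nat -> seq letter * box) :
  (forall n, exists b u, [/\ (f n.+1).1 = (f n).1 ++ b :: u, fits (f n).2 (b :: u) &
     refines (f n.+1).2 (drop (size (b :: u)) (f n).2)]) ->
  exists c, forall n, (n <= size (f n).1)%N /\
    exists2 c', c = catw (f n).1 c' & inbox (f n).2 c'.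
Proof.
move=> step.
have [c cP] := @word_limit _ (fun n => (f n).1)
  (fun n => let: ex_intro b (ex_intro u (And3 e _ _)) := step n in
            ex_intro _ b (ex_intro _ u e)).
exists c => n; have [ln fn] := cP n; split=> //.
exists (fun i => c (size (f n).1 + i)%N).
  apply/funext => i; rewrite (catwE (fun _ => false)); case: ltnP => iu.
    by rewrite fn nth_mkseq.
  by rewrite subnKC.
move=> i.
have chain m : exists u, [/\ (m <= size u)%N, (f (n + m)%N).1 = (f n).1 ++ u,
    fits (f n).2 u & refines (f (n + m)%N).2 (drop (size u) (f n).2)].
  elim: m => [|m [u [mu e fu ru]]].
    by exists [::]; rewrite addn0 cats0 drop0; split=> //; exact: refines_refl.
  have [b [u' [e' fu' ru']]] := step (n + m)%N; exists (u ++ b :: u'); rewrite addnS.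
  split; first by rewrite size_cat /= addnS ltnS (leq_trans mu)// leq_addr.
  - by rewrite e' e catA.
  - by apply/fits_cat; split=> //; exact: fits_refines ru fu'.
  - apply: refines_trans ru' _; rewrite size_cat [(size u + _)%N]addnC -drop_drop; exact: refines_drop.
have [u [iu e fu _]] := chain i.+1; have [_ fm] := cP (n + i.+1)%N.
have -> : c (size (f n).1 + i)%N = nth (fun _ => false) u i.
  rewrite -[u](drop_size_cat _ (erefl (size (f n).1))) -e fm nth_drop nth_mkseq//.
  by rewrite e size_cat ltn_add2l.
exact: fits_nth fu _ iu.
Qed.

End Boxes.

Section Large.
Implicit Types (E : tail -> Prop) (v w : box) (u : seq letter) (b : letter) (c : tail).

(** E is large in v if comeager many choices of the first letter, each followed
    by a suitable refinement of the box of the other letters, and so on, lead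
    after finitely many steps to a box that is contained in E.  Here [r] refines
    any box that may be demanded before. *)
Inductive large : (tail -> Prop) -> box -> Prop :=
| large_box E v : (forall c, inbox v c -> E c) -> large E v
| large_step E v (P : letter -> Prop) (r : letter -> box -> box) :
    comeager (head [::] v) P ->
    (forall b w, refines (r b w) w) ->
    (forall b w, ext (head [::] v) b -> P b -> refines w (behead v) ->
       large (fun c => E (consw b c)) (r b w)) ->
    large E v.

Definition densely E v := forall w, refines w v -> exists2 w', refines w' w & large E w'.

Lemma large_mono E E' v : large E v -> (forall c, inbox v c -> E c -> E' c) -> large E' v.
Proof.
move=> El; elim: El E' => {E v} [E v Ev|E v P r cP rr _ IH] E' EE'.
  by apply: large_box => c vc; apply/EE'/Ev.
apply: large_step (comeager_and cP (comeager_recurrent _)) (rr) _ => b w vb [Pb rb] wv.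
apply: (IH b w) => // c wc; apply: EE'; apply/inbox_consw; split=> //.
exact: inbox_refines (refines_trans (rr _ _) wv) wc.
Qed.

Lemma densely_refines E v w : refines w v -> densely E v -> densely E w.
Proof. by move=> wv Ev w' /refines_trans -/(_ _ wv); exact: Ev. Qed.

Lemma densely_mono E E' v : densely E v -> (forall c, inbox v c -> E c -> E' c) -> densely E' v.
Proof.
move=> Ev EE' w wv; have [w' w'w El] := Ev w wv; exists w' => //.
apply: large_mono El _ => c w'c; apply: EE'.
exact: inbox_refines (refines_trans w'w wv) w'c.
Qed.

Lemma densely_box E v : (forall c, inbox v c -> E c) -> densely E v.
Proof.
move=> Ev w wv; exists w; first exact: refines_refl.
by apply: large_box => c /(inbox_refines wv); exact: Ev.
Qed.

Lemma large_fibers E v :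
  comeager (head [::] v) (fun b => recurrent b -> densely (fun c => E (consw b c)) (behead v)) ->
  large E v.
Proof.
move=> cE.
have /choice[r rP] : forall bw : letter * box, exists w', refines w' bw.2 /\
    (refines bw.2 (behead v) -> densely (fun c => E (consw bw.1 c)) (behead v) ->
     large (fun c => E (consw bw.1 c)) w').
  move=> [b w] /=; have [[wv dE]|no] := pselect (
      refines w (behead v) /\ densely (fun c => E (consw b c)) (behead v)).
    by have [w' w'w El] := dE _ wv; exists w'.
  by exists w; split=> [|wv Ev]; [exact: refines_refl|case: no].
apply: (@large_step _ _ _ (fun b w => r (b, w)) (comeager_and cE (comeager_recurrent _))).
  by move=> b w; exact: (rP (b, w)).1.
by move=> b w vb [Eb rb] wv; exact: ((rP (b, w)).2 wv (Eb rb)).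
Qed.

Lemma large_fiber E v : large E v -> comeager (head [::] v)
  (fun b => recurrent b -> exists2 w, refines w (behead v) & large (fun c => E (consw b c)) w).
Proof.
case=> {E v} [E v Ev|E v P r cP rr Er].
  apply: comeagerT => b vb rb; exists (behead v); first exact: refines_refl.
  by apply: large_box => c vc; apply: Ev; apply/inbox_consw.
apply: comeager_mono cP _ => b vb Pb _; exists (r b (behead v)); first exact: rr.
by apply: Er => //; exact: refines_refl.
Qed.

(** For each of the countably many boxes w of the other letters, the first letters
    that admit a refinement of w form a set that is comeager in cones dense in
    the cone of v. *)
Lemma densely_fiber E v : densely E v -> comeager (head [::] v)
  (fun b => recurrent b -> densely (fun c => E (consw b c)) (behead v)).
Proof.
move=> Ev.
have cE w : refines w (behead v) -> comeager (head [::] v) (fun b => recurrent b ->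
    exists2 w', refines w' w & large (fun c => E (consw b c)) w').
  move=> wv; apply: comeager_local => t vt.
  have [w' w'tw /large_fiber El] := Ev _ (refines_cons vt wv).
  exists (head [::] w'); first exact: (refines_head w'tw).
  apply: comeager_mono El _ => b _ H /H[w'' w''w' El]; exists w'' => //.
  exact: refines_trans w''w' (refines_behead w'tw).
have /comeager_all : forall w : box, comeager (head [::] v) (fun b => refines w (behead v) ->
    recurrent b -> exists2 w', refines w' w & large (fun c => E (consw b c)) w').
  move=> w; have [/cE/comeager_mono|nwv] := pselect (refines w (behead v)).
    by apply=> b _ H _.
  exact: comeagerT.
by move=> c; apply: comeager_mono c _ => b _ H rb w wv; exact: H.
Qed.

(** Follow the definition of [large], and choose each letter generically for all
    the sets D k at once. *)
Lemma reach E v (D : nat -> tail -> Prop) : large E v -> (forall k, densely (D k) v) ->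
  exists b u w, [/\ fits v (b :: u), refines w (drop (size (b :: u)) v),
    forall c, inbox w c -> E (catw (b :: u) c) &
    forall k, densely (fun c => D k (catw (b :: u) c)) w].
Proof.
move=> El; elim: El D => {E v} [E v Ev|E v P r cP rr _ IH] D Dv;
  have cD := comeager_all (fun k => densely_fiber (Dv k)).
  have [b vb [rb Db]] := baire (comeager_and (comeager_recurrent _) cD).
  exists b, [::], (behead v); split=> //=.
  - by rewrite drop1; exact: refines_refl.
  - by move=> c vc; apply: Ev; apply/inbox_consw.
  - by move=> k; exact: Db.
have [b vb [[rb Pb] Db]] := baire (comeager_and (comeager_and (comeager_recurrent _) cP) cD).
have bv := refines_refl (behead v).
have [b' [u [w [fu ru Eu Du]]]] := IH b _ vb Pb bv (fun k c => D k (consw b c))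
  (fun k => densely_refines (rr b _) (Db k rb)).
exists b, (b' :: u), w; split=> //.
- by split=> //; exact: fits_refines (rr b _) fu.
- by rewrite [size _]/= drop_behead; exact: refines_trans ru (refines_drop _ (rr b _)).
Qed.

End Large.

(** * Generic sequences of letters *)

Section Generic.
Implicit Types (E : tail -> Prop) (v w : box) (u : seq letter) (b : letter) (c : tail).

(** E contains a countable intersection of sets that are large in a dense family
    of boxes.  This plays the role of a comeager set.  It satisfies the theorem
    of Kuratowski and Ulam in both directions ([generic_fiber],
    [generic_fibers]). *)
Definition generic E v := exists2 D : nat -> tail -> Prop,
  forall k, densely (D k) v & forall c, inbox v c -> (forall k, D k c) -> E c.

Lemma generic_mono E E' v : generic E v -> (forall c, inbox v c -> E c -> E' c) ->
  generic E' v.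
Proof. by move=> [D Dv DE] EE'; exists D => // c vc /(DE _ vc); exact: EE'. Qed.

Lemma generic_refines E v w : refines w v -> generic E v -> generic E w.
Proof.
move=> wv [D Dv DE]; exists D => [k|c wc]; first exact: densely_refines (Dv k).
exact: DE (inbox_refines wv wc).
Qed.

Lemma generic_densely E v : densely E v -> generic E v.
Proof. by move=> Ev; exists (fun _ => E) => // c _ /(_ 0%N). Qed.

Lemma generic_all (I : countType) (E : I -> tail -> Prop) v :
  (forall i, generic (E i) v) -> generic (fun c => forall i, E i c) v.
Proof.
move=> gE; have /choice[D DP] : forall i, exists D : nat -> tail -> Prop,
    (forall k, densely (D k) v) /\ forall c, inbox v c -> (forall k, D k c) -> E i c.
  by move=> i; have [D Dv DE] := gE i; exists D.
exists (fun (m : nat) c => if @choice.unpickle (I * nat)%type m is Some (i, n)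
    then D i n c else True).
  move=> m; case: choice.unpickle => [[i n]|]; first exact: (DP i).1.
  exact: densely_box.
move=> c vc Dc i; apply: (DP i).2 => // n.
by have := Dc (choice.pickle (i, n)); rewrite choice.pickleK.
Qed.

Lemma generic_and E E' v : generic E v -> generic E' v ->
  generic (fun c => E c /\ E' c) v.
Proof.
move=> gE gE'; have /generic_all g : forall i : bool, generic (if i then E else E') v.
  by case.
by apply: generic_mono g _ => c _ H; split; [exact: (H true)|exact: (H false)].
Qed.

Lemma inbox_meet v w c : inbox v c -> inbox w c ->
  exists v', [/\ refines v' v, refines v' w & inbox v' c].
Proof.
move=> vc wc; pose long i := maxn (size (nth [::] v i)) (size (nth [::] w i)).
pose v' := mkseq (fun i => mkseq (c i) (long i)) (maxn (size v) (size w)).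
exists v'; split=> i; have [vi|iv] := ltnP i (maxn (size v) (size w)).
- rewrite nth_mkseq//; apply: mkseq_prefix; first exact: (vc i).2.
  by rewrite leq_maxl.
- by have si : (size v <= i)%N by [lia]; rewrite (nth_default _ si) prefix0s.
- rewrite nth_mkseq//; apply: mkseq_prefix; first exact: (wc i).2.
  by rewrite leq_maxr.
- by have si : (size w <= i)%N by [lia]; rewrite (nth_default _ si) prefix0s.
- by rewrite nth_mkseq//; split; [exact: (vc i).1|exact: ext_mkseq].
- split; first exact: (vc i).1.
  by rewrite nth_default ?size_mkseq//; exact: ext_nil.
Qed.

(** There are countably many boxes, and by [densely] a generic tail enters one of
    those in which E is generic. *)
Lemma generic_local E v :
  (forall w, refines w v -> exists2 w', refines w' w & generic E w') -> generic E v.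
Proof.
move=> dense.
have good w : generic (fun c => generic E w -> inbox w c -> E c) v.
  have [[D Dw DE]|nE] := pselect (generic E w); last first.
    by apply: generic_densely; apply: densely_box.
  exists (fun k c => inbox w c -> D k c) => [k v' v'v|c vc Dc _ wc]; last first.
    by apply: DE => // k; exact: Dc.
  have [[c [v'c wc]]|no] := pselect (exists c, inbox v' c /\ inbox w c); last first.
    exists v'; first exact: refines_refl.
    by apply: large_box => c v'c wc; case: no; exists c.
  have [z [zv' zw _]] := inbox_meet v'c wc.
  have [z' z'z Dz] := Dw k z zw; exists z'; first exact: refines_trans zv'.
  by apply: large_mono Dz _.
have enters : generic (fun c => exists w, generic E w /\ inbox w c) v.
  apply: generic_densely => w wv; have [w' w'w gE] := dense w wv; exists w' => //.
  by apply: large_box => c w'c; exists w'.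
apply: generic_mono (generic_and (generic_all good) enters) _ => c _ [gc [w [gw wc]]].
exact: gc gw wc.
Qed.

Lemma generic_fiber E v : generic E v -> comeager (head [::] v)
  (fun b => recurrent b -> generic (fun c => E (consw b c)) (behead v)).
Proof.
move=> [D Dv DE]; have c := comeager_all (fun k => densely_fiber (Dv k)).
apply: comeager_mono c _ => b vb Db rb; exists (fun k c => D k (consw b c)).
  by move=> k; exact: Db.
by move=> c vc Dc; apply: DE => //; apply/inbox_consw.
Qed.

Lemma generic_fibers E v : comeager (head [::] v)
    (fun b => recurrent b -> generic (fun c => E (consw b c)) (behead v)) ->
  generic E v.
Proof.
pose Q b := recurrent b -> generic (fun c => E (consw b c)) (behead v).
rewrite -/Q => cQ.
have /choice[D DP] : forall b, exists D : nat -> tail -> Prop, recurrent b -> Q b ->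
    (forall k, densely (D k) (behead v)) /\
    forall c, inbox (behead v) c -> (forall k, D k c) -> E (consw b c).
  move=> b; have [[rb /(_ rb)[D Dv DE]]|no] := pselect (recurrent b /\ Q b).
    by exists D.
  by exists (fun _ _ => True) => rb Qb; case: no.
exists (fun k c => Q (c 0%N) /\ D (c 0%N) k (fun i => c i.+1)).
  move=> k w wv; exists w; first exact: refines_refl.
  apply: large_fibers; apply: comeager_mono (comeager_sub (refines_head wv) cQ) _.
  move=> b wb Qb rb; apply: densely_mono (_ : densely (D b k) (behead w)) _ => [|c _ Dc].
    by apply: densely_refines (refines_behead wv) _; exact: ((DP b) rb Qb).1.
  by split.
move=> c vc Dc; rewrite -(consw_head_tail c).
have Qc := (Dc 0%N).1; have [_] := DP _ (vc 0%N).1 Qc; apply.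
  by move=> i; have := vc i.+1; rewrite nth_behead.
by move=> k; exact: (Dc k).2.
Qed.

(** The sets D n are reached one after the other, and [fusion] gives a tail in
    all of them. *)
Lemma generic_ex E v : generic E v -> exists2 c, inbox v c & E c.
Proof.
move=> [D Dv DE].
have [|n [u w] [/= fu ru Du]|f [f0 fP]] := @dependent_choice_inv (seq letter * box)
  (fun n x => [/\ fits v x.1, refines x.2 (drop (size x.1) v) &
                  forall k, densely (fun c => D k (catw x.1 c)) x.2])
  (fun n x y => exists b u, [/\ y.1 = x.1 ++ b :: u, fits x.2 (b :: u),
     refines y.2 (drop (size (b :: u)) x.2) & forall c, inbox y.2 c -> D n (catw y.1 c)])
  ([::], v).
- by split=> //=; rewrite drop0; exact: refines_refl.
- have [w' w'w Dw'] := Du n w (refines_refl w).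
  have [b [s [z [fs rs Ez Dz]]]] := reach Dw' (fun k => densely_refines w'w (Du k)).
  have fs' : fits w (b :: s) := fits_refines w'w fs.
  have rs' : refines z (drop (size (b :: s)) w) := refines_trans rs (refines_drop _ w'w).
  exists (u ++ b :: s, z); split.
    exists b, s; split=> // c /Ez /=; by rewrite catw_cat.
  split=> /=.
  - by apply/fits_cat; split=> //; exact: fits_refines ru fs'.
  - apply: refines_trans rs' _; rewrite size_cat [(size u + _)%N]addnC -drop_drop.
    exact: refines_drop.
  - by move=> k; apply: densely_mono (Dz k) _ => c _ /=; rewrite catw_cat.
have [c cP] := @fusion f (fun n => let: ex_intro b (ex_intro u (And4 e1 e2 e3 _)) :=
  (fP n).2 in ex_intro _ b (ex_intro _ u (And3 e1 e2 e3))).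
have vc : inbox v c by have [_ [c' ->]] := cP 0%N; rewrite f0.
exists c => //; apply: DE => // n.
have [_ [_ [_ [_ _ _ Dn]]]] := fP n; have [_ [c' -> wc']] := cP n.+1.
exact: Dn.
Qed.

Lemma generic_step E v : generic E v -> exists b,
  fits v [:: b] /\ generic (fun c => E (consw b c)) (behead v).
Proof.
move=> gE; have [b vb [rb gb]] := baire (comeager_and (comeager_recurrent _) (generic_fiber gE)).
by exists b; split=> //; exact: gb.
Qed.

Lemma generic_words n E E' v :
  (forall u, size u = n -> fits v u -> generic (fun c => E (catw u c)) (drop n v) ->
     generic (fun c => E' (catw u c)) (drop n v)) ->
  generic E v -> generic E' v.
Proof.
elim: n E E' v => [|n IH] E E' v EE' gE; first by have := EE' [::] erefl I; rewrite drop0; exact.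
apply: generic_fibers; apply: comeager_mono (generic_fiber gE) _ => b vb gb rb.
apply: IH (gb rb) => u un fu.
by have := EE' (b :: u); rewrite drop_behead; apply=> //=; rewrite un.
Qed.

Lemma generic_true v : generic (fun=> True) v.
Proof. exact/generic_densely/densely_box. Qed.

End Generic.

(** * Deciding a colour generically *)

Section Colours.
Implicit Types (E : tail -> Prop) (v w : box) (u : seq letter) (b q : letter) (c : tail).
Implicit Types (X : bool -> tail -> Prop) (l : bool).

Definition allrec c := forall i, recurrent (c i).

Lemma inbox_allrec v c : inbox v c -> allrec c.
Proof. by move=> vc i; exact: (vc i).1. Qed.

Definition agree (T : Type) k (x y : nat -> T) := forall i, (i < k)%N -> x i = y i.

Lemma agree_catw u c c' k : (k <= size u)%N -> agree k (catw u c) (catw u c').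
Proof.
move=> ku i ik; have iu := leq_trans ik ku.
by rewrite !(catwE (fun _ => false)) iu.
Qed.

(** Near a dense set of letters q, and near any given tail, only one of the two
    colours occurs. *)
Definition glued X := forall t c, allrec c -> exists q k l, ext t q /\
  forall b c', recurrent b -> allrec c' -> agree k b q -> agree k c' c ->
    ~ X l (consw b c').

(** Let g run through countably many letters, dense in the cone of t for both
    colours.  A tail c can be chosen such that after each of its initial parts
    the rest is still generic for all these letters.  Then both colours occur
    near c and near every letter q. *)
Lemma glued_not_dense X t v : glued X ->
  ~ (forall l t', prefix t t' -> exists b,
       [/\ ext t' b, recurrent b & generic (fun c => X l (consw b c)) v]).
Proof.
move=> gX dense.
have /choice[g gP] : forall lt' : bool * seq bool, exists b, prefix t lt'.2 ->
    [/\ ext lt'.2 b, recurrent b & generic (fun c => X lt'.1 (consw b c)) v].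
  move=> [l t'] /=; have [/dense-/(_ l)[b bP]|] := pselect (prefix t t' : Prop).
    by exists b.
  by exists (fun _ => false).
have [|n [u w] [/= fu -> gu]|f [f0 fP]] := @dependent_choice_inv (seq letter * box)
  (fun n x => [/\ fits v x.1, x.2 = drop (size x.1) v &
    forall i : bool * seq bool, prefix t i.2 ->
      generic (fun c => X i.1 (consw (g i) (catw x.1 c))) x.2])
  (fun n x y => exists b s, [/\ y.1 = x.1 ++ b :: s, fits x.2 (b :: s) &
     refines y.2 (drop (size (b :: s)) x.2)])
  ([::], v).
- by split=> //=; [rewrite drop0|move=> i /gP[]].
- have /comeager_all cg : forall i : bool * seq bool,
      comeager (head [::] (drop (size u) v)) (fun b => prefix t i.2 -> recurrent b ->
        generic (fun c => X i.1 (consw (g i) (catw (rcons u b) c))) (drop (size u).+1 v)).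
    move=> i; have [ti|nti] := pselect (prefix t i.2 : Prop); last exact: comeagerT.
    apply: comeager_mono (generic_fiber (gu i ti)) _ => b _ gb _ rb.
    move: (gb rb); rewrite -[behead _]drop1 drop_drop add1n.
    by move=> h; apply: generic_mono h _ => c _; rewrite -cats1 catw_cat.
  have [b vb [rb gb]] := baire (comeager_and (comeager_recurrent _) cg).
  exists (rcons u b, drop (size u).+1 v); split.
    exists b, [::]; split=> //=; first by rewrite cats1.
    by rewrite drop_drop add1n; exact: refines_refl.
  split=> /=; first by rewrite -cats1; apply/fits_cat.
    by rewrite size_rcons.
  by move=> i ti; exact: gb.
have [c cP] := @fusion f (fun n => (fP n).2).
have vc : inbox v c by have [_ [c' ->]] := cP 0%N; rewrite f0.
have [q [k [l [tq Xl]]]] := gX t c (inbox_allrec vc).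
pose t' := mkseq q (maxn k (size t)).
have tt' : prefix t t' by apply: mkseq_prefix tq _; rewrite leq_maxr.
have [t'b rb _] := gP (l, t') tt'; have [[fu fw gu] _] := fP k.
have [c' wc' Xc'] := generic_ex (gu (l, t') tt'); rewrite fw in wc'.
have [ku _] := cP k.
have vc' : inbox v (catw (f k).1 c') by apply/inbox_catw.
apply: (Xl (g (l, t')) (catw (f k).1 c')) => //; first exact: inbox_allrec vc'.
- move=> i ik; have it' : (i < maxn k (size t))%N by rewrite leq_max ik.
  by rewrite t'b ?size_mkseq// nth_mkseq.
- have [_ [c1 -> _]] := cP k; exact: agree_catw.
Qed.

(** Otherwise almost all first letters are decided densely.  Neither colour can
    be generic in a whole cone of first letters, so each colour is generic for a
    dense set of first letters in some cone, and a second application gives a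
    common cone and box for both colours.  This contradicts [glued_not_dense]. *)
Lemma undecided_step X w : glued X -> generic (fun c => exists l, X l c) w ->
  (forall w' l, refines w' w -> ~ generic (X l) w') ->
  exists b w', [/\ fits w [:: b], refines w' (behead w),
    generic (fun c => exists l, X l (consw b c)) w' &
    forall w'' l, refines w'' w' -> ~ generic (fun c => X l (consw b c)) w''].
Proof.
move=> gX Xw undec; apply: contrapT => no.
have decided : comeager (head [::] w) (fun b => recurrent b ->
    forall w1, refines w1 (behead w) -> exists w2 l, refines w2 w1 /\
      generic (fun c => X l (consw b c)) w2).
  apply: comeager_mono (generic_fiber Xw) _ => b wb gb rb w1 w1w.
  apply: contrapT => nodec; apply: no; exists b, w1; split=> //.
    exact: generic_refines w1w (gb rb).
  by move=> w2 l w21 g2; apply: nodec; exists w2, l.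
have flip l t w1 : prefix (head [::] w) t -> refines w1 (behead w) ->
    exists t1 w2, [/\ prefix t t1, refines w2 w1 & forall t2, prefix t1 t2 ->
      exists b, [/\ ext t2 b, recurrent b & generic (fun c => X l (consw b c)) w2]].
  move=> wt w1w; apply: contrapT => noflip.
  apply: (undec (t :: w1) (~~ l)); first exact: refines_cons.
  apply: generic_fibers => /=.
  have /comeager_all rare : forall w2 : box, comeager t (fun b => refines w2 w1 ->
      ~ (recurrent b /\ generic (fun c => X l (consw b c)) w2)).
    move=> w2; have [w21|n21] := pselect (refines w2 w1); last exact: comeagerT.
    apply: comeager_local => t1 tt1.
    have [t2 [t12 nob]] : exists t2, prefix t1 t2 /\ ~ exists b,
        [/\ ext t2 b, recurrent b & generic (fun c => X l (consw b c)) w2].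
      apply: contrapT => H; apply: noflip; exists t1, w2; split=> // t2 t12.
      by apply: contrapT => nob; apply: H; exists t2.
    by exists t2 => //; apply: comeagerT => b t2b _ [rb gb]; apply: nob; exists b.
  apply: comeager_mono (comeager_and rare (comeager_sub wt decided)) _.
  move=> b tb [rareb decb] rb; apply: generic_local => w' w'w1.
  have [w2 [l' [w2w' g2]]] := decb rb w' (refines_trans w'w1 w1w).
  exists w2 => //; have -> // : ~~ l = l'.
  have [l'l|] := eqVneq l' l; last by case: (l) (l') => -[].
  case: (rareb w2 (refines_trans w2w' w'w1)); split=> //; by rewrite -l'l.
have [t1 [w1 [wt1 w1w d1]]] := flip true _ _ (prefix_refl _) (refines_refl _).
have [t2 [w2 [t12 w21 d2]]] := flip false _ _ wt1 w1w.
apply: (@glued_not_dense X t2 w2 gX) => -[] t' t2t'; last exact: d2.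
have [b [t'b rb gb]] := d1 t' (prefix_trans t12 t2t').
by exists b; split=> //; exact: generic_refines gb.
Qed.

(** If no box decides the colour, then by [undecided_step] letters can be chosen
    one by one such that the colour stays undecided.  By the second hypothesis
    one of the colours does not occur near the limit, so the other is generic. *)
Lemma decide X v : (forall u, fits v u -> glued (fun l c => X l (catw u c))) ->
  (forall c, allrec c -> exists k l, forall c', allrec c' -> agree k c' c -> ~ X l c') ->
  generic (fun c => exists l, X l c) v ->
  exists w l, refines w v /\ generic (X l) w.
Proof.
move=> gX fin gv; apply: contrapT => undec.
have [|n [u w] [/= fu wv gu un]|f [f0 fP]] := @dependent_choice_inv (seq letter * box)
  (fun n x => [/\ fits v x.1, refines x.2 (drop (size x.1) v),
    generic (fun c => exists l, X l (catw x.1 c)) x.2 &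
    forall w l, refines w x.2 -> ~ generic (fun c => X l (catw x.1 c)) w])
  (fun n x y => exists b s, [/\ y.1 = x.1 ++ b :: s, fits x.2 (b :: s) &
     refines y.2 (drop (size (b :: s)) x.2)])
  ([::], v).
- split=> //=; first by rewrite drop0; exact: refines_refl.
  by move=> w l wv g; apply: undec; exists w, l.
- have [b [w' [fb w'w gb unb]]] := undecided_step (gX u fu) gu un.
  have e l c : X l (catw (rcons u b) c) = X l (catw u (consw b c)).
    by rewrite -cats1 catw_cat.
  have w'd : refines w' (drop (size [:: b]) w) by rewrite drop1.
  exists (rcons u b, w'); split; first by exists b, [::]; rewrite cats1.
  split=> /=.
  + rewrite -cats1; apply/fits_cat; split=> //; exact: fits_refines wv fb.
  + apply: refines_trans w'w _; rewrite size_rcons.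
    have -> : drop (size u).+1 v = behead (drop (size u) v) by rewrite -drop1 drop_drop.
    exact: refines_behead.
  + by apply: generic_mono gb _ => c _ [l Xl]; exists l; rewrite e.
  + move=> w'' l w''w' g; apply: (unb w'' l w''w').
    by apply: generic_mono g _ => c _; rewrite e.
have [c cP] := @fusion f (fun n => (fP n).2).
have vc : inbox v c by have [_ [c' ->]] := cP 0%N; rewrite f0.
have [k [l nX]] := fin c (inbox_allrec vc).
have [[fu wv gu un] _] := fP k; have [ku [c0 cE _]] := cP k.
apply: (un (f k).2 (~~ l)); first exact: refines_refl.
apply: generic_mono gu _ => c' wc' [l' Xl']; have -> // : ~~ l = l'.
have [l'l|] := eqVneq l' l; last by case: (l) (l') => -[].
case: (nX (catw (f k).1 c')); last by rewrite -l'l.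
  apply: (@inbox_allrec v); apply/inbox_catw; split=> //; exact: inbox_refines wc'.
by rewrite cE; exact: agree_catw.
Qed.

End Colours.

(** * A fibre on which a predicate is constant *)

(** The branches of plain threads are those that are not eventually constant. *)
Definition wandering (e : nat -> bool) := forall N d, exists2 i, (N <= i)%N & e i = d.

Lemma iff_asboolN (A P : Prop) : (A <-> P) -> (A <-> ~~ `[< P >]) -> False.
Proof.
move=> AP [h1 h2]; have [p|np] := pselect P.
  by have := h1 (AP.2 p); rewrite (asboolT p).
by apply: (np); apply/AP/h2; rewrite (asboolF np).
Qed.

Lemma wandering_odd e N : (forall i, (N <= i)%N -> e i = odd i) -> wandering e.
Proof.
move=> eo M d; pose i := (maxn M N).*2; exists (i + d)%N.
  by apply: leq_trans (leq_addr _ _); rewrite /i -addnn -[X in (X <= _)%N]addn0 leq_add ?leq_maxl.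
rewrite eo ?oddD ?odd_double ?oddb//; apply: leq_trans (leq_addr _ _).
by rewrite /i -addnn -[X in (X <= _)%N]addn0 leq_add ?leq_maxr.
Qed.

(** The cells [sig ++ mixed d k] make up the cell of [sig] up to branches that are
    eventually constant.  A descent along such cells changes the direction
    infinitely often. *)
Definition mixed d k : seq bool := nseq k.+1 d ++ [:: ~~ d].

Lemma mixed_cover sig e : wandering e -> ext sig e -> exists d k, ext (sig ++ mixed d k) e.
Proof.
move=> we se; pose d := e (size sig); pose n := (size sig).+1.
have chg : exists i, e (n + i)%N == ~~ d.
  by have [i ni ei] := we n (~~ d); exists (i - n)%N; rewrite subnKC// ei.
case: (ex_minnP chg) => k /eqP ek kmin; exists d, k => i.
rewrite size_cat size_cat size_nseq /= addn1 nth_cat => ilt.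
case: ltnP => [/se//|si]; rewrite nth_cat size_nseq nth_nseq.
have [ik|ki] := ltnP (i - size sig) k.+1; last first.
  have -> : (i - size sig - k.+1 = 0)%N by lia.
  by rewrite -ek; congr e; rewrite /n; lia.
move: si; rewrite leq_eqVlt => /predU1P[<- //|si].
have -> : i = (n + (i - n))%N by rewrite subnKC.
apply/eqP; apply: contraT => ei; have := kmin (i - n)%N.
have -> : e (n + (i - n))%N == ~~ d by case: (e _) ei; case: (d).
by move=> /(_ isT); rewrite /n in si *; lia.
Qed.

Section Fibre.
Implicit Types (v w : box) (s u : seq letter) (b q : letter) (c : tail).
Implicit Types (l d : bool) (e r : nat -> bool) (sig tau rho : seq bool).
Context (W : tail -> (nat -> bool) -> Prop).
Context (W_plain : forall c e, allrec c -> wandering e -> exists k, forall c' e',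
  allrec c' -> wandering e' -> agree k c' c -> agree k e' e -> (W c' e' <-> W c e)).
Context (W_glue : forall m c r t, allrec c -> exists q k (P : Prop), ext t q /\
  forall c' e', allrec c' -> wandering e' ->
    (forall i, (i < k)%N -> i <> m -> c' i = c i) -> agree k (c' m) q ->
    agree m e' r -> (forall i, (m < i < k)%N -> e' i = ~~ e' m) -> (W c' e' <-> P)).

(** W has the constant value l on the cell of tau, over the letters of s followed
    by c. *)
Definition colour s tau l c := forall e, wandering e -> ext tau e ->
  (W (catw s c) e <-> l).

Definition constant_on s tau c := exists l, colour s tau l c.

(** The cell of tau reaches the wall in the middle of the cell of rho: it contains
    branches that come close to the wall. *)
Definition touches tau rho := forall k, exists e,
  [/\ wandering e, ext tau e, ext rho e &
      forall i, (size rho < i < k)%N -> e i = ~~ e (size rho)].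

Lemma colour_cat s u tau l c : colour (s ++ u) tau l c = colour s tau l (catw u c).
Proof. by rewrite /colour catw_cat. Qed.

Lemma constant_cat s u tau c : constant_on (s ++ u) tau c = constant_on s tau (catw u c).
Proof. by rewrite /constant_on; under eq_exists do rewrite colour_cat. Qed.

Lemma allrec_catw s c : fits [::] s -> allrec c -> allrec (catw s c).
Proof.
move=> fs rc; apply: (@inbox_allrec [::]); apply/inbox_catw; split=> // i.
by rewrite nth_drop nth_nil; split; [exact: rc|exact: ext_nil].
Qed.

Lemma agree_catw_tail s k c c' : agree k c' c -> agree k (catw s c') (catw s c).
Proof.
move=> cc' i ik; rewrite !(catwE (fun=> false)); case: ifP => // _; apply: cc'; lia.
Qed.

(** At a glued thread on the wall, W has one value, which the colours on both
    sides must take nearby. *)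
Lemma glued_colours s rho (tau : bool -> seq bool) : fits [::] s -> size rho = size s ->
  (forall l, touches (tau l) rho) -> glued (fun l c => colour s (tau l) l c).
Proof.
move=> fs rs tr t c rc; have rb := recurrent_pad [::].
have rbc : allrec (consw (pad [::]) c) by case.
have [q [k [P [tq WP]]]] := W_glue (size s) (nth false rho) t (allrec_catw fs rbc).
exists q, k, (~~ `[< P >]); split=> // b c' rb' rc' bq c'c.
have [e [we te re eN]] := tr (~~ `[< P >]) k.
move=> /(_ e we te); apply: iff_asboolN; apply: WP => //.
- by apply: allrec_catw => // -[].
- move=> i ik im; rewrite !(catwE (fun=> false)); case: ltnP => // si.
  have [j ij] : exists j, (i - size s)%N = j.+1 by exists (i - size s).-1; lia.
  rewrite ij /=; apply: c'c; lia.
- by rewrite (catwE (fun=> false)) ltnn subnn.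
- by move=> i im; rewrite re// rs.
- by move=> i im; rewrite -rs eN// rs.
Qed.

(** Any branch in the cell makes, with c, a plain thread, and W is constant near
    it. *)
Lemma colour_decided s tau : fits [::] s ->
  (exists2 e, wandering e & ext tau e) -> forall c, allrec c ->
  exists k l, forall c', allrec c' -> agree k c' c -> ~ colour s tau l c'.
Proof.
move=> fs [e we te] c rc; have [k Wk] := W_plain (allrec_catw fs rc) we.
exists k, (~~ `[< W (catw s c) e >]) => c' rc' c'c /(_ e we te).
apply: iff_asboolN; apply: Wk => //; [exact: allrec_catw|exact: agree_catw_tail].
Qed.

Lemma touches_prefix tau tau' rho : prefix tau tau' -> touches tau' rho -> touches tau rho.
Proof.
by move=> tt tr k; have [e [we te re eN]] := tr k; exists e; split=> //; exact: ext_prefix te.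
Qed.

Lemma touches_ray d j rho : touches (rho ++ d :: nseq j (~~ d)) rho.
Proof.
move=> k; pose n := size rho; pose K := maxn k (n + j.+1).
exists (fun i => if (i < n)%N then nth false rho i else if i == n then d else
  if (i < K)%N then ~~ d else odd i); split=> [|i|i /[dup] ir ->//|i /andP[ni ik]].
- apply: (@wandering_odd _ (K + n.+1)) => i Ki; do 3![case: ifPn => [|_]; first lia] => //.
- rewrite size_cat /= size_nseq nth_cat => ij; case: ltnP => // ni.
  have [->|ni'] := eqVneq i n; first by rewrite subnn.
  have -> : (i < K)%N by rewrite /K; lia.
  have -> : (i - size rho)%N = (i - n).-1.+1 by rewrite -/n; lia.
  by rewrite /= nth_nseq; case: ifPn => //; rewrite -/n; lia.
- rewrite -/n ltnn eqxx; case: ltnP; first lia.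
  by move=> _; case: eqP; [lia|move=> _]; rewrite /K ifT//; lia.
Qed.

Lemma touches_extension tau n : (size tau <= n)%N ->
  exists2 rho, size rho = n & touches tau rho.
Proof.
move=> tn; exists (tau ++ nseq (n - size tau) false); first by rewrite size_cat size_nseq; lia.
by apply: touches_prefix (touches_ray true 0 _); rewrite -catA prefix_prefix.
Qed.

(** The second part says that, however many letters are appended to s, the cell
    still touches the wall whose depth is the new number of letters. *)
Definition abuts tau rho := touches tau rho /\
  forall n, (size rho <= n)%N -> exists2 rho', size rho' = n & touches tau rho'.

(** Both colours can be decided by [decide].  If they were different, then on the
    common wall both would be generic, against [glued_not_dense]. *)
Lemma same_colour s rho tau tau' v : fits [::] s -> size rho = size s ->
  abuts tau rho -> abuts tau' rho ->
  generic (constant_on s tau) v -> generic (constant_on s tau') v ->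
  generic (fun c => exists l, colour s tau l c /\ colour s tau' l c) v.
Proof.
move=> fs rs [tr tn] [tr' tn'] g g'; apply: generic_local => w wv.
have dec t z : touches t rho ->
    (forall n, (size rho <= n)%N -> exists2 rho', size rho' = n & touches t rho') ->
    generic (constant_on s t) z -> exists w l, refines w z /\ generic (colour s t l) w.
  move=> tt tn0; apply: decide => [u fu|].
    have [|rho' ru tu] := tn0 (size (s ++ u)); first by rewrite rs size_cat leq_addr.
    have fsu : fits [::] (s ++ u).
      apply/fits_cat; split=> //; apply: fits_refines fu => i.
      by rewrite nth_drop !nth_nil prefix0s.
    have -> : (fun l c => colour s t l (catw u c)) = (fun l c => colour (s ++ u) t l c).
      by apply/funext => l; apply/funext => c; rewrite colour_cat.
    exact: glued_colours fsu ru (fun=> tu).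
  by apply: colour_decided => //; have [e [we te _ _]] := tt 0%N; exists e.
have [w1 [l [w1w gl]]] := dec tau w tr tn (generic_refines wv g).
have [w2 [l' [w21 gl']]] := dec tau' w1 tr' tn' (generic_refines (refines_trans w1w wv) g').
exists w2; first exact: refines_trans w1w.
have {}gl := generic_refines w21 gl.
have [ll'|ll'] := eqVneq l l'.
  by subst l'; apply: generic_mono (generic_and gl gl') _ => c _ h; exists l.
exfalso; pose t0 d := if d == l then tau else tau'.
have g0 d : generic (colour s (t0 d) d) w2.
  rewrite /t0; case: eqP => [->//|/eqP dl]; have -> // : d = l'.
  by case: (d) (l) (l') dl ll' => -[] [].
have tr0 d : touches (t0 d) rho by rewrite /t0; case: ifP.
apply: (glued_not_dense (t := head [::] w2) (v := behead w2) (glued_colours fs rs tr0)).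
move=> d t tt; have [b [[rb tb _] gb]] := generic_step
  (generic_refines (refines_cons tt (refines_refl _)) (g0 d)).
by exists b.
Qed.

Lemma abuts1 d rho : abuts (rho ++ [:: d]) rho.
Proof.
split=> [|n]; first exact: (touches_ray d 0).
rewrite leq_eqVlt => /predU1P[<-|rn]; first by exists rho => //; exact: (touches_ray d 0).
by apply: touches_extension; rewrite size_cat addn1.
Qed.

Lemma abuts2 d rho : abuts (rho ++ [:: d; ~~ d]) rho.
Proof.
split=> [|n]; first exact: (touches_ray d 1).
rewrite leq_eqVlt => /predU1P[<-|]; first by exists rho => //; exact: (touches_ray d 1).
rewrite leq_eqVlt => /predU1P[<-|rn]; last first.
  by apply: touches_extension; rewrite size_cat addn2.
exists (rho ++ [:: d]); first by rewrite size_cat addn1.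
have := touches_ray (~~ d) 0 (rho ++ [:: d]); by rewrite -catA.
Qed.

Lemma wandering_ext tau : exists2 e, wandering e & ext tau e.
Proof.
exists (fun i => if (i < size tau)%N then nth false tau i else odd i); last by move=> i ->.
by apply: (@wandering_odd _ (size tau)) => i; rewrite ltnNge => ->.
Qed.

Lemma colour_unique s tau l l' c : colour s tau l c -> colour s tau l' c -> l = l'.
Proof.
have [e we te] := wandering_ext tau; move=> /(_ e we te) h /(_ e we te) h'.
by apply/idP/idP => [/h/h'|/h'/h].
Qed.

Definition alike s tau tau' c := exists l, colour s tau l c /\ colour s tau' l c.

(** The two cells have a wall in common, below k.+1 further letters. *)
Lemma mixed_alike s sig d k v : fits [::] s -> size sig = size s ->
  generic (constant_on s (sig ++ mixed d k)) v ->
  generic (constant_on s (sig ++ mixed d k.+1)) v ->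
  generic (alike s (sig ++ mixed d k) (sig ++ mixed d k.+1)) v.
Proof.
move=> fs ss g g'; pose rho := sig ++ nseq k.+1 d.
have e1 : sig ++ mixed d k = rho ++ [:: ~~ d] by rewrite /rho /mixed catA.
have e2 : sig ++ mixed d k.+1 = rho ++ [:: d; ~~ d].
  by rewrite /rho /mixed -[k.+2]addn1 nseqD -!catA.
apply: (generic_words (n := k.+1)) (generic_and g g') => u us fu /=.
rewrite e1 e2 => gg; have fsu : fits [::] (s ++ u).
  apply/fits_cat; split=> //; apply: fits_refines fu => i.
  by rewrite nth_drop !nth_nil prefix0s.
have rsu : size rho = size (s ++ u) by rewrite !size_cat size_nseq ss us.
have := same_colour fsu rsu (abuts1 (~~ d) rho) (abuts2 d rho)
  (v := drop k.+1 v).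
move=> /(_ _ _)/generic_mono; apply=> [||c _ [l]].
- by apply: generic_mono gg _ => c _ []; rewrite constant_cat.
- by apply: generic_mono gg _ => c _ []; rewrite constant_cat.
- by rewrite !colour_cat; exists l.
Qed.

(** Any two mixed cells are connected by a finite chain of neighbours, and a
    generic tail takes care of countably many conditions. *)
Lemma constant_generic s sig v : fits [::] s -> size sig = size s ->
  (forall d k, generic (constant_on s (sig ++ mixed d k)) v) ->
  generic (constant_on s sig) v.
Proof.
move=> fs ss g.
have turn := same_colour fs ss (abuts2 true sig) (abuts2 false sig) (g true 0%N) (g false 0%N).
have /generic_all along : forall dk : bool * nat,
    generic (alike s (sig ++ mixed dk.1 dk.2) (sig ++ mixed dk.1 dk.2.+1)) v.
  by move=> [d k]; exact: mixed_alike.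
apply: generic_mono (generic_and turn along) _ => c _ [[l [lt lf]] al].
exists l; have all_l d k : colour s (sig ++ mixed d k) l c.
  elim: k => [|k IH]; first by case: d.
  by have [l' [/(colour_unique IH) <-]] := al (d, k).
by move=> e we se; have [d [k dke]] := mixed_cover we se; exact: all_l dke.
Qed.

Definition bad s sig v := [/\ fits [::] s, size sig = size s &
  forall w, refines w v -> ~ generic (constant_on s sig) w].

Lemma bad_step s sig v : bad s sig v -> exists d k u w,
  [/\ size u = k.+2, fits v u, refines w (drop k.+2 v) & bad (s ++ u) (sig ++ mixed d k) w].
Proof.
move=> [fs ss nb]; apply: contrapT => no; apply: (nb v (refines_refl v)).
apply: constant_generic => // d k.
apply: (generic_words (n := k.+2)) (generic_true v) => u us fu _.
apply: generic_local => w wv; apply: contrapT => nw; apply: no.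
exists d, k, u, w; split=> //; split.
- apply/fits_cat; split=> //; apply: fits_refines fu => i.
  by rewrite nth_drop !nth_nil prefix0s.
- by rewrite !size_cat size_nseq /= us ss addn1.
- move=> w' w'w g; apply: nw; exists w' => //.
  by apply: generic_mono g _ => c _; rewrite constant_cat.
Qed.

(** A sequence of bad cells along mixed words gives in the limit a plain thread,
    near which W is constant; thus W is constant on a cell of the sequence. *)
Theorem constant_fibre : exists2 c, allrec c &
  exists l : bool, forall e, wandering e -> (W c e <-> l).
Proof.
have [b0|nb] := pselect (bad [::] [::] [::]); last first.
  have [w g] : exists w, generic (constant_on [::] [::]) w.
    apply: contrapT => no; apply: nb; split=> // w _ g; apply: no.
    by exists w.
  have [c wc [l cl]] := generic_ex g; exists c; first exact: inbox_allrec wc.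
  by exists l => e we; exact: cl.
have [n [[u w] sig] /= B|f [f0 fP]] := @dependent_choice_inv ((seq letter * box) * seq bool)%type
  (fun n x => bad x.1.1 x.2 x.1.2)
  (fun n x y => (exists b s, [/\ y.1.1 = x.1.1 ++ b :: s, fits x.1.2 (b :: s) &
     refines y.1.2 (drop (size (b :: s)) x.1.2)]) /\
     exists d k, y.2 = x.2 ++ mixed d k) (([::], [::]), [::]) b0.
  have [d [k [s [w' [sk fs w'w B']]]]] := bad_step B.
  exists ((u ++ s, w'), sig ++ mixed d k); split=> //; split; last by exists d, k.
  by by case: s sk fs w'w {B'} => // b s <- fs w'w; exists b, s.
have [c cP] := @fusion (fun n => (f n).1) (fun n => (fP n).2.1).
have [|e eP] := @word_limit _ (fun n => (f n).2).
  by move=> n; have [_ [d [k ->]]] := (fP n).2; exists d, (nseq k d ++ [:: ~~ d]).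
have fe n : ext (f n).2 e by rewrite (eP n).2; exact: ext_mkseq.
have we : wandering e.
  move=> N d; have [ln _] := eP N; have := fe N.+1.
  have [_ [d' [k ->]]] := (fP N).2; rewrite /mixed catA => fN.
  have ext_at (x : bool) (t t' : seq bool) : ext (t ++ x :: t') e -> e (size t) = x.
    by move=> /(_ (size t)); rewrite size_cat nth_cat ltnn subnn /= addnS ltnS leq_addr => ->.
  have [->|dd'] := eqVneq d d'.
    exists (size (f N).2) => //; apply: (ext_at _ _ (nseq k d' ++ [:: ~~ d'])).
    by move: fN; rewrite -catA.
  exists (size ((f N).2 ++ nseq k.+1 d')); first by rewrite size_cat (leq_trans ln)// leq_addr.
  by rewrite (ext_at _ _ _ fN); case: (d) (d') dd' => -[].
have rc : allrec c by have [_ [c' ->]] := cP 0%N; rewrite f0; exact: inbox_allrec.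
have [k Wk] := W_plain rc we.
have [[fs ss nb] _] := fP k; have [ku [c0 cE _]] := cP k.
case: (nb (f k).1.2 (refines_refl _)); apply: generic_mono (generic_true _) _ => c' wc' _.
exists `[< W c e >] => e' we' se'; rewrite asboolE; apply: Wk => //.
- exact: allrec_catw (inbox_allrec wc').
- by rewrite cE; exact: agree_catw.
- have [kf _] := eP k; move=> i ik; have il := leq_trans ik kf.
  by rewrite se'// (fe k).
Qed.

End Fibre.

(** * Nearness of threads *)

(** A sequence of pairs of numbers in which every pair occurs infinitely often. *)
Definition slot (j : nat) : nat * nat :=
  if @choice.unpickle ((nat * nat) * nat)%type j is Some (ij, _) then ij else (0, 0)%N.

Lemma slot_often ij N : exists2 j, (N <= j)%N & slot j = ij.
Proof.
pose f n := @choice.pickle ((nat * nat) * nat)%type (ij, n).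
have fK n : slot (f n) = ij by rewrite /slot /f choice.pickleK.
apply: contrapT => no.
have fN n : (f n < N)%N by rewrite ltnNge; apply/negP => Nf; apply: no; exists (f n).
have u : uniq [seq f n | n <- iota 0 N.+1].
  rewrite map_inj_uniq ?iota_uniq// => a b.
  by move/(pcan_inj choice.pickleK) => [].
suff : (size [seq f n | n <- iota 0 N.+1] <= size (iota 0 N))%N.
  by rewrite size_map !size_iota ltnn.
by apply: uniq_leq_size u _ => _ /mapP[n _ ->]; rewrite mem_iota fN.
Qed.

Notation thread := (tail * (nat -> bool))%type.

Section Threads.
Implicit Types (p q r : thread) (m n k i j : nat).

(** The digits of the letters other than m and, in place of the letter m, the
    branch below depth m. *)
Definition datum m p (ij : nat * nat) : bool :=
  if ij.1 == m then (ij.2 < m)%N && p.2 ij.2 else p.1 ij.1 ij.2.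

Definition plain p := allrec p.1 /\ wandering p.2.

(** Branches with the part 0111... from depth m on stand for the wall at depth m.
    The letter m is zero at almost all even places, and at almost all odd places
    it gives the data of the thread, each of them infinitely often. *)
Definition glue m p := [/\ forall i, i <> m -> recurrent (p.1 i), p.2 m = false,
  forall i, (m < i)%N -> p.2 i = true &
  exists N, forall j, (N <= j)%N ->
    p.1 m j.*2 = false /\ p.1 m j.*2.+1 = datum m p (slot j)].

Definition thread_ok p := plain p \/ exists m, glue m p.

Lemma glue_nonrec m p : glue m p -> ~ recurrent (p.1 m).
Proof. by move=> [_ _ _ [N pN]] /(_ N)[j /pN[-> _]]. Qed.

(** The coding letter determines the thread. *)
Lemma glue_unique m p q : glue m p -> glue m q -> p.1 m = q.1 m -> p = q.
Proof.
move=> [rp p0 p1 [N pN]] [rq q0 q1 [N' qN]] pq.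
have dat ij : datum m p ij = datum m q ij.
  have [j Nj <-] := slot_often ij (maxn N N'); rewrite geq_max in Nj.
  by have /andP[/pN[_ <-] /qN[_ <-]] := Nj; rewrite pq.
case: p q rp p0 p1 pN rq q0 q1 qN pq dat => [x e] [y f] /= _ p0 p1 _ _ q0 q1 _ pq dat.
congr pair; apply/funext => i.
  have [->//|im] := eqVneq i m; apply/funext => j.
  by have := dat (i, j); rewrite /datum /= (negbTE im).
have [im|mi|->] := ltngtP i m; last by rewrite p0 q0.
  by have := dat (m, i); rewrite /datum /= eqxx im.
by rewrite p1// q1.
Qed.

Definition coincide n p q := forall i, (i < n)%N ->
  [/\ p.1 i = q.1 i, recurrent (p.1 i) & p.2 i = q.2 i].

Definition turned m n (e : nat -> bool) := forall i, (m < i < n)%N -> e i = ~~ e m.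

(** As far as the first n places show, both threads are near a thread glued at
    depth m. *)
Definition linked m n p q :=
  [/\ forall i, (i < n)%N -> i <> m -> p.1 i = q.1 i /\ recurrent (p.1 i),
      agree n (p.1 m) (q.1 m), agree m p.2 q.2, turned m n p.2 & turned m n q.2].

Definition ynear n p q := coincide n p q \/ exists2 m, (m < n)%N & linked m n p q.

Lemma coincide_le k n p q : (n <= k)%N -> coincide k p q -> coincide n p q.
Proof. by move=> nk pq i ni; apply: pq; exact: leq_trans nk. Qed.

Lemma agree_le (T : Type) k n (x y : nat -> T) : (n <= k)%N -> agree k x y -> agree n x y.
Proof. by move=> nk xy i ni; apply: xy; exact: leq_trans nk. Qed.

Lemma linked_le m k n p q : (n <= k)%N -> linked m k p q -> linked m n p q.
Proof.
move=> nk [pq pqm e pt qt]; split=> // [i ni|||].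
- by apply: pq; exact: leq_trans nk.
- exact: agree_le pqm.
- by move=> i /andP[mi ni]; apply: pt; rewrite mi (leq_trans ni).
- by move=> i /andP[mi ni]; apply: qt; rewrite mi (leq_trans ni).
Qed.

Lemma linked_coincide m n p q : (n <= m)%N -> linked m n p q -> coincide n p q.
Proof.
move=> nm [pq _ e _ _] i ni; have [|-> rp] := pq i ni; first lia.
by split=> //; apply: e; lia.
Qed.

Lemma linked_ynear m n p q : linked m n p q -> ynear n p q.
Proof.
by move=> pq; have [mn|nm] := ltnP m n; [right; exists m|left; exact: linked_coincide pq].
Qed.

Lemma coincide_sym n p q : coincide n p q -> coincide n q p.
Proof. by move=> pq i /pq[e r ->]; rewrite -e. Qed.

Lemma linked_sym m n p q : linked m n p q -> linked m n q p.
Proof.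
move=> [pq pqm e pt qt]; split=> //.
- by move=> i ni im; have [<-] := pq i ni im.
- by move=> i /pqm.
- by move=> i /e.
Qed.

Lemma ynear_sym n p q : ynear n p q -> ynear n q p.
Proof. by move=> [/coincide_sym|[m mn /linked_sym]]; [left|right; exists m]. Qed.

Lemma coincide_linked n m p q r : coincide n.+1 p q -> linked m n.+1 q r -> ynear n p r.
Proof.
move=> pq [qr qrm e qt rt]; have [mn|nm] := ltnP m n; last first.
  left=> i ni; have [-> rq ->] := pq i (ltnW ni).
  by have [|<- _] := qr i (ltnW ni) _; [lia|split=> //; apply: e; lia].
right; exists m => //; split.
- by move=> i ni im; have [-> rq _] := pq i (ltnW ni); have [<- _] := qr i (ltnW ni) im.
- have [-> _ _] := pq m (ltnW mn); exact: agree_le qrm.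
- by move=> i im; have [|_ _ ->] := pq i _; [lia|exact: e].
- move=> i /andP[mi ni]; have [_ _ ->] := pq i (ltnW ni); have [_ _ ->] := pq m (ltnW mn).
  by apply: qt; lia.
- by move=> i mi; apply: rt; lia.
Qed.

Lemma linked_trans m n p q r : linked m n p q -> linked m n q r -> linked m n p r.
Proof.
move=> [pq pqm e pt qt] [qr qrm e' _ rt]; split=> //.
- by move=> i ni im; have [-> ?] := pq i ni im; have [<-] := qr i ni im.
- by move=> i ni; rewrite pqm ?qrm.
- by move=> i ni; rewrite e ?e'.
Qed.

(** If m' < n, then by the first link the branch of q would be constant from
    m.+1 to n, and by the second one it would change after m'.  So m' = n, and
    the second link does not affect the first n places. *)
Lemma linked_near m m' n p q r : (m < m')%N -> (m' < n.+1)%N ->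
  linked m n.+1 p q -> linked m' n.+1 q r -> ynear n p r.
Proof.
move=> mm' m'n [pq pqm e pt qt] [qr qrm e' qt' rt].
have [m'n'|nm'] := ltnP m' n.
  have := qt m'.+1; have := qt m'; have := qt' m'.+1.
  by move=> -> //; [move=> ->//; [move=> /(_ _); case: (q.2 m) => /(_ _)|]|]; lia.
apply: linked_ynear (m) _ _ _ _; split.
- move=> i ni im; have [|-> rp] := pq i _ im; first lia.
  by have [| |<-] := qr i; [lia|lia|].
- by move=> i ni; rewrite pqm; [have [| |->] := qr m; lia|lia].
- by move=> i im; rewrite e// e'//; lia.
- by move=> i mi; apply: pt; lia.
- by move=> i mi; rewrite -e'; [rewrite -(e' m); [apply: qt; lia|lia]|lia].
Qed.

Lemma ynear_trans n p q r : ynear n.+1 p q -> ynear n.+1 q r -> ynear n p r.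
Proof.
move=> [pq|[m mn pq]] [qr|[m' m'n qr]].
- left=> i ni; have [-> ? ->] := pq i (ltnW ni); exact: (qr i (ltnW ni)).
- exact: coincide_linked pq qr.
- apply: ynear_sym; exact: coincide_linked (coincide_sym qr) (linked_sym pq).
- have [mm'|m'm|mm'] := ltngtP m m'.
  + exact: linked_near pq qr.
  + apply: ynear_sym; exact: linked_near m'm mn (linked_sym qr) (linked_sym pq).
  + subst m'; apply: linked_ynear (m) _ _ _ _; apply: linked_le (leqnSn n) _.
    exact: linked_trans pq qr.
Qed.

Lemma glue_linked m k p q : glue m p -> (m < k)%N -> ynear k p q -> linked m k p q.
Proof.
move=> gp mk [/(_ m mk)[_ /(glue_nonrec gp)]//|[m' m'k pq]].
have [<-//|m'm] := eqVneq m' m.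
have [pq' _ _ _ _] := pq; have [|_ /(glue_nonrec gp)//] := pq' m mk.
by apply/nesym/eqP.
Qed.

Lemma ynear_refl n p : thread_ok p -> ynear n p p.
Proof.
move=> [[rp _]|[m [rp p0 p1 _]]]; first by left.
apply: (@linked_ynear m); split=> //.
- by move=> i _ /rp.
- by move=> i /andP[mi _]; rewrite p0 p1.
- by move=> i /andP[mi _]; rewrite p0 p1.
Qed.

(** A wandering branch turns again after every depth m < n, hence it is not near
    the wall there. *)
Lemma plain_coincide n p : plain p -> exists k, forall q, ynear k p q -> coincide n p q.
Proof.
move=> [rp wp].
have [k kP] : exists k, forall m, (m < n)%N -> ~ turned m k p.2.
  elim: n => [|n [k kP]]; first by exists 0%N.
  have [i ni pi] := wp n.+1 (p.2 n).
  exists (maxn k i.+1) => m; rewrite ltnS leq_eqVlt => /predU1P[->|mn] t.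
    by have := t i; rewrite pi ni leq_max leqnn orbT => /(_ isT); case: (p.2 n).
  by apply: (kP m mn) => j /andP[mj jk]; apply: t; rewrite mj leq_max jk.
exists (maxn n k) => q [|[m mk pq]]; first exact: coincide_le (leq_maxl _ _).
have [mn|nm] := ltnP m n; last exact: linked_coincide nm (linked_le (leq_maxl _ _) pq).
have [_ _ _ t _] := pq; case: (kP m mn) => i /andP[mi ik]; apply: t.
by rewrite mi leq_max ik orbT.
Qed.

Definition regular n p := exists k, forall q, ynear k p q -> coincide n p q.

Lemma thread_cases n p : thread_ok p -> regular n p \/ exists2 m, (m < n)%N & glue m p.
Proof.
move=> [/(plain_coincide n)|[m gp]]; first by left.
have [mn|nm] := ltnP m n; first by right; exists m.
left; exists m.+1 => q /(glue_linked gp (ltnSn m)) pq.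
exact: linked_coincide nm (linked_le (leqW nm) pq).
Qed.

Lemma ynear_sep p q : thread_ok p -> thread_ok q -> (forall n, ynear n p q) -> p = q.
Proof.
wlog plain_first : p q / ((exists m, glue m p) -> exists m, glue m q).
  move=> H op oq pq; have [gq|nq] := pselect (exists m, glue m q).
    by apply: H.
  by apply/esym/H => // n; exact/ynear_sym.
move=> op oq pq.
have [pp|np] := pselect (plain p).
  have e n i : (i < n)%N -> p.1 i = q.1 i /\ p.2 i = q.2 i.
    by have [k kP] := plain_coincide n pp; move=> /(kP _ (pq k))[].
  case: p q {pp plain_first op oq pq} e => [x e] [y f] /= ef.
  by congr pair; apply/funext => i; have [] := ef i.+1 i (ltnSn i).
have [m gp] : exists m, glue m p by case: op.
have pqm k : linked m k p q.
  have [mk|km] := ltnP m k; first exact: glue_linked gp mk (pq k).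
  apply: linked_le km (linked_le (leqnSn m) _); exact: glue_linked gp (ltnSn m) (pq _).
have [m' gq] := plain_first (ex_intro _ m gp).
have pqe : p.1 m = q.1 m.
  by apply/funext => i; have [_ + _ _ _] := pqm i.+1; apply.
have m'm : m' = m.
  apply/eqP; apply: contraT => /eqP m'm; have [rq _ _ _] := gq.
  by case: (glue_nonrec gp); rewrite pqe; apply: rq; exact: nesym.
by apply: glue_unique gp _ pqe; rewrite -m'm.
Qed.

Definition approx m n p q :=
  [/\ forall i, (i < n)%N -> i <> m -> p.1 i = q.1 i /\ recurrent (p.1 i),
      agree n (p.1 m) (q.1 m), agree m p.2 q.2 & (turned m n p.2 <-> turned m n q.2)].

Lemma approx_sym m n p q : approx m n p q -> approx m n q p.
Proof.
move=> [pq pqm e t]; split.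
- by move=> i ni im; have [<-] := pq i ni im.
- by move=> i /pqm.
- by move=> i /e.
- exact: iff_sym.
Qed.

Lemma approx_linked m n p p' q q' : approx m n p p' -> approx m n q q' ->
  linked m n p q -> linked m n p' q'.
Proof.
move=> [pp ppm ep tp] [qq qqm eq tq] [pq pqm e pt qt]; split=> //; try exact/tp; try exact/tq.
- move=> i ni im; have [<- rp] := pp i ni im; have [<- _] := qq i ni im.
  exact: pq.
- by move=> i ni; rewrite -ppm ?pqm ?qqm.
- by move=> i ni; rewrite -ep ?e ?eq.
Qed.

Lemma coincide_approx m n p q : (m < n)%N -> coincide n p q -> approx m n p q.
Proof.
move=> mn pq; have em : p.2 m = q.2 m by have [] := pq m mn.
split.
- by move=> i ni _; have [] := pq i ni.
- by move=> i _; have [->] := pq m mn.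
- by move=> i im; have [] := pq i (ltn_trans im mn).
- by split=> t i /[dup] /andP[mi ni] /t; have [_ _ ->] := pq i ni; rewrite em.
Qed.

Lemma linked_approx m n p q : linked m n p q -> approx m n p q.
Proof. by move=> []. Qed.

Lemma ynear_digits n p q i : (i < n)%N -> ynear n p q -> agree n (p.1 i) (q.1 i).
Proof.
move=> ni [/(_ i ni)[-> _ _]//|[m mn [pq pqm _ _ _]]].
by have [->//|im] := eqVneq i m; have [|->] := pq i ni; first exact/eqP.
Qed.

Lemma ynear_linked m n p q : (m < n)%N -> p.1 m <> q.1 m ->
  ynear n p q -> linked m n p q.
Proof.
move=> mn pqm [/(_ m mn)[]//|[m' m'n pq]]; have [<-//|m'm] := eqVneq m' m.
by have [pq' _ _ _ _] := pq; have [|/pqm//] := pq' m mn; exact/nesym/eqP.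
Qed.

Lemma differ_stable m p q : p.1 m <> q.1 m -> exists k, forall p' q',
  ynear k p p' -> ynear k q q' -> p'.1 m <> q'.1 m.
Proof.
move=> pq; have [j pqj] : exists j, p.1 m j <> q.1 m j.
  by apply: contrapT => no; apply: pq; apply/funext => j; apply: contrapT => pqj; apply: no; exists j.
exists (maxn m j).+1 => p' q' pp' qq' e; apply: pqj.
rewrite (ynear_digits _ pp') ?(ynear_digits _ qq') ?e//; rewrite ltnS ?leq_maxl ?leq_maxr//.
Qed.

Lemma ynear_le k n p q : (n <= k)%N -> ynear k p q -> ynear n p q.
Proof.
move=> nk [/(coincide_le nk)|[m _ /(linked_le nk)]]; first by left.
exact: linked_ynear.
Qed.

Definition stable n p q := exists k, forall p' q', ynear k p p' -> ynear k q q' ->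
  (ynear n p' q' <-> ynear n p q).

Lemma stable_sym n p q : stable n p q -> stable n q p.
Proof.
move=> [k kP]; exists k => q' p' qq' pp'; have := kP p' q' pp' qq'.
by move=> [h1 h2]; split=> /ynear_sym h; apply/ynear_sym; [exact: h1|exact: h2].
Qed.

Definition approximable m n p := exists k, forall q, ynear k p q -> approx m n p q.

(** If the letters in place m differ, then near threads can only be linked at
    depth m, and this depends on initial parts of the letter m only. *)
Lemma stable_differ m n p q : (m < n)%N -> p.1 m <> q.1 m ->
  approximable m n p -> approximable m n q -> stable n p q.
Proof.
move=> mn pq [k1 ap] [k2 aq]; have [k3 dpq] := differ_stable pq.
exists (maxn k1 (maxn k2 k3)) => p' q' /[dup] pp' /(ynear_le (leq_maxl _ _))/ap app
  /[dup] qq' /(ynear_le _)/aq aqq.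
have {}aqq : approx m n q q' by apply: aqq; rewrite !leq_max leqnn !orbT.
have le3 : (k3 <= maxn k1 (maxn k2 k3))%N by rewrite !leq_max leqnn !orbT.
have pq' := dpq p' q' (ynear_le le3 pp') (ynear_le le3 qq').
split=> [/(ynear_linked mn pq')|/(ynear_linked mn pq)] h; apply: (@linked_ynear m).
  exact: approx_linked (approx_sym app) (approx_sym aqq) h.
exact: approx_linked app aqq h.
Qed.

Lemma regular_approximable m n p : (m < n)%N -> regular n p -> approximable m n p.
Proof. by move=> mn [k kP]; exists k => q /kP; exact: coincide_approx. Qed.

Lemma glue_approximable m n p : (m < n)%N -> glue m p -> approximable m n p.
Proof.
by move=> mn gp; exists n => q /(glue_linked gp mn); exact: linked_approx.
Qed.

Lemma regular_recurrent m n p : thread_ok p -> (m < n)%N -> regular n p -> recurrent (p.1 m).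
Proof. by move=> op mn [k /(_ p (ynear_refl k op) m mn)[]]. Qed.

Lemma stable_regular n p q : regular n p -> regular n q -> stable n p q.
Proof.
move=> [k1 rp] [k2 rq]; exists (maxn k1 k2) => p' q'.
move=> /(ynear_le (leq_maxl _ _))/rp pp /(ynear_le (leq_maxr _ _))/rq qq.
split=> -[pq|[m mn pq]].
- left=> i ni; have [-> _ ->] := pp i ni; have [-> _ ->] := qq i ni; exact: pq.
- right; exists m => //; apply: approx_linked pq; apply/approx_sym/coincide_approx => //.
- left=> i ni; have [<- _ <-] := pp i ni; have [<- _ <-] := qq i ni; exact: pq.
- right; exists m => //; apply: approx_linked pq; exact: coincide_approx.
Qed.

(** Threads that are glued at the same depth m < n with the same letter m are
    equal.  In all other cases with a glued thread, the letters differ in the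
    place of the glue. *)
Lemma ynear_stable n p q : thread_ok p -> thread_ok q -> stable n p q.
Proof.
have half a b m : thread_ok b -> (m < n)%N -> glue m a -> regular n b -> stable n a b.
  move=> ob mn ga rb; apply: (@stable_differ m) => //.
  - move=> ab; apply: (glue_nonrec ga); rewrite ab; exact: regular_recurrent rb.
  - exact: glue_approximable.
  - exact: regular_approximable.
move=> op oq; have [rp|[m mn gp]] := thread_cases n op.
  have [rq|[m mn gq]] := thread_cases n oq; first exact: stable_regular.
  by apply: stable_sym; exact: half gq rp.
have [rq|[m' m'n gq]] := thread_cases n oq; first exact: half gp rq.
have [m'm|/eqP m'm] := eqVneq m' m.
  subst m'; have [pq|pq] := pselect (p.1 m = q.1 m); last first.
    by apply: (@stable_differ m) => //; exact: glue_approximable.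
  have <- := glue_unique gp gq pq; exists n => p' q' pp' pq'.
  split=> _; first exact: ynear_refl.
  apply: (@linked_ynear m); apply: linked_trans (glue_linked gp mn pq').
  by apply: linked_sym; exact: glue_linked pp'.
have pqm : p.1 m <> q.1 m.
  by move=> e; apply: (glue_nonrec gp); rewrite e; case: gq => rq _ _ _; exact/rq/nesym.
have pqm' : p.1 m' <> q.1 m'.
  by move=> e; apply: (glue_nonrec gq); rewrite -e; case: gp => rp _ _ _; exact: rp.
have far a b : a.1 m <> b.1 m -> a.1 m' <> b.1 m' -> ~ ynear n a b.
  move=> ab ab' /(ynear_linked mn ab)[h _ _ _ _].
  by have [/ab'] := h m' m'n m'm.
have [k1 d1] := differ_stable pqm; have [k2 d2] := differ_stable pqm'.
exists (maxn k1 k2) => p' q' pp' qq'; split=> h; exfalso; last exact: far h.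
apply: far h; [apply: d1|apply: d2].
- exact: ynear_le (leq_maxl _ _) pp'.
- exact: ynear_le (leq_maxl _ _) qq'.
- exact: ynear_le (leq_maxr _ _) pp'.
- exact: ynear_le (leq_maxr _ _) qq'.
Qed.

End Threads.

(** * The space of threads *)

Local Open Scope classical_set_scope.

Section ThreadSpace.

Let S := set_type [set p : thread | thread_ok p].

Let nearS n (p q : S) := ynear n (val p) (val q).

Let S_ok (p : S) : thread_ok (val p).
Proof. exact: set_valP. Qed.

Definition thread_space : clopen_uniformity.
Proof.
apply: (@ClopenUniformity S nearS).
- by move=> p q; left.
- by move=> n p; apply: ynear_refl; exact: S_ok.
- by move=> n p q; exact: ynear_sym.
- by move=> n p q r; exact: ynear_trans.
- by move=> p q pq; apply: val_inj; apply: ynear_sep pq; exact: S_ok.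
- move=> n p q; have [k kP] := ynear_stable n (S_ok p) (S_ok q).
  by exists k => p' q'; exact: kP.
Defined.

Definition bits (p : thread_space) (d : bool) :=
  (val (p : S)).2 0%N = d /\ (val (p : S)).2 1%N = d.

Lemma bits_far (p q : thread_space) : bits p false -> bits q true -> ~ near 2 p q.
Proof.
move=> [p0 p1] [q0 q1] [/(_ 0%N isT)[_ _]|[[|[|//]] _ [_ _ e t _]]].
- by rewrite p0 q0.
- by have := t 1%N isT; rewrite p0 p1.
- by have := e 0%N isT; rewrite p0 q0.
Qed.

(** The glued threads needed in [constant_fibre] exist: the letter q may start
    with any word t before it codes the thread. *)
Theorem bits_inseparable (W : thread_space -> Prop) :
  (forall p, exists k, forall q, near k p q -> (W q <-> W p)) ->
  (forall p, bits p false -> W p) -> (forall p, bits p true -> ~ W p) -> False.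
Proof.
move=> Wloc W0 W1.
pose mk (p : thread) (h : thread_ok p) : thread_space := SigSub (mem_set h).
pose V (c : tail) (e : nat -> bool) := exists h : thread_ok (c, e), W (mk _ h).
have VE c e (h : thread_ok (c, e)) : V c e <-> W (mk _ h).
  split=> [[h' Wh']|]; last by exists h.
  by rewrite (_ : mk _ h = mk _ h')//; apply: val_inj.
have plain_ok c e : allrec c -> wandering e -> thread_ok (c, e) by left.
have [||c rc [l cl]] := @constant_fibre V.
- move=> c e rc we; have [k Wk] := Wloc (mk _ (plain_ok c e rc we)).
  exists k => c' e' rc' we' cc' ee'.
  have := Wk (mk _ (plain_ok c' e' rc' we')).
  move=> h; apply: iff_trans (VE _ _ _) (iff_trans (h _) (iff_sym (VE _ _ _))).
  by left=> i ik /=; rewrite cc'// ee'.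
- move=> m c r t rc; pose e i := if (i < m)%N then r i else (m < i)%N.
  pose q i := if (i < size t)%N then nth false t i else
    if odd i then datum m (c, e) (slot i./2) else false.
  pose x i := if i == m then q else c i.
  have gl : glue m (x, e).
    split=> /= [i /eqP im|||].
    + by rewrite /x (negbTE im); exact: rc.
    + by rewrite /e ltnn.
    + by move=> i mi; rewrite /e mi ltnNge ltnW.
    + exists (size t) => j tj; rewrite /x eqxx /q.
      have -> : (j.*2 < size t)%N = false by lia.
      have -> : (j.*2.+1 < size t)%N = false by lia.
      rewrite /= odd_double /= uphalf_double; split=> //.
      by rewrite /datum /x /=; case: eqP.
  have ok : thread_ok (x, e) by right; exists m.
  have [k Wk] := Wloc (mk _ ok).
  exists q, (maxn k m.+1), (W (mk _ ok)); split; first by move=> i it; rewrite /q it.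
  move=> c' e' rc' we' cc' qc' re' te'; have := Wk (mk _ (plain_ok c' e' rc' we')).
  move=> h; apply: iff_trans (VE _ _ _) (h _).
  apply: (@ynear_le (maxn k m.+1)); first exact: leq_maxl.
  apply: (@linked_ynear m); split=> /=.
  + move=> i ik im; rewrite cc'// /x ifN_eq; last exact/eqP.
    by split.
  + by move=> i ik; rewrite qc'// /x eqxx.
  + by move=> i im; rewrite re'// /e im.
  + by move=> i /andP[mi _]; rewrite /e ltnn mi ltnNge ltnW.
  + by move=> i mi; rewrite te'.
have [e we fe] := wandering_ext [:: false; false].
have [e' we' fe'] := wandering_ext [:: true; true].
have [_ h1] := cl e we; have [h2 _] := cl e' we'.
have Ve : V c e.
  by apply/(VE _ _ (plain_ok c e rc we))/W0; split; [exact: (fe 0%N)|exact: (fe 1%N)].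
have nVe' : ~ V c e'.
  by move=> /(VE _ _ (plain_ok c e' rc we')); apply: W1; split; [exact: (fe' 0%N)|exact: (fe' 1%N)].
by apply: nVe'; apply/(cl e' we'); apply/(cl e we).
Qed.

End ThreadSpace.

(** * Dyadic neighbourhoods *)

Local Open Scope ring_scope.

Section Dyadic.
Context {R : realType}.
Implicit Types (t s u : R) (n m k : nat).

Lemma pow2_gt0 n : 0 < 2 ^+ n :> R.
Proof. by rewrite exprn_gt0. Qed.

Lemma pow2_neq0 n : 2 ^+ n != 0 :> R.
Proof. by rewrite gt_eqF ?pow2_gt0. Qed.

Lemma dyadic_ord_neq k j n m : (n < m)%N ->
  (k.*2.+1)%:R / 2 ^+ n <> (j.*2.+1)%:R / 2 ^+ m :> R.
Proof.
move=> nm /eqP; rewrite eqr_div ?pow2_neq0//.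
rewrite -!natrX -!natrM eqr_nat => /eqP e.
move: e; rewrite -(subnKC (ltnW nm)) expnD mulnCA -[RHS]mulnC => /eqP.
rewrite eqn_pmul2l ?expn_gt0// => /eqP e.
have : odd (k.*2.+1 * 2 ^ (m - n)) = odd j.*2.+1 by rewrite e.
by rewrite oddM oddX subn_eq0 leqNgt nm /= !odd_double.
Qed.

Lemma has_dyadic_ord_unique t n m : has_dyadic_ord t n -> has_dyadic_ord t m -> n = m.
Proof.
have pos k i : has_dyadic_ord (k.*2.+1%:R / 2 ^+ i.+1 : R) 0 -> False.
  move=> [/eqP|]; first by rewrite mulf_eq0 invr_eq0 pnatr_eq0/= (negbTE (pow2_neq0 _)).
  by move=> e; apply: (@dyadic_ord_neq 0 k 0 i.+1) => //; rewrite e expr0 divr1.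
case: n m => [|n] [|m] //=.
- by move=> h [k tk]; case: (pos k m); rewrite -tk.
- by move=> [k tk] h; case: (pos k n); rewrite -tk.
move=> [k ->] [j]; have [nm|mn|->//] := ltngtP n m.
- by move/dyadic_ord_neq; rewrite ltnS => /(_ nm).
- by move/esym/dyadic_ord_neq; rewrite ltnS => /(_ mn).
Qed.

Lemma dyadic_ordP t m : dyadic_ord t = Some m <-> has_dyadic_ord t m.
Proof.
rewrite /dyadic_ord; case: pselect => [e|ne]; last by split=> // tm; case: ne; exists m.
case: cid => n /= tn; split=> [[<-]//|tm]; congr Some.
exact: has_dyadic_ord_unique tn tm.
Qed.

Lemma dyadic_has_ord k n : (k <= 2 ^ n)%N ->
  exists2 m, (m <= n)%N & has_dyadic_ord (k%:R / 2 ^+ n : R) m.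
Proof.
elim: n k => [|n IH] k.
  rewrite expn0 => k1; exists 0%N => //; rewrite expr0 divr1.
  by case: k k1 => [|[|]]; [left|right|].
have [ko _|ke kn] := boolP (odd k).
  by exists n.+1 => //; exists k./2; rewrite -{1}(odd_double_half k) ko.
have k2 : k = (k./2).*2 by rewrite -{1}(odd_double_half k) (negbTE ke).
have [|m mn mk] := IH k./2; first by move: kn; rewrite {1}k2 expnS -mul2n leq_pmul2l.
exists m; first exact: leqW.
suff -> : k%:R / 2 ^+ n.+1 = (k./2)%:R / 2 ^+ n :> R by [].
rewrite {1}k2 -mul2n natrM exprS; have := pow2_gt0 n; set x := 2 ^+ n => x0.
by field; rewrite gt_eqF.
Qed.

Lemma dyadic_ord_leP t n : 0 <= t <= 1 ->
  dyadic_ord_le t n <-> exists2 k, (k <= 2 ^ n)%N & t = k%:R / 2 ^+ n.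
Proof.
move=> /andP[t0 t1]; rewrite /dyadic_ord_le; split=> [|[k kn tk]]; last first.
  by have [m mn] := dyadic_has_ord kn; rewrite -tk => /dyadic_ordP ->.
case E : dyadic_ord => [m|//] mn; move/dyadic_ordP : E.
suff H : has_dyadic_ord t m -> exists k, t = k%:R / 2 ^+ n.
  move=> /H[k tk]; exists k => //; move: t1; rewrite tk ler_pdivrMr ?pow2_gt0// mul1r.
  by rewrite -natrX ler_nat.
case: m mn => [_ [->|->]|m mn [k ->]]; first by exists 0%N; rewrite mul0r.
  by exists (2 ^ n)%N; rewrite natrX divff ?pow2_neq0.
exists (k.*2.+1 * 2 ^ (n - m.+1))%N; rewrite natrM natrX -{2}(subnK mn) exprD.
by field; rewrite !pow2_neq0.
Qed.

(** The ends of [dyadic_nbhd n t] are dyadic numbers of order at most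
    [cut_order t n]. *)
Definition cut_order t n : nat := if dyadic_ord_le t n then n.+1 else n.

(** P is one of the inequalities that define a dyadic neighbourhood; it may be
    void at an end of the unit interval. *)
Definition cut t n (P : R -> Prop) := (forall s, 0 <= s <= 1 -> P s) \/
  exists u m, [/\ has_dyadic_ord u m, (m <= cut_order t n)%N, Some m <> dyadic_ord t &
    (forall s, P s <-> s < u) \/ (forall s, P s <-> u < s)].

Lemma dyadic_ord_le_neq t n m : dyadic_ord_le t n = false -> (m <= n)%N ->
  Some m <> dyadic_ord t.
Proof. by move=> h mn e; move: h; rewrite /dyadic_ord_le -e mn. Qed.

Lemma dyadic_ord_le_neqS t n : dyadic_ord_le t n -> Some n.+1 <> dyadic_ord t.
Proof. by move=> + e; rewrite /dyadic_ord_le -e ltnn. Qed.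

Lemma cut_below t n u m : has_dyadic_ord u m -> (m <= cut_order t n)%N ->
  Some m <> dyadic_ord t -> cut t n (fun s => s < u).
Proof. by move=> um mt mo; right; exists u, m; split=> //; left. Qed.

Lemma cut_above t n u m : has_dyadic_ord u m -> (m <= cut_order t n)%N ->
  Some m <> dyadic_ord t -> cut t n (fun s => u < s).
Proof. by move=> um mt mo; right; exists u, m; split=> //; right. Qed.

Lemma dyadic_nbhd_inner t n : 0 < t < 1 -> exists u v,
  [/\ forall s, dyadic_nbhd n t s <-> u < s < v, u < t < v, v - u <= (2 ^+ n)^-1,
      cut t n (fun s => u < s) & cut t n (fun s => s < v)].
Proof.
move=> /andP[t0 t1]; have t01 : 0 <= t <= 1 by rewrite !ltW.
have x0 := pow2_gt0 n; have xn0 := pow2_neq0 n.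
have [k kE] : exists k : nat, Num.floor (2 ^+ n * t) = k%:Z.
  by exists `|Num.floor (2 ^+ n * t)|%N; rewrite gez0_abs// floor_ge0 mulr_ge0// ltW.
have /andP[kt tk] : k%:R <= 2 ^+ n * t < k.+1%:R.
  by have := floor_itv (2 ^+ n * t); rewrite kE -PoszD addn1 -!pmulrn.
have {}kt : k%:R / 2 ^+ n <= t by rewrite ler_pdivrMr// mulrC.
have {}tk : t < k.+1%:R / 2 ^+ n by rewrite ltr_pdivlMr// mulrC.
have kn : (k < 2 ^ n)%N.
  by rewrite -(ltr_nat R) natrX -[ltRHS]mul1r -ltr_pdivrMr// (le_lt_trans kt).
have eS : 2 ^+ n.+1 = 2 * 2 ^+ n :> R by rewrite exprS.
exists (dyadic_left n t), (dyadic_right n t).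
split; first by move=> s; rewrite /dyadic_nbhd (gt_eqF t0) (lt_eqF t1) /= in_itv/=.
all: rewrite /dyadic_left /dyadic_right kE; case E : (dyadic_ord_le t n).
- have [j _ tj] := (dyadic_ord_leP n t01).1 E.
  have jk : j = k.
    move: kt tk; rewrite tj ler_pM2r ?ltr_pM2r ?invr_gt0// ler_nat ltr_nat ltnS => kj jk.
    by apply/eqP; rewrite eqn_leq kj jk.
  rewrite tj jk eS intrB intrD intrM -pmulrn.
  have -> : (2 * k%:R - 1) / (2 * 2 ^+ n) = k%:R / 2 ^+ n - (2 ^+ n)^-1 / 2 :> R by field.
  have -> : (2 * k%:R + 1) / (2 * 2 ^+ n) = k%:R / 2 ^+ n + (2 ^+ n)^-1 / 2 :> R by field.
  have : 0 < (2 ^+ n)^-1 :> R by rewrite invr_gt0.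
  by lra.
- rewrite -PoszD addn1 -!pmulrn tk andbT lt_neqAle kt andbT; apply/eqP => e.
  suff : dyadic_ord_le t n by rewrite E.
  by apply/(dyadic_ord_leP n t01); exists k => //; exact: ltnW.
- rewrite eS intrB intrD intrM -pmulrn le_eqVlt; apply/orP; left; apply/eqP; field.
  exact: xn0.
- rewrite intrD -!pmulrn le_eqVlt; apply/orP; left; apply/eqP; field.
  exact: xn0.
- apply: (@cut_above _ _ _ n.+1); rewrite /cut_order ?E//; last exact: dyadic_ord_le_neqS.
  have k0 : (0 < k)%N.
    have [j _ tj] := (dyadic_ord_leP n t01).1 E; move: tk t0; rewrite tj.
    rewrite ltr_pM2r ?invr_gt0// pmulr_lgt0 ?invr_gt0// ltr_nat ltr0n ltnS.
    by move=> jk j0; exact: leq_trans jk.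
  exists k.-1; have -> : k.-1.*2.+1%:R = (2 * k%:Z - 1)%:~R :> R; last by [].
  by rewrite pmulrn; congr (_%:~R); lia.
- have [m mn um] := dyadic_has_ord (ltnW kn); rewrite -pmulrn.
  by apply: (@cut_above _ _ _ m) => //; [rewrite /cut_order E|exact: dyadic_ord_le_neq E mn].
- apply: (@cut_below _ _ _ n.+1); rewrite /cut_order ?E//; last exact: dyadic_ord_le_neqS.
  exists k; have -> : k.*2.+1%:R = (2 * k%:Z + 1)%:~R :> R; last by [].
  by rewrite pmulrn; congr (_%:~R); lia.
- have [m mn um] := dyadic_has_ord kn; rewrite -PoszD addn1 -pmulrn.
  by apply: (@cut_below _ _ _ m) => //; [rewrite /cut_order E|exact: dyadic_ord_le_neq E mn].
Qed.

Lemma dyadic_nbhd_spec t n : 0 <= t <= 1 ->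
  [/\ dyadic_nbhd n t t, forall s, dyadic_nbhd n t s -> `|s - t| < (2 ^+ n)^-1 &
      exists P Q, [/\ cut t n P, cut t n Q &
        forall s, 0 <= s <= 1 -> dyadic_nbhd n t s <-> P s /\ Q s]].
Proof.
move=> t01; have /andP[t0 t1] := t01.
have x0 := pow2_gt0 n; have xn0 := pow2_neq0 n.
have xi : 0 < (2 ^+ n)^-1 :> R by rewrite invr_gt0.
have h2 : 1 / 2 ^+ n.+1 = (2 ^+ n)^-1 / 2 :> R by rewrite exprS; field.
have ord0 : dyadic_ord (0 : R) = Some 0%N by apply/dyadic_ordP; left.
have ord1 : dyadic_ord (1 : R) = Some 0%N by apply/dyadic_ordP; right.
have [t_0|tn0] := eqVneq t 0.
  have nE s : dyadic_nbhd n t s <-> 0 <= s < 1 / 2 ^+ n.+1.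
    by rewrite t_0 /dyadic_nbhd eqxx /= in_itv.
  rewrite t_0 in nE *; split=> [|s|]; first by apply/nE; rewrite h2; lra.
    by move=> /nE; rewrite h2 subr0 => /andP[s0 ?]; rewrite ger0_norm//; lra.
  exists (fun=> True), (fun s => s < 1 / 2 ^+ n.+1); split; first by left.
    apply: (@cut_below _ _ _ n.+1); [by exists 0%N| |by rewrite ord0].
    by rewrite /cut_order /dyadic_ord_le ord0.
  by move=> s /andP[s0 _]; split=> [/nE/andP[]//|[_ ?]]; apply/nE; rewrite s0.
have [t_1|tn1] := eqVneq t 1.
  have nE s : dyadic_nbhd n t s <-> 1 - 1 / 2 ^+ n.+1 < s <= 1.
    by rewrite t_1 /dyadic_nbhd oner_eq0 eqxx /= in_itv.
  rewrite t_1 in nE *; split=> [|s|]; first by apply/nE; rewrite h2; lra.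
    by move=> /nE; rewrite h2 => /andP[? s1]; rewrite ler0_norm ?subr_le0//; lra.
  exists (fun s => 1 - 1 / 2 ^+ n.+1 < s), (fun=> True); split; [|by left|].
    apply: (@cut_above _ _ _ n.+1); [|by rewrite /cut_order /dyadic_ord_le ord1|by rewrite ord1].
    exists (2 ^ n).-1.
    have -> : (2 ^ n).-1.*2.+1 = (2 ^ n.+1 - 1)%N by rewrite expnS; have := expn_gt0 2 n; lia.
    by rewrite natrB ?expn_gt0// natrX mulrBl divff ?pow2_neq0.
  by move=> s /andP[_ s1]; split=> [/nE/andP[]//|[? _]]; apply/nE; rewrite s1 andbT.
have t_in : 0 < t < 1 by rewrite !lt_neqAle t0 t1 tn1 eq_sym tn0.
have [u [v [nE utv uv cu cv]]] := dyadic_nbhd_inner n t_in.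
split=> [|s|]; first exact/nE.
  by move=> /nE usv; rewrite ltr_norml; lra.
exists (fun s => u < s), (fun s => s < v); split=> // s _.
by split=> [/nE/andP[]//|[? ?]]; apply/nE/andP.
Qed.

End Dyadic.

(** * A clopen uniformity on numu0 *)

Section Families.
Context (T : choiceType) (I : countType) (B : I -> T -> Prop).
Context (B_sep : forall p q, (forall i, B i p <-> B i q) -> p = q).

Let near_B n p q := forall i, (choice.pickle i < n)%N -> (B i p <-> B i q).

(** Nearness of order n means that the first n sets of the family do not separate
    the two points. *)
Definition family_uniformity : clopen_uniformity.
Proof.
apply: (@ClopenUniformity T near_B).
- by move=> p q i; rewrite ltn0.
- by move=> n p i.
- by move=> n p q pq i ni; exact: iff_sym (pq i ni).
- move=> n p q r pq qr i ni; apply: iff_trans (pq i _) (qr i _); exact: ltnW.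
- by move=> p q pq; apply: B_sep => i; exact: (pq (choice.pickle i).+1).
- move=> n p q; exists n => p' q' pp' qq'; split=> pq i ni.
    by apply: iff_trans (pp' i ni) (iff_trans (pq i ni) (iff_sym (qq' i ni))).
  by apply: iff_trans (iff_sym (pp' i ni)) (iff_trans (pq i ni) (qq' i ni)).
Defined.

Lemma family_nearE n (p q : family_uniformity) : near n p q <->
  forall i, (choice.pickle i < n)%N -> (B i p <-> B i q).
Proof. by []. Qed.

Lemma family_near i : exists n, forall p q : family_uniformity,
  near n p q -> (B i p <-> B i q).
Proof. by exists (choice.pickle i).+1 => p q; exact. Qed.

End Families.

Section NumuPoints.
Context {R : realType}.
Local Notation X := (numu0 R sigma2).
Implicit Types (p q : X) (n m i j : nat) (t : seq bool).

Lemma numu0_time_itv p : 0 <= numu0_time p <= 1.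
Proof. by have [] := set_valP p; rewrite in_itv. Qed.

Lemma numu0_letter p i : Some i <> dyadic_ord (numu0_time p) -> sigma2 (numu0_seq p i).
Proof. by have [_ h _] := set_valP p; exact: h. Qed.

Lemma numu0_letterN p i : Some i = dyadic_ord (numu0_time p) -> ~ sigma2 (numu0_seq p i).
Proof. by have [_ _ h] := set_valP p; exact: h. Qed.

Definition finword t : cantor_space := fun j => nth false t j.

Lemma sigma2_finword a : sigma2 a <-> exists t, a = finword t.
Proof.
split=> [fa|[t ->]]; last first.
  rewrite /sigma2/=; apply: (@sub_finite_set _ _ `I_(size t)); last exact: finite_II.
  move=> j /= jt; rewrite ltnNge; apply/negP => tj.
  by move: jt; rewrite /finword nth_default.
have [N aN] : exists N, forall j, (N <= j)%N -> a j = false.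
  have /finite_fsetP[D aD] := fa.
  exists (\max_(j <- D) j).+1 => j Dj; apply/negbTE/negP => aj.
  have : j \in D by have : [set` D] j by rewrite -aD.
  move=> jD; have := leq_bigmax_seq (F := id) j jD (isT : xpredT j).
  by rewrite leqNgt Dj.
exists (mkseq a N); apply/funext => j; rewrite /finword.
have [jN|Nj] := ltnP j N; first by rewrite nth_mkseq.
by rewrite nth_default ?size_mkseq ?aN.
Qed.

Definition dyadic (k m : nat) : R :=
  if m is 0 then (0 < k)%N%:R else (k.*2.+1)%:R / 2 ^+ m.

Lemma dyadic_ordE k m : has_dyadic_ord (dyadic k m) m.
Proof. by case: m => [|m] /=; [case: ltnP; [right|left]|exists k]. Qed.

Lemma has_dyadic_ordE (u : R) m : has_dyadic_ord u m -> exists k, u = dyadic k m.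
Proof. by case: m => [[|]->|m [k ->]]; [exists 0%N|exists 1%N|exists k]. Qed.

Local Notation code := ((nat * nat) + ((nat * seq bool) + (nat * nat * seq bool)))%type.

(** The countable family of clopen sets. *)
Definition mark (x : code) p : Prop :=
  match x with
  | inl (i, j) => numu0_seq p i j
  | inr (inl (i, t)) => numu0_seq p i = finword t
  | inr (inr (k, m, t)) => numu0_seq p m = finword t /\ numu0_time p < dyadic k m
  end.

Lemma numu0_ord_time p m k : sigma2 (numu0_seq p m) -> numu0_time p <> dyadic k m.
Proof.
move=> pm pk; apply: (@numu0_letterN p m) pm; apply/esym/dyadic_ordP; rewrite pk.
exact: dyadic_ordE.
Qed.

Lemma numu0_eq p q : numu0_seq p = numu0_seq q -> numu0_time p = numu0_time q -> p = q.
Proof.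
move=> e e'; apply: val_inj; rewrite [LHS]surjective_pairing [RHS]surjective_pairing.
by congr pair.
Qed.

Lemma dyadic_between (s u : R) N : 0 <= s -> s < u -> exists k m, (N < m)%N /\ s < dyadic k m < u.
Proof.
move=> s0 su.
have d0 : 0 < u - s by rewrite subr_gt0.
pose m := (maxn N (Num.bound (3 / (u - s)))).+1.
have mu : 3 / 2 ^+ m < u - s.
  rewrite ltr_pdivrMr ?exprn_gt0// mulrC -ltr_pdivrMr//.
  apply: lt_trans (archi_boundP _) _; first by rewrite divr_ge0// ltW.
  rewrite -natrX ltr_nat; apply: leq_ltn_trans (ltn_expl m (isT : 1 < 2)%N).
  by rewrite /m leqW// leq_maxr.
have m0 : 0 < 2 ^+ m :> R by rewrite exprn_gt0.
have [k kE] : exists k : nat, Num.floor (2 ^+ m * s / 2) = k%:Z.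
  exists `|Num.floor (2 ^+ m * s / 2)|%N; rewrite gez0_abs// floor_ge0 divr_ge0//.
  by rewrite mulr_ge0// ltW.
have /andP[k1 k2] : k%:R <= 2 ^+ m * s / 2 < k.+1%:R.
  by have := floor_itv (2 ^+ m * s / 2); rewrite kE -PoszD addn1 -!pmulrn.
have kR : k.+1.*2.+1%:R = 2 * k%:R + 3 :> R.
  have -> : k.+1.*2.+1 = (2 * k + 3)%N by lia.
  by rewrite natrD natrM.
(* The number for k itself may lie below s; the one for k.+1 exceeds s by at
   most three units. *)
exists k.+1, m; split; first by rewrite /m ltnS leq_maxl.
have -> : dyadic k.+1 m = (2 * k%:R + 3) / 2 ^+ m by rewrite /dyadic /m -/m kR.
have mu' : 3 < (u - s) * 2 ^+ m by rewrite -ltr_pdivrMr.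
have k2' : 2 ^+ m * s / 2 < k%:R + 1 by rewrite natr1.
by apply/andP; split; [rewrite ltr_pdivlMr//|rewrite ltr_pdivrMr//]; lra.
Qed.

Lemma mark_sep p q : (forall x, mark x p <-> mark x q) -> p = q.
Proof.
wlog st : p q / numu0_time p <= numu0_time q.
  move=> H pq; have [|qp] := leP (numu0_time p) (numu0_time q).
    by move/H; apply.
  by apply: esym; apply: H => [|x]; [exact: ltW|exact: iff_sym].
move=> pq; have e : numu0_seq p = numu0_seq q.
  by apply/funext => i; apply/funext => j; apply/idP/idP => h; exact/(pq (inl (i, j))).
apply: numu0_eq => //; apply/eqP; apply: contraT => tn.
have {}st : numu0_time p < numu0_time q by rewrite lt_neqAle tn.
have /andP[p0 _] := numu0_time_itv p.
pose N := if dyadic_ord (numu0_time p) is Some n then n else 0%N.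
have [k [m [Nm /andP[pu uq]]]] := dyadic_between N p0 st.
have /sigma2_finword[t pt] : sigma2 (numu0_seq p m).
  by apply: numu0_letter => mo; move: Nm; rewrite /N -mo ltnn.
have [/(_ _)[//|_ qu] _] := pq (inr (inr (k, m, t))).
by have := lt_trans qu uq; rewrite ltxx.
Qed.

Definition numu0_uniformity : clopen_uniformity := family_uniformity mark_sep.

Lemma near_mark x : exists n, forall p q : numu0_uniformity,
  near n p q -> (mark x p <-> mark x q).
Proof. exact: family_near. Qed.

Lemma near_and (P Q : X -> Prop) (p : numu0_uniformity) :
  (exists n, forall q, near n p q -> P q) -> (exists n, forall q, near n p q -> Q q) ->
  exists n, forall q : numu0_uniformity, near n p q -> P q /\ Q q.
Proof.
move=> [n nP] [m mQ]; exists (maxn n m) => q pq; split.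
  by apply/nP/near_le/pq; rewrite leq_maxl.
by apply/mQ/near_le/pq; rewrite leq_maxr.
Qed.

Lemma near_all (P : nat -> X -> Prop) (p : numu0_uniformity) N :
  (forall i, (i < N)%N -> exists n, forall q, near n p q -> P i q) ->
  exists n, forall q : numu0_uniformity, near n p q -> forall i, (i < N)%N -> P i q.
Proof.
elim: N => [|N IH] PN; first by exists 0%N.
have [|n nP] := IH; first by move=> i iN; apply: PN; exact: leqW.
have [m mP] := PN N (ltnSn N); exists (maxn n m) => q pq i.
rewrite ltnS leq_eqVlt => /predU1P[->|iN].
  by apply/mP/near_le/pq; rewrite leq_maxr.
by apply: nP iN; apply/near_le/pq; rewrite leq_maxl.
Qed.

Lemma near_letter (p : numu0_uniformity) i : sigma2 (numu0_seq p i) ->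
  exists n, forall q : numu0_uniformity, near n p q -> numu0_seq q i = numu0_seq p i.
Proof.
move=> /sigma2_finword[t pt]; have [n nP] := near_mark (inr (inl (i, t))).
by exists n => q /nP[/(_ pt) qt _]; rewrite qt pt.
Qed.

Lemma near_digit (p : numu0_uniformity) i j :
  exists n, forall q : numu0_uniformity, near n p q -> numu0_seq q i j = numu0_seq p i j.
Proof.
have [n nP] := near_mark (inl (i, j)).
by exists n => q /nP[h1 h2]; apply/idP/idP.
Qed.

(** As the letter m of p is a finite word, nearby points q have the same letter
    in place m and hence a time different from u. *)
Lemma near_side (p : numu0_uniformity) (u : R) m : has_dyadic_ord u m ->
  sigma2 (numu0_seq p m) -> exists n, forall q : numu0_uniformity, near n p q ->
  (numu0_time q < u) = (numu0_time p < u) /\ (u < numu0_time q) = (u < numu0_time p).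
Proof.
move=> /has_dyadic_ordE[k uk] pm; have /sigma2_finword[t pt] := pm.
have [n nP] := near_letter pm; have [n' n'P] := near_mark (inr (inr (k, m, t))).
exists (maxn n n') => q pq.
have qm : numu0_seq q m = numu0_seq p m by apply/nP/near_le/pq; rewrite leq_maxl.
have qk : mark (inr (inr (k, m, t))) p <-> mark (inr (inr (k, m, t))) q.
  by apply/n'P/near_le/pq; rewrite leq_maxr.
have lt_eq : (numu0_time q < u) = (numu0_time p < u).
  rewrite uk; case: qk => /= h1 h2; apply/idP/idP => h.
    by have [] := h2 (conj (etrans qm pt) h).
  by have [] := h1 (conj pt h).
split=> //; have := @numu0_ord_time p m k pm; have := @numu0_ord_time q m k.
rewrite qm -uk => /(_ pm)/eqP qu /eqP pu.
by rewrite !lt_neqAle !leNgt lt_eq ![u == _]eq_sym qu pu.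
Qed.

Lemma near_cut (p : numu0_uniformity) (p' : X) n P : cut (numu0_time p') n P ->
  (forall i, (i <= cut_order (numu0_time p') n)%N -> Some i <> dyadic_ord (numu0_time p') ->
     sigma2 (numu0_seq p i)) ->
  P (numu0_time p) -> exists m, forall q : numu0_uniformity, near m p q -> P (numu0_time q).
Proof.
move=> [PT|[u [m [um mn mo PE]]]] ps Pp.
  by exists 0%N => q _; apply: PT; exact: numu0_time_itv.
have [k kP] := near_side um (ps m mn mo); exists k => q /kP[h1 h2].
by case: PE => PE; apply/PE; rewrite ?h1 ?h2; apply/PE.
Qed.

Lemma basic_nbhdE n p q : basic_nbhd n p q <->
  [/\ dyadic_nbhd n (numu0_time p) (numu0_time q),
      forall i, (i <= cut_order (numu0_time p) n)%N -> Some i <> dyadic_ord (numu0_time p) ->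
        numu0_seq q i = numu0_seq p i &
      dyadic_ord_le (numu0_time p) n -> forall i, Some i = dyadic_ord (numu0_time p) ->
        forall j, (j < n.+1)%N -> numu0_seq q i j = numu0_seq p i j].
Proof.
rewrite /basic_nbhd /cut_order; case E : (dyadic_ord_le _ n).
  by split=> [[? ? h]|[? ? /(_ isT)]]; split.
split=> [[? h]|[? h _]]; split=> //.
  by move=> i ilt _; exact: h.
by move=> i ilt; apply: h => //; exact: dyadic_ord_le_neq E ilt.
Qed.

(** A basic neighbourhood is cut out by finite words in places other than the
    order of its centre, by finitely many digits, and by two inequalities for the
    time, at dyadic numbers whose order is the place of one of these words. *)
Lemma near_basic (p : numu0_uniformity) p' n : basic_nbhd n p' p ->
  exists m, forall q : numu0_uniformity, near m p q -> basic_nbhd n p' q.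
Proof.
move=> /basic_nbhdE[pt pl pd]; have [_ _ [P [Q [cP cQ PQ]]]] := dyadic_nbhd_spec n (numu0_time_itv p').
have ps i : (i <= cut_order (numu0_time p') n)%N -> Some i <> dyadic_ord (numu0_time p') ->
    sigma2 (numu0_seq p i) by move=> ilt io; rewrite pl//; exact: numu0_letter.
have [Pp Qp] := (PQ _ (numu0_time_itv p)).1 pt.
have time := near_and (near_cut cP ps Pp) (near_cut cQ ps Qp).
have lets := @near_all (fun i q => Some i <> dyadic_ord (numu0_time p') ->
  numu0_seq q i = numu0_seq p' i) p (cut_order (numu0_time p') n).+1.
have digs := @near_all (fun j q => forall i, Some i = dyadic_ord (numu0_time p') ->
  dyadic_ord_le (numu0_time p') n -> numu0_seq q i j = numu0_seq p' i j) p n.+1.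
have [||m mP] := near_and time (near_and (lets _) (digs _)).
- move=> i ilt; have [io|io] := pselect (Some i = dyadic_ord (numu0_time p')).
    by exists 0%N.
  have [k kP] := near_letter (ps i ilt io); exists k => q /kP -> _; exact: pl.
- move=> j jn; case E : (dyadic_ord (numu0_time p')) => [i|]; last by exists 0%N.
  have [k kP] := near_digit p i j; exists k => q /kP qp _ [->] le.
  by rewrite qp; apply: pd => //; rewrite E.
- exists m => q /mP[/(PQ _ (numu0_time_itv q)) qt [ql qd]]; apply/basic_nbhdE; split=> //.
  by move=> le i io j jn; exact: qd.
Qed.

Lemma basic_nbhd_refl n p : basic_nbhd n p p.
Proof. by apply/basic_nbhdE; have [] := dyadic_nbhd_spec n (numu0_time_itv p). Qed.

Lemma basic_nbhd_digit n p q i j : basic_nbhd n p q -> (i <= n)%N -> (j <= n)%N ->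
  numu0_seq q i j = numu0_seq p i j.
Proof.
move=> /basic_nbhdE[_ ql qd] ilt jlt.
have [io|io] := pselect (Some i = dyadic_ord (numu0_time p)).
  by apply: qd => //; rewrite /dyadic_ord_le -io.
by rewrite ql// /cut_order; case: ifP => // _; exact: leqW.
Qed.

(** A letter that is not a finite word differs from a given finite word in one
    digit, and so do nearby letters. *)
Lemma mark_open x p : exists n, forall q, basic_nbhd n p q -> (mark x q <-> mark x p).
Proof.
have letter m t : exists n, forall q, basic_nbhd n p q ->
    (numu0_seq q m = finword t <-> numu0_seq p m = finword t).
  have [mo|mo] := pselect (Some m = dyadic_ord (numu0_time p)); last first.
    exists m => q /basic_nbhdE[_ ql _]; rewrite ql//.
    by rewrite /cut_order; case: ifP.
  have [j pj] : exists j, numu0_seq p m j <> finword t j.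
    apply: contrapT => no; apply: (numu0_letterN mo); apply/sigma2_finword; exists t.
    by apply/funext => j; apply: contrapT => pj; apply: no; exists j.
  exists (maxn m j) => q /basic_nbhd_digit qp; split=> e; exfalso; apply: pj.
    by rewrite -e qp ?leq_maxl ?leq_maxr.
  by rewrite e.
case: x => [[i j]|[[m t]|[[k m] t]]] /=.
- exists (maxn i j) => q /basic_nbhd_digit ->; rewrite ?leq_maxl ?leq_maxr//.
- exact: letter.
have [n nP] := letter m t; have [pm|pm] := pselect (numu0_seq p m = finword t); last first.
  by exists n => q /nP[h1 h2]; split=> -[? ?]; case: pm => //; exact: h1.
have pu : 0 < `|dyadic k m - numu0_time p|.
  rewrite normr_gt0 subr_eq0 eq_sym; apply/eqP; apply: numu0_ord_time.
  by apply/sigma2_finword; exists t.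
pose N := maxn m (Num.bound `|dyadic k m - numu0_time p|^-1).
have Nd : (2 ^+ N)^-1 < `|dyadic k m - numu0_time p|.
  rewrite -[ltRHS]invrK ltf_pV2 ?posrE ?invr_gt0 ?exprn_gt0//.
  apply: lt_trans (archi_boundP _) _; first by rewrite invr_ge0 ltW.
  rewrite -natrX ltr_nat; apply: leq_ltn_trans (ltn_expl N (isT : 1 < 2)%N).
  by rewrite leq_maxr.
have ps : sigma2 (numu0_seq p m) by apply/sigma2_finword; exists t.
exists N => q /basic_nbhdE[qt ql _].
have -> : numu0_seq q m = numu0_seq p m.
  apply: ql => [|mo]; last exact: numu0_letterN ps.
  by rewrite /cut_order; case: ifP => _; [apply: leqW|]; rewrite leq_maxl.
have [_ /(_ _ qt) near_t _] := dyadic_nbhd_spec N (numu0_time_itv p).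
suff -> : (numu0_time q < dyadic k m) = (numu0_time p < dyadic k m) by [].
have {near_t} := lt_trans near_t Nd; move: (dyadic k m) => u.
case: (ltP (numu0_time p) u) => pu'.
  have d0 : 0 < u - numu0_time p by rewrite subr_gt0.
  by rewrite (gtr0_norm d0) ltr_norml => /andP[_ h]; apply/idP; lra.
have d0 : u - numu0_time p <= 0 by rewrite subr_le0.
rewrite (ler0_norm d0) ltr_norml => /andP[h _].
by apply/negbTE; rewrite -leNgt; lra.
Qed.

Lemma numu0_nbhsP (p : X) (V : set X) :
  nbhs p V <-> exists n, forall q, @near numu0_uniformity n p q -> V q.
Proof.
split=> [|[n nV]].
  rewrite nbhsE => -[U [oU Up] UV].
  have [n nU] : exists n, forall q, @near numu0_uniformity n p q -> U q.
    case: oU => /= F FS UE; move: Up; rewrite -UE => -[E FE Ep].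
    have [D DS DE] := FS _ FE; rewrite -DE in Ep.
    have near_D (s : seq (set X)) : {subset s <= D} -> exists n, forall q,
        @near numu0_uniformity n p q -> forall S, S \in s -> S q.
      elim: s => [|S s IH] sD; first by exists 0%N.
      have [|n nP] := IH; first by move=> S' S's; apply: sD; rewrite inE S's orbT.
      have SD : S \in D by apply: sD; rewrite mem_head.
      have /set_mem[k [p' SE]] := DS _ SD.
      have [m mP] : exists m, forall q, @near numu0_uniformity m p q -> S q.
        by rewrite SE; apply: near_basic; rewrite -SE; exact: Ep.
      exists (maxn n m) => q pq S'; rewrite inE => /predU1P[->|S's].
        by apply/mP/near_le/pq; rewrite leq_maxr.
      by apply: nP S's; apply/near_le/pq; rewrite leq_maxl.
    have [n nP] := near_D D (fun _ => id); exists n => q pq; exists E => //.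
    by rewrite -DE => S SD; exact: nP.
  by exists n => q /nU; exact: UV.
have base k p' : open (basic_nbhd k p' : set X).
  exists [set (basic_nbhd k p' : set X)]; last by rewrite bigcup_set1.
  by move=> S ->; apply: finI_from1; exists k, p'.
suff: nbhs p [set q | @near numu0_uniformity n p q] by apply: filterS => q /nV.
have near_x x : nbhs p [set q | mark x p <-> mark x q].
  have [k kP] := mark_open x p; suff : nbhs p (basic_nbhd k p).
    by apply: filterS => q /kP qp; exact: iff_sym.
  exact: open_nbhs_nbhs (conj (base k p) (basic_nbhd_refl k p)).
elim: n {nV} => [|n IH]; first by apply: filterE => q; exact: near0.
have near_n : nbhs p [set q | forall x, choice.pickle x = n -> (mark x p <-> mark x q)].
  have [[x xn]|no] := pselect (exists x : code, choice.pickle x = n).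
    apply: filterS (near_x x) => q px y yn.
    by have <- : x = y by apply: (pcan_inj choice.pickleK); rewrite xn yn.
  by apply: filterE => q x xn; case: no; exists x.
apply: filterS (filterI IH near_n) => q [/family_nearE pq qn]; apply/family_nearE => x.
by rewrite ltnS leq_eqVlt => /predU1P[/qn//|xn]; exact: pq.
Qed.

End NumuPoints.

Local Close Scope ring_scope.

(** * The sum of the two spaces *)

Section Sums.
Context (X Y : clopen_uniformity).

Let near_sum n (p q : X + Y) := match p, q with
  | inl x, inl y => near n x y
  | inr x, inr y => near n x y
  | _, _ => n = 0%N
  end.

Definition sum_uniformity : clopen_uniformity.
Proof.
apply: (@ClopenUniformity (X + Y)%type near_sum).
- by move=> [x|x] [y|y] //=; exact: near0.
- by move=> n [x|x]; exact: near_refl.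
- by move=> n [x|x] [y|y] //=; exact: near_sym.
- by move=> n [x|x] [y|y] [z|z] //=; exact: near_trans.
- move=> [x|x] [y|y] xy; try by have := xy 1%N.
    by congr inl; exact: near_sep.
  by congr inr; exact: near_sep.
- move=> n [x|x] [y|y].
  + have [k kP] := near_clopen n x y; exists k.+1 => -[x'|x'] [y'|y'] //= xx yy.
    by apply: kP; [exact: near_le xx|exact: near_le yy].
  + by exists 1%N => -[x'|x'] [y'|y'].
  + by exists 1%N => -[x'|x'] [y'|y'].
  + have [k kP] := near_clopen n x y; exists k.+1 => -[x'|x'] [y'|y'] //= xx yy.
    by apply: kP; [exact: near_le xx|exact: near_le yy].
Defined.

End Sums.

Section Separation.
Context (R : realType) (Z : clopen_uniformity).
Let G : topologicalGroupType := boolean_group R Z.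

Definition near_closure (E : Z -> Prop) (z : Z) := forall n, exists2 z', near n z z' & E z'.

Lemma near_closure_closed (E : Z -> Prop) (z : Z) : ~ near_closure E z ->
  exists n, forall z', near n z z' -> ~ near_closure E z'.
Proof.
move=> nE; have [n nP] : exists n, forall z', near n z z' -> ~ E z'.
  apply: contrapT => no; apply: nE => n; apply: contrapT => nz; apply: no.
  by exists n => z' zz' Ez'; apply: nz; exists z'.
exists n.+1 => z' zz' /(_ n.+1)[z'' z'z''].
exact/nP/near_trans/z'z''.
Qed.

Lemma covering_separation (E F : Z -> Prop) n :
  (forall p q, E p -> F q -> ~ near n p q) -> covering_dim_le_pred 1 G ->
  exists W : Z -> Prop, [/\ forall p, exists k, forall q, near k p q -> (W q <-> W p),
    forall p, E p -> W p & forall p, F p -> ~ W p].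
Proof.
move=> EF dimG.
(* E and F need not be closed: a glued thread may lie in the closure of a set
   of plain threads. *)
pose A : set G := [set ([fset z]%fset : G) | z in near_closure E].
pose B : set G := [set ([fset z]%fset : G) | z in near_closure F].
have cA : closed A by apply: closed_singletons => z; exact: near_closure_closed.
have cB : closed B by apply: closed_singletons => z; exact: near_closure_closed.
have AB0 : A `&` B = set0.
  rewrite -subset0 => _ [[z Ez <-] [z' Fz' /fset1_inj zz']]; subst z'.
  have [p zp Ep] := Ez n.+1; have [q zq Fq] := Fz' n.+1.
  exact: EF Ep Fq (near_trans (near_sym zp) zq).
have [W [oW oCW AW BW]] := separating_clopen cA cB AB0 dimG.
exists (fun z => W [fset z]%fset); split=> [p|p Ep|p Fp].
- have [Wp|nWp] := pselect (W [fset p]%fset).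
    have /nbhs_singleton[k kP] := open_nbhs_nbhs (conj oW Wp).
    by exists k => q /kP.
  have /nbhs_singleton[k kP] := open_nbhs_nbhs (conj oCW nWp).
  by exists k => q /kP Wq; split.
- by apply: AW; exists p => // k; exists p => //; exact: near_refl.
- by apply: BW; exists p => // k; exists p => //; exact: near_refl.
Qed.

End Separation.

Section SumGroup.
Context (R : realType).
Let X : clopen_uniformity := @numu0_uniformity R.
Let Z := sum_uniformity X thread_space.
Let G : topologicalGroupType := boolean_group R Z.

(** The first summand is closed because points of different summands are not
    near. *)
Lemma numu0_embeds : embeds_as_closed_subspace (numu0 R sigma2) G.
Proof.
apply: (@singletons_embed R Z (numu0 R sigma2) (fun s => inl (s : X))).
- by move=> s s' [].
- move=> s V; rewrite numu0_nbhsP; split=> -[n nV]; exists n => s'; exact: nV.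
- move=> [s|y] nz; first by case: nz; exists s.
  by exists 1%N.
Qed.

Lemma sum_dim_gt0 : (0 < covering_dim G)%E.
Proof.
have not1 : ~ covering_dim_le_pred 1 G.
  pose E d (z : Z) := if z is inr y then bits y d else False.
  have EF p q : E false p -> E true q -> ~ near 2 p q.
    by case: p q => [?|p] [?|q] //; exact: bits_far.
  move=> /(covering_separation EF)[W [Wloc W0 W1]].
  apply: (@bits_inseparable (fun y => W (inr y))) => [y|y yb|y yb].
  - by have [k kP] := Wloc (inr y); exists k => y'; exact: (kP (inr y')).
  - exact: W0.
  - exact: W1.
apply: dim_value_gt0 => // dim0; apply: not1 => k U /dim0[m [V [oV VU V0]]].
by exists m, V; split=> // x; apply: leq_trans (V0 x) _.
Qed.

End SumGroup.

Theorem mainTheorem2 (R : realType) :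
  (exists G : topologicalGroupType,
     [/\ metrizable R G,
         embeds_as_closed_subspace (numu0 R sigma2) G,
         small_ind G = 0%E
       & (0 < covering_dim G)%E]) /\
  (exists G : topologicalGroupType, metrizable R G /\ small_ind G <> covering_dim G).
Proof.
pose G : topologicalGroupType := boolean_group R (sum_uniformity (@numu0_uniformity R) thread_space).
split; exists G.
  split; [exact: boolean_group_metrizable|exact: numu0_embeds
    |exact: boolean_group_ind|exact: sum_dim_gt0].
split; first exact: boolean_group_metrizable.
by rewrite boolean_group_ind => dim0; have := sum_dim_gt0 R; rewrite -dim0 ltxx.
Qed.
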